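(* Let $f:X\to X$ be a continuous and locally injective transformation of the compact metric space $X$ and let $\mu$ be a Borel probability measure on $X$ which is $f$-invariant and ergodic. Let $J_f(\mu)$ be the Jacobian of $\mu$ with respect to $f$. If the set $D$ of discontinuities of $J_f(\mu)$ is closed and has $\mu$-measure zero, and if $J_f(\mu)$ is bounded, then the inverse metric entropy $h^-_{f,B}(\mu)$ of $\mu$ exists and $$h^-_{f,B}(\mu)=h_f(\mu)-F_f(\mu).$$
   Context: $h_f(\mu)$ is the usual measure-theoretic entropy. Inverse limit: $\widehat X=\{\hat x=(x_0,x_{-1},x_{-2},\ldots): x_{-i}\in X,\ f(x_{-i})=x_{-i+1},\ i\ge 1\}$ (elements are called prehistories of $x=x_0$), $\pi(\hat x)=x_0$, $\hat f(x_0,x_{-1},\ldots)=(f(x_0),x_0,x_{-1},\ldots)$; $\hat\mu$ is the unique $\hat f$-invariant ergodic probability measure on $\widehat X$ with $\pi_*\hat\mu=\mu$. Inverse metric entropy: for $\hat x\in\widehat X$, $\varepsilon>0$, $n\ge1$, $$B_n^-(\hat x,\varepsilon)=\{y\in X:\exists\,\hat y\in\widehat X,\ y_0=y,\ d(x_{-i},y_{-i})<\varepsilon,\ 0\le i\le n\}.$$ Put $h^-_{f,inf,B}(\mu,\hat x)=\lim_{\varepsilon\to0}\liminf_{n\to\infty}\frac{-\log\mu(B_n^-(\hat x,\varepsilon))}{n}$ and $h^-_{f,sup,B}(\mu,\hat x)=\lim_{\varepsilon\to0}\limsup_{n\to\infty}\frac{-\log\mu(B_n^-(\hat x,\varepsilon))}{n}$,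 and $h^-_{f,inf,B}(\mu)=\int h^-_{f,inf,B}(\mu,\hat x)\,d\hat\mu(\hat x)$, $h^-_{f,sup,B}(\mu)=\int h^-_{f,sup,B}(\mu,\hat x)\,d\hat\mu(\hat x)$. The inverse metric entropy exists if the last two numbers are equal, and then $h^-_{f,B}(\mu)$ is their common value. Jacobian and folding entropy: $f$ is assumed positively non-singular with respect to $\mu$, i.e. $\mu(A)=0$ implies $\mu(f(A))=0$. If $\{A_0,A_1,\ldots\}$ is a countable measurable partition of $X$ with $f$ injective on each $A_i$, then $J_f(\mu)(x)=\frac{d(\mu\circ f|_{A_i})}{d\mu}(x)$ for $\mu$-a.e. $x\in A_i$; it does not depend on the partition and is $\ge1$ $\mu$-a.e. Discontinuities and boundedness refer to a fixed everywhere-defined version of $J_f(\mu)$ with values $\geq 1$. The folding entropy is $F_f(\mu)=H_\mu(\epsilon\,|\,f^{-1}\epsilon)$, where $\epsilon$ is the partition of $X$ into single points and $f^{-1}\epsilon$ the partition into fibers $f^{-1}(x)$; equivalently $F_f(\mu)=\int_X\log J_f(\mu)\,d\mu$. *)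

(* Defs.v *)
From HB Require Import structures.
From mathcomp Require Import all_boot all_order all_algebra.
From mathcomp Require Import all_classical all_reals all_analysis.

Set Implicit Arguments.
Unset Strict Implicit.
Unset Printing Implicit Defensive.

Import Order.TTheory GRing.Theory Num.Theory.
Import numFieldNormedType.Exports.

Local Open Scope classical_set_scope.
Local Open Scope ring_scope.

(* Measurable types are pointed in the library, hence the base point.  It costs
   nothing here: a space that carries a probability measure is nonempty. *)
#[short(type="pmetricType")]
HB.structure Definition PointedMetric (K : numDomainType) :=
  {M of Pointed M & Metric K M}.

Notation borel T := (g_sigma_algebraType (@open T)).

Definition invariant_measure d (T : measurableType d) (R : realType)
    (f : T -> T) (mu : set T -> \bar R) : Prop :=
  forall A, measurable A -> mu (f @^-1` A) = mu A.

Definition ergodic d (T : measurableType d) (R : realType)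
    (f : T -> T) (mu : set T -> \bar R) : Prop :=
  forall A, measurable A -> f @^-1` A = A -> mu A = 0%E \/ mu A = 1%E.

Definition locally_injective (X : topologicalType) (f : X -> X) : Prop :=
  forall x : X, exists2 U, nbhs x U & {in U &, injective f}.

(* [lne 0 = -oo] and [0 * -oo = 0] in [\bar R], so [xlogx_opp 0 = 0]. *)
Definition xlogx_opp (R : realType) (p : \bar R) : \bar R := (- (p * lne p))%E.

(* Cells may be empty. *)
Definition measurable_partition d (T : measurableType d) (I : Type)
    (A : I -> set T) : Prop :=
  [/\ forall i, measurable (A i), trivIset setT A & \bigcup_i A i = setT].

Section metric_entropy.
Context d (T : measurableType d) (R : realType).
Variables (f : T -> T) (mu : probability T R).

(* The cells of the join of the partitions f^{-i} A, i < n, are indexed by the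
   words w of length n. *)
Definition itinerary_cell k (A : 'I_k -> set T) n (w : {ffun 'I_n -> 'I_k}) :
    set T :=
  [set x | forall i : 'I_n, A (w i) (iter i f x)].

Definition join_entropy k (A : 'I_k -> set T) (n : nat) : \bar R :=
  (\sum_(w : {ffun 'I_n -> 'I_k}) xlogx_opp (mu (itinerary_cell A w)))%E.

Definition partition_entropy k (A : 'I_k -> set T) : \bar R :=
  limn (fun n => (n%:R^-1)%:E * join_entropy A n)%E.

Definition metric_entropy : \bar R :=
  ereal_sup [set h | exists k (A : 'I_k -> set T),
    measurable_partition A /\ h = partition_entropy A].

End metric_entropy.

Section jacobian.
Context d (T : measurableType d) (R : realType).
Variables (f : T -> T) (mu : probability T R).

Definition positively_nonsingular : Prop :=
  forall A, measurable A -> mu A = 0%E -> mu (f @` A) = 0%E.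

(* [J] is an everywhere defined version, with values at least 1, of the function
   equal on each A_i to the density of mu o f|_{A_i} with respect to mu. *)
Definition is_jacobian (J : T -> R) : Prop :=
  [/\ measurable_fun setT J,
      forall x, 1 <= J x
    & exists A : nat -> set T,
      [/\ measurable_partition A,
          forall i, {in A i &, injective f}
        & forall i E, measurable E -> E `<=` A i ->
            mu (f @` E) = (\int[mu]_(x in E) (J x)%:E)%E]].

End jacobian.

Section folding_entropy.
Context d (T : measurableType d) (R : realType).

(* Entropy of the partition into points: infinite unless the measure is carried
   by countably many points. *)
Definition point_entropy (nu : set T -> \bar R) : \bar R :=
  if `[< exists S, [/\ measurable S, countable S & nu (~` S) = 0%E] >]
  then (\esum_(y in [set: T]) xlogx_opp (nu [set y]))%E
  else +oo%E.

(* Canonical system of conditional measures for the partition into fibers: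
   [kappa x] is the conditional measure on f^{-1}(x).  As f^{-1}(x) |-> x carries
   the quotient measure to the image of mu by f, which is mu when mu is
   invariant, conditional measures are integrated against mu. *)
Definition fiber_disintegration (f : T -> T) (mu : probability T R)
    (kappa : R.-pker T ~> T) : Prop :=
  (forall A, measurable A -> mu A = (\int[mu]_x kappa x A)%E) /\
  {ae mu, forall x, kappa x (f @^-1` [set x]) = 1%E}.

(* H_mu(eps | f^{-1} eps) for an f-invariant mu, in Rohlin's sense: the mean
   entropy of the point partition for the conditional measures on the fibers.
   These are unique up to a null set, so that there is a single value to get. *)
Definition folding_entropy (f : T -> T) (mu : probability T R) : \bar R :=
  xget 0%E [set h | exists2 kappa : R.-pker T ~> T,
    fiber_disintegration f mu kappa
    & h = (\int[mu]_x point_entropy (kappa x))%E].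

End folding_entropy.

Section inverse_entropy.
Context (R : realType) (X : pmetricType R).
Variables (f : X -> X).

(* The coordinate x_{-i} of a prehistory is [xh i]. *)
Definition inverse_limit : set {ptws nat -> X} :=
  [set xh | forall i, f (xh i.+1) = xh i].

(* \hat f, extended by the same formula to all sequences. *)
Definition inverse_limit_map (xh : {ptws nat -> X}) : {ptws nat -> X} :=
  fun i => if i is j.+1 then xh j else f (xh 0%N).

(* Borel measures on the inverse limit are given as Borel measures on the product
   space carried by the closed set [inverse_limit].  The preimage of a set by the
   extended map differs from its preimage by \hat f only by null sets, and
   invariant subsets of [inverse_limit] are the same for both maps, so that
   invariance and ergodicity are those of \hat f. *)
Definition is_inverse_limit_lift (mu : probability (borel X) R)
    (muh : probability (borel {ptws nat -> X}) R) : Prop :=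
  [/\ muh inverse_limit = 1%E,
      invariant_measure (inverse_limit_map : borel {ptws nat -> X} -> _) muh,
      ergodic (inverse_limit_map : borel {ptws nat -> X} -> _) muh
    & forall A : set (borel X), measurable A ->
        muh ((fun xh : {ptws nat -> X} => xh 0%N) @^-1` A) = mu A].

Definition inverse_bowen_ball (n : nat) (xh : {ptws nat -> X}) (e : R) : set X :=
  [set y | exists2 yh, inverse_limit yh
    & yh 0%N = y /\ forall i, (i <= n)%N -> mdist (xh i) (yh i) < e].

Variables (mu : probability (borel X) R)
  (muh : probability (borel {ptws nat -> X}) R).

Definition inverse_ball_rate (xh : {ptws nat -> X}) (e : R) (n : nat) : \bar R :=
  ((n%:R^-1)%:E * - lne (mu (inverse_bowen_ball n xh e)))%E.

Definition local_inverse_entropy_inf (xh : {ptws nat -> X}) : \bar R :=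
  lim ((fun e => limn_einf (inverse_ball_rate xh e)) @ 0^'+).

Definition local_inverse_entropy_sup (xh : {ptws nat -> X}) : \bar R :=
  lim ((fun e => limn_esup (inverse_ball_rate xh e)) @ 0^'+).

Definition inverse_entropy_inf : \bar R :=
  (\int[muh]_(xh in inverse_limit) local_inverse_entropy_inf xh)%E.

Definition inverse_entropy_sup : \bar R :=
  (\int[muh]_(xh in inverse_limit) local_inverse_entropy_sup xh)%E.

Definition inverse_entropy_exists : Prop :=
  inverse_entropy_inf = inverse_entropy_sup.

(* Meaningful under [inverse_entropy_exists]. *)
Definition inverse_entropy : \bar R := inverse_entropy_inf.

End inverse_entropy.

Definition discontinuities (X Y : topologicalType) (g : X -> Y) : set X :=
  [set x | ~ {for x, continuous g}].

(* Main.v *)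
(* The law of the past of a point makes the left shift [S] of prehistories an
   ergodic system, and the past ball of radius [e] around [xh] is a Bowen ball of
   [S].  Brin-Katok for [S] therefore says that its measure decays like
   [exp (- n h)], where [h], the entropy of [f], is also that of [S].  Pushing the
   past ball forward from time [-n] to time [0], where [f] is injective at small
   scale, multiplies the measure by the Jacobian at each step, so that the inverse
   Bowen ball has measure about [exp (sum_(i < n) ln J (x_(-i-1)))] times that of
   the past ball; the variation of [ln J] on small balls is small off a
   neighbourhood of its discontinuities of small measure, and bounded everywhere.
   By Birkhoff's theorem the sum is about [n] times the integral of [ln J], which
   is the folding entropy.

   The entropy bounds rest on Gibbs' inequality and its almost sure version
   applied to one family of distributions on words: words are parsed greedily into
   blocks taken from small codebooks, up to noise. *)

Require Import Defs.
From HB Require Import structures.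
From mathcomp Require Import all_boot all_order all_algebra.
From mathcomp Require Import all_classical all_reals all_analysis.
From mathcomp Require Import measurable_realfun lra ring zify.

Import Order.TTheory GRing.Theory Num.Theory.
Import numFieldNormedType.Exports.

Set Implicit Arguments.
Unset Strict Implicit.
Unset Printing Implicit Defensive.

Local Open Scope classical_set_scope.
Local Open Scope ring_scope.

(** * Ergodic sums *)

(** The obstacle in the lower entropy bound is that past balls are not subordinate to a partition: a
    small ball near a boundary sees several labels, and [mu] may charge the boundary. Cells are
    therefore shrunk to closed cores at positive distance from each other, and times spent off the
    cores count as transmission errors. The price of an error depends on the tolerance [eta], so
    [eta] is fixed before the cores, whose complement is then made small against that price.

    Ergodicity enters as a dichotomy. The points where some quantity is too large infinitely often
    form a forward invariant set; if it is not null, almost every point meets such times, and the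
    waiting time can be bounded by a constant off a small set.

    Birkhoff's theorem appears as an upper bound for nonnegative functions. The lower bound for
    [ln J] is the upper one for [L - ln J], available because [J] is bounded.

    The conditional measures behind the folding entropy are made explicit by finitely many inverse
    branches with weights [1 / J]; invariance of [mu] makes these weights add up to 1 almost
    everywhere. *)

Definition birkhoff_sum (T : Type) (R : realType) (S : T -> T) (g : T -> R)
  (n : nat) (x : T) : R := \sum_(t < n) g (iter t S x).

Section birkhoff_sum.
Context (T : Type) (R : realType) (S : T -> T).
Implicit Types g : T -> R.

Lemma birkhoff_sum0 g x : birkhoff_sum S g 0 x = 0.
Proof. by rewrite /birkhoff_sum big_ord0. Qed.

Lemma birkhoff_sumD g m n x :
  birkhoff_sum S g (m + n) x = birkhoff_sum S g m x + birkhoff_sum S g n (iter m S x).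
Proof.
rewrite /birkhoff_sum big_split_ord/=; congr (_ + _).
by apply: eq_bigr => i _; rewrite addnC iterD.
Qed.

Lemma birkhoff_sumS g n x :
  birkhoff_sum S g n.+1 x = g x + birkhoff_sum S g n (S x).
Proof. by rewrite -add1n birkhoff_sumD/= {1}/birkhoff_sum big_ord1. Qed.

Lemma birkhoff_sum_ge0 g n x : (forall y, 0 <= g y) -> 0 <= birkhoff_sum S g n x.
Proof. by move=> g0; apply: sumr_ge0. Qed.

Lemma birkhoff_sum_add g h n x :
  birkhoff_sum S (g \+ h) n x = birkhoff_sum S g n x + birkhoff_sum S h n x.
Proof. by rewrite /birkhoff_sum big_split. Qed.

Lemma birkhoff_sumZ (c : R) g n x :
  birkhoff_sum S (fun y => c * g y) n x = c * birkhoff_sum S g n x.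
Proof. by rewrite /birkhoff_sum mulr_sumr. Qed.

Lemma birkhoff_sum_cst (c : R) n x : birkhoff_sum S (fun=> c) n x = c * n%:R.
Proof. by rewrite /birkhoff_sum sumr_const card_ord mulr_natr. Qed.

(** A Katznelson-Weiss stopping argument: off [B] a whole block of length at most [N] is paid by
    [psi], on [B] a single letter is paid [c]. It serves Birkhoff's bound with
    [l n x = a n - S_n phi x], and coding with [l] the code length of an itinerary. *)
Lemma greedy_parse (c : R) (N : nat) (B : set T) (psi : T -> R) (l : nat -> T -> R) :
  0 <= c -> (forall x, 0 <= psi x) ->
  (forall x, l 0%N x <= 0) ->
  (forall n x, l n.+1 x <= c + l n (S x)) ->
  (forall x, ~ B x -> exists m, [/\ (0 < m)%N, (m <= N)%N &
     forall n, l (m + n)%N x <= birkhoff_sum S psi m x + l n (iter m S x)]) ->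
  forall n x,
    l n x <= birkhoff_sum S psi n x + c * birkhoff_sum S (\1_B) n x + c * N%:R.
Proof.
move=> c0 psi0 l0 lS lB.
have short n x : l n x <= c * n%:R.
  elim: n x => [|n IH] x; first by rewrite mulr0.
  by rewrite (le_trans (lS _ _))// mulrS mulrDr mulr1 lerD2l.
have chi0 (x : T) : 0 <= \1_B x :> R by rewrite indicE; case: (_ \in _).
elim/ltn_ind => n IH x.
(* A block starting this close to the end might overrun it; the crude bound [short] on this stretch
   is the term [c * N]. *)
have [nN|Nn] := leqP n N.
  rewrite (le_trans (short _ _))// ler_wpDl ?addr_ge0 ?mulr_ge0 ?birkhoff_sum_ge0//.
  by rewrite ler_wpM2l// ler_nat.
have [Bx|nBx] := pselect (B x).
  case: n IH Nn => [//|n] IH Nn.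
  rewrite (le_trans (lS _ _))//.
  rewrite (le_trans (lerD (lexx c) (IH n (ltnSn n) (S x))))//.
  have B1 : \1_B x = 1 :> R by rewrite indicE mem_set.
  rewrite !birkhoff_sumS B1.
  by have := psi0 x; lra.
have [m [m0 mN lm]] := lB x nBx.
have mn : (m <= n)%N by rewrite (leq_trans mN)// ltnW.
have nm : (n - m < n)%N by rewrite ltn_subrL m0 (leq_trans m0).
rewrite -(subnKC mn) (le_trans (lm (n - m)%N))//.
rewrite (le_trans (lerD (lexx _) (IH (n - m)%N nm (iter m S x))))//.
rewrite !birkhoff_sumD mulrDr.
have := mulr_ge0 c0 (birkhoff_sum_ge0 m x chi0); set a := c * _; lra.
Qed.

End birkhoff_sum.

Lemma integral_comp_preserving d1 d2 (T1 : measurableType d1)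
    (T2 : measurableType d2) (R : realType) (m1 : {measure set T1 -> \bar R})
    (m2 : {measure set T2 -> \bar R}) (f : T1 -> T2) (g : T2 -> \bar R) :
  measurable_fun setT f ->
  (forall A, measurable A -> m1 (f @^-1` A) = m2 A) ->
  measurable_fun setT g -> (forall y, (0 <= g y)%E) ->
  (\int[m1]_x g (f x) = \int[m2]_y g y)%E.
Proof.
move=> mf m12 mg g0.
have := ge0_integral_pushforward mf m1 measurableT mg (fun y _ => g0 y).
rewrite preimage_setT => <-.
by apply: eq_measure_integral => A mA _; exact: m12.
Qed.

(** * Birkhoff's upper bound *)

Section ergodic_theory.
Context d (T : measurableType d) (R : realType) (P : probability T R).
Variable S : T -> T.
Hypothesis mS : measurable_fun setT S.
Hypothesis PS : invariant_measure S P.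

Lemma integral_cst_probability (K : \bar R) : (\int[P]_x K = K)%E.
Proof.
rewrite integral_cst//.
exact: (etrans (congr1 (mule K) (probability_setT P)) (mule1 _)).
Qed.

Lemma measurable_iter n : measurable_fun setT (iter n S).
Proof.
elim: n => [|n IH]; first exact: measurable_id.
rewrite (_ : iter n.+1 S = S \o iter n S)//.
exact: (measurableT_comp mS IH).
Qed.

Lemma measurable_preimage_iter n A : measurable A -> measurable (iter n S @^-1` A).
Proof. by move=> mA; rewrite -[X in measurable X]setTI; exact: measurable_iter. Qed.

Lemma measure_preimage_iter n A : measurable A -> P (iter n S @^-1` A) = P A.
Proof.
move=> mA; elim: n => [//|n IH].
rewrite -[RHS]IH -(PS (measurable_preimage_iter n mA)); congr (P _).
by apply/seteqP; split => x /=; rewrite -iterSr.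
Qed.

Lemma integral_comp_iter n (g : T -> \bar R) :
  measurable_fun setT g -> (forall x, (0 <= g x)%E) ->
  (\int[P]_x g (iter n S x) = \int[P]_x g x)%E.
Proof.
apply: (integral_comp_preserving (measurable_iter n)) => A mA.
exact: measure_preimage_iter.
Qed.

Hypothesis ergS : ergodic S P.

(* The union of the preimages of the largest measurable forward invariant subset
   of [G'] is strictly invariant. *)
Lemma ergodic_forward_invariant (G G' : set T) :
  (forall x, G x -> G (S x)) -> G `<=` G' -> measurable G' ->
  P.-negligible G \/ P G' = 1%E.
Proof.
move=> GS GG' mG'.
pose G2 := \bigcap_n (iter n S @^-1` G').
have mG2 : measurable G2.
  by apply: bigcap_measurable => // n _; exact: measurable_preimage_iter.
have G2S x : G2 x -> G2 (S x).
  by move=> h n _ /=; rewrite -iterSr; exact: h.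
pose G3 := \bigcup_n (iter n S @^-1` G2).
have mG3 : measurable G3.
  by apply: bigcup_measurable => n _; exact: measurable_preimage_iter.
have G2G' : G2 `<=` G' by move=> x /(_ 0%N I).
have GG2 : G `<=` G2.
  move=> x Gx n _ /=; apply: GG'.
  by elim: n => //= n; exact: GS.
have G3inv : S @^-1` G3 = G3.
  apply/seteqP; split => x /=.
    by move=> [n _ /= h]; exists n.+1 => //=; rewrite -iterS iterSr.
  move=> [n _ /= h]; exists n => //=.
  by rewrite -iterSr iterS; exact: G2S.
have PG3 : P G3 = P G2.
  have cv : P (iter n S @^-1` G2) @[n --> \oo] --> P G3.
    apply: nondecreasing_cvg_mu => //.
    - by move=> n; exact: measurable_preimage_iter.
    - apply/nondecreasing_seqP => n; apply/subsetPset => x /= h.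
      exact: G2S.
  have cv2 : P (iter n S @^-1` G2) @[n --> \oo] --> P G2.
    rewrite (_ : (fun n => _) = cst (P G2)); first exact: cvg_cst.
    by apply/funext => n; rewrite measure_preimage_iter.
  exact: (cvg_unique _ cv cv2).
case: (ergS mG3 G3inv) => G30.
  left; exists G2; split => //; by rewrite -PG3.
right; apply/eqP; rewrite eq_le probability_le1//=.
by rewrite -G30 PG3 le_measure ?inE.
Qed.

Lemma measurable_birkhoff_sum (g : T -> R) n :
  measurable_fun setT g -> measurable_fun setT (birkhoff_sum S g n).
Proof.
move=> mg; apply: measurable_sum => i.
exact: (measurableT_comp mg (measurable_iter i)).
Qed.

Lemma integral_birkhoff_sum (g : T -> R) n :
  measurable_fun setT g -> (forall x, 0 <= g x) ->
  (\int[P]_x (birkhoff_sum S g n x)%:E = n%:R%:E * \int[P]_x (g x)%:E)%E.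
Proof.
move=> mg g0; rewrite /birkhoff_sum.
under eq_integral do rewrite -sumEFin.
have mgi i : measurable_fun setT (EFin \o (fun x => g (iter i S x))).
  exact/measurable_EFinP/(measurableT_comp mg (measurable_iter i)).
rewrite ge0_integral_sum//; [|by move=> i; exact: mgi|by move=> i x _; rewrite lee_fin].
transitivity (\sum_(i < n) (\int[P]_x (g x)%:E))%E.
  apply: eq_bigr => i _.
  rewrite (@integral_comp_iter i (EFin \o g))//; first exact/measurable_EFinP.
by rewrite big_const_ord iter_addr_0 mule_natl.
Qed.

(** Continuity from above turns almost sure occurrence into a waiting time below one [N] off a small
    set. That set is the [B] of [greedy_parse], and [n0] forces the blocks to be long. *)
Lemma first_occurrence_bound (E : nat -> set T) (n0 : nat) (e : R) :
  (forall n, measurable (E n)) -> 0 < e ->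
  P (\bigcup_(n in [set n | (n0 <= n)%N]) E n) = 1%E ->
  exists N, (P (~` \bigcup_(n in [set n | (n0 <= n < N)%N]) E n) < e%:E)%E.
Proof.
move=> mE e0 PE.
pose F N := ~` \bigcup_(n in [set n | (n0 <= n < N)%N]) E n.
have mF N : measurable (F N).
  by apply: measurableC; apply: bigcup_measurable => n _.
have mU : measurable (\bigcup_(n in [set n | (n0 <= n)%N]) E n).
  by apply: bigcup_measurable.
have FI : \bigcap_N F N = ~` \bigcup_(n in [set n | (n0 <= n)%N]) E n.
  apply/seteqP; split => x.
    by move=> h [n n0n Enx]; apply: (h n.+1 I); exists n => //=; rewrite n0n ltnSn.
  by move=> h N _ [n /= /andP[n0n _] Enx]; apply: h; exists n.
have : P (F N) @[N --> \oo] --> P (\bigcap_N F N).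
  apply: nonincreasing_cvg_mu => //.
  - by rewrite (le_lt_trans (probability_le1 _ (mF _)))// ltry.
  - by rewrite FI; exact: measurableC.
  - move=> a b ab; apply/subsetPset => x h [n /= /andP[n0n na] Enx].
    by apply: h; exists n => //=; rewrite n0n (leq_trans na).
rewrite FI probability_setC// PE subee//.
move=> /fine_cvgP[_] /cvgrPdist_lt /(_ e e0)[N _ /(_ N (leqnn N))] /=.
rewrite sub0r normrN => h; exists N.
rewrite -[X in (X < _)%E](@fineK _ (P (F N))) ?fin_num_measure// lte_fin.
by rewrite (le_lt_trans (ler_norm _)).
Qed.

Lemma integral_birkhoff_sumD_cst (g : T -> R) n (K : R) :
  measurable_fun setT g -> (forall x, 0 <= g x) -> 0 <= K ->
  (\int[P]_x (birkhoff_sum S g n x + K)%:E = n%:R%:E * (\int[P]_x (g x)%:E) + K%:E)%E.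
Proof.
move=> mg g0 K0.
under eq_integral do rewrite EFinD.
rewrite ge0_integralD//.
- by rewrite integral_birkhoff_sum// integral_cst_probability.
- by move=> x _; rewrite lee_fin birkhoff_sum_ge0.
- exact/measurable_EFinP/measurable_birkhoff_sum.
Qed.

Lemma integral_indicE (B : set T) (c : R) : measurable B -> 0 <= c ->
  (\int[P]_x (c * \1_B x)%:E = c%:E * P B)%E.
Proof.
move=> mB c0; under eq_integral do rewrite EFinM.
rewrite ge0_integralZl//; first by rewrite integral_indic// setIT.
exact/measurable_EFinP/measurable_indic.
Qed.

(** If averages above some [a] between the mean and [c] recurred on a non-null set, almost every
    point would start a block of average at least [a]; parsing a long orbit into such blocks
    contradicts the mean of [phi]. *)
Theorem birkhoff_eventually_le (phi : T -> R) (c : R) :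
  measurable_fun setT phi -> (forall x, 0 <= phi x) ->
  (\int[P]_x (phi x)%:E < c%:E)%E ->
  {ae P, forall x, \forall n \near \oo, birkhoff_sum S phi n x <= c * n%:R}.
Proof.
move=> mphi phi0 Ic.
set I := (\int[P]_x (phi x)%:E)%E in Ic.
have I0 : (0 <= I)%E by apply: integral_ge0 => x _; rewrite lee_fin.
have If : I \is a fin_num by rewrite ge0_fin_numE// (lt_trans Ic)// ltry.
pose r := fine I.
have IE : I = r%:E by rewrite fineK.
have r0 : 0 <= r by rewrite -lee_fin -IE.
have rc : r < c by rewrite -lte_fin -IE.
pose a := (r + c) / 2.
have ra : r < a by rewrite /a; lra.
have ac : a < c by rewrite /a; lra.
(* The margin [b > a] absorbs the loss of the first term under [S]. Leaving [b] existential, to be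
   replaced by [(a + b) / 2], makes [G] forward invariant. *)
pose G := [set x | exists2 b, a < b & forall n0, exists2 n, (n0 <= n)%N &
   b * n%:R < birkhoff_sum S phi n x].
pose E n := [set x | a * n%:R <= birkhoff_sum S phi n x].
pose G' := \bigcup_(n in [set n | (1 <= n)%N]) E n.
have mE n : measurable (E n).
  rewrite -[E n]setTI; apply: measurable_fun_le => //.
  exact: measurable_birkhoff_sum.
have GS x : G x -> G (S x).
  move=> [b ab Gb]; exists ((a + b) / 2); first lra.
  move=> n0; pose k := Num.truncn (phi x / ((b - a) / 2)).
  have [[//|n] n0n] := Gb (n0 + k.+1).+1.
  rewrite birkhoff_sumS => h; exists n; first by lia.
  have ba : 0 < (b - a) / 2 by lra.
  have : phi x < (b - a) / 2 * n%:R.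
    rewrite mulrC -ltr_pdivrMr//; apply: (lt_le_trans (truncnS_gt _)).
    by rewrite ler_nat -/k; lia.
  move: h; rewrite -natr1; lra.
have GG' : G `<=` G'.
  move=> x [b ab /(_ 1%N)[n n1 h]]; exists n => //=.
  rewrite /E/=; apply: le_trans (ltW h); rewrite ler_wpM2r//; lra.
have mG' : measurable G' by apply: bigcup_measurable.
case: (ergodic_forward_invariant GS GG' mG') => [Gn|G'1].
  apply: (negligibleS _ Gn) => x /= h; exists c => //.
  apply: contrapT => hn; apply: h.
  move/existsNP: hn => [n0 hn0]; exists n0 => // n /= n0n.
  rewrite leNgt; apply/negP => h; apply: hn0; by exists n.
exfalso.
have a0 : 0 < a by lra.
(* Visits to [B] cost at most [a * e = (a - r) / 3] per letter, and the choice of [n] below puts the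
   end cost [a * N] under [(a - r) / 3 * n]; with the mean [r] the total stays below [a * n]. *)
pose e := (a - r) / (3 * a).
have e0 : 0 < e by rewrite /e divr_gt0//; lra.
have [N] := first_occurrence_bound mE e0 G'1.
set B := ~` _ => PBe.
have mB : measurable B by apply: measurableC; apply: bigcup_measurable.
pose n := (Num.truncn (3 * a * N%:R / (a - r))).+1.
have hn x : a * n%:R - birkhoff_sum S phi n x <=
    birkhoff_sum S (fun=> 0) n x + a * birkhoff_sum S (\1_B) n x + a * N%:R.
  apply: (@greedy_parse T R S a N B _
    (fun n x => a * n%:R - birkhoff_sum S phi n x)) => //.
  - exact: ltW.
  - by move=> y; rewrite birkhoff_sum0 mulr0 subr0.
  - by move=> m y; rewrite birkhoff_sumS -natr1; have := phi0 y; lra.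
  - move=> y /contrapT[m /= /andP[m1 mN]]; rewrite /E /= => h.
    exists m; split => //; first exact: ltnW.
    move=> k; rewrite birkhoff_sum_cst birkhoff_sumD natrD; lra.
pose g := phi \+ (fun y => a * \1_B y).
have aB0 y : 0 <= a * \1_B y by rewrite mulr_ge0// ltW.
have g0 y : 0 <= g y by rewrite /g/= addr_ge0.
have maB : measurable_fun setT (fun y => a * \1_B y).
  by apply: measurable_funM => //; exact: measurable_indic.
have mg : measurable_fun setT g by exact: measurable_funD.
have aN0 : 0 <= a * N%:R by rewrite mulr_ge0// ltW.
have : (\int[P]_x (a * n%:R)%:E <= \int[P]_x (birkhoff_sum S g n x + a * N%:R)%:E)%E.
  apply: ge0_le_integral => //.
  - by move=> x _; rewrite lee_fin mulr_ge0// ltW.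
  - apply/measurable_EFinP/measurable_funD => //; exact: measurable_birkhoff_sum.
  - move=> x _; rewrite lee_fin birkhoff_sum_add birkhoff_sumZ.
    by have := hn x; rewrite birkhoff_sum_cst; lra.
rewrite integral_cst_probability integral_birkhoff_sumD_cst//.
have -> : (\int[P]_x (g x)%:E = I + a%:E * P B)%E.
  under eq_integral do rewrite EFinD.
  rewrite ge0_integralD ?integral_indicE ?(ltW a0)//.
  - by move=> x _; rewrite lee_fin.
  - exact/measurable_EFinP.
  - by move=> x _; rewrite lee_fin.
  - exact/measurable_EFinP.
have [p PB] : exists p, P B = p%:E by exists (fine (P B)); rewrite fineK// fin_num_measure.
move: PBe; rewrite PB IE lte_fin => pe.
rewrite -!EFinM -!EFinD lee_fin => hh.
have ape : a * p < (a - r) / 3.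
  apply: (@lt_le_trans _ _ (a * e)); first by rewrite ltr_pM2l.
  by rewrite le_eqVlt; apply/orP; left; apply/eqP; rewrite /e; field; rewrite gt_eqF.
have n0 : 0 < n%:R :> R by rewrite ltr0n.
move: (n0); have : 3 * a * N%:R < (a - r) * n%:R.
  by rewrite -ltr_pdivrMl ?subr_gt0// mulrC; exact: truncnS_gt.
clear - hh ape ra a0 n0 => hN _; move: hN.
move: hh ape.
set A := a * p; set n' := n%:R in n0 *; set N' := N%:R => hh ape hN.
have : (a - r) / 3 * n' = n' * a / 3 - n' * r / 3 by ring.
have : A * n' < (a - r) / 3 * n' by rewrite ltr_pM2r.
nra.
Qed.

End ergodic_theory.

(** * Distributions on words and entropy *)

Section words.
Context (I : finType) (R : realType).
Implicit Types (F G : seq I -> R) (m n : nat).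

Definition word_sum n F : R := \sum_(w : n.-tuple I) F w.

Lemma word_sum0 F : word_sum 0 F = F [::].
Proof.
rewrite /word_sum (eq_bigr (fun=> F [::])); last by move=> w _; rewrite tuple0.
by rewrite big_const card_tuple expn0 /= addr0.
Qed.

Lemma word_sumS n F : word_sum n.+1 F = \sum_(a : I) word_sum n (fun w => F (a :: w)).
Proof.
rewrite /word_sum pair_big/=.
rewrite (reindex (fun p : I * n.-tuple I => [tuple of p.1 :: p.2]))//=.
exists (fun w : n.+1.-tuple I => (thead w, [tuple of behead w])).
- by move=> [a w] _ /=; rewrite theadE; congr (_, _); apply: val_inj.
- by move=> w _; rewrite -tuple_eta.
Qed.

Lemma word_sum_ext n F G : (forall w, size w = n -> F w = G w) -> word_sum n F = word_sum n G.
Proof. by move=> FG; apply: eq_bigr => w _; apply: FG; rewrite size_tuple. Qed.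

Lemma ler_word_sum n F G :
  (forall w, size w = n -> F w <= G w) -> word_sum n F <= word_sum n G.
Proof. by move=> FG; apply: ler_sum => w _; apply: FG; rewrite size_tuple. Qed.

Lemma word_sum_ge0 n F : (forall w, 0 <= F w) -> 0 <= word_sum n F.
Proof. by move=> F0; apply: sumr_ge0. Qed.

Lemma word_sumZ n (c : R) F : word_sum n (fun w => c * F w) = c * word_sum n F.
Proof. by rewrite /word_sum mulr_sumr. Qed.

Lemma word_sumB n F G : word_sum n (fun w => F w - G w) = word_sum n F - word_sum n G.
Proof. by rewrite /word_sum sumrB. Qed.

Lemma word_sumD n F G : word_sum n (fun w => F w + G w) = word_sum n F + word_sum n G.
Proof. by rewrite /word_sum big_split. Qed.

Lemma word_sum_sum n (J : Type) (r : seq J) (F : J -> seq I -> R) :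
  word_sum n (fun w => \sum_(j <- r) F j w) = \sum_(j <- r) word_sum n (F j).
Proof. by rewrite /word_sum exchange_big. Qed.

Lemma word_sum_cat m n F G :
  word_sum (m + n) (fun w => F (take m w) * G (drop m w)) = word_sum m F * word_sum n G.
Proof.
elim: m F => [|m IH] F.
  rewrite word_sum0 -word_sumZ add0n; apply: word_sum_ext => w _.
  by rewrite take0 drop0.
rewrite addSn !word_sumS mulr_suml; apply: eq_bigr => a _ /=.
exact: (IH (fun w => F (a :: w))).
Qed.

(** Nonnegativity of relative entropy, from [ln t <= t - 1] at [t = q w / p w]. Words with [p w = 0]
    contribute 0 to both sides. *)
Lemma gibbs_inequality n (p q : seq I -> R) :
  (forall w, 0 <= p w) -> (forall w, 0 < q w) ->
  word_sum n p = 1 -> word_sum n q <= 1 ->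
  word_sum n (fun w => - (p w * ln (p w))) <= word_sum n (fun w => p w * - ln (q w)).
Proof.
move=> p0 q0 p1 q1; rewrite -subr_le0 -word_sumB.
apply: (@le_trans _ _ (word_sum n (fun w => q w - p w))); last first.
  by rewrite word_sumB p1 subr_le0.
apply: ler_word_sum => w _.
have := p0 w; rewrite le_eqVlt => /orP[/eqP <-|pw].
  by rewrite !mul0r oppr0 !addr0 ltW.
have -> : - (p w * ln (p w)) - p w * - ln (q w) = p w * ln (q w / p w).
  by rewrite ln_div ?posrE//; ring.
have : ln (q w / p w) <= q w / p w - 1.
  have := @le_ln1Dx R (q w / p w - 1).
  rewrite addrCA subrr addr0; apply.
  by rewrite ltrBDl subrr divr_gt0.
rewrite -(ler_pM2l pw) => /le_trans; apply.
by rewrite mulrBr mulr1 mulrCA divff ?mulr1// gt_eqF.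
Qed.

End words.

(* A word is produced by concatenating independent blocks drawn with weights [b]. *)
Section renewal.
Context (I : finType) (R : realType) (b : seq I -> R).

(** The fuel makes the recursion structural, since [drop m.+1 w] is not a syntactic subterm; any
    fuel at least [size w] gives the same value. *)
Fixpoint renewal_rec (fuel : nat) (w : seq I) : R :=
  if fuel is f.+1 then
    if w is [::] then 1
    else \sum_(m < size w) b (take m.+1 w) * renewal_rec f (drop m.+1 w)
  else 1.

Definition renewal (w : seq I) := renewal_rec (size w) w.

Lemma renewal_recE f w : (size w <= f)%N -> renewal_rec f w = renewal w.
Proof.
move: f; have [n] := ubnP (size w); elim: n w => // n IH [|a w] wn [|f] wf //.
rewrite /renewal/=; apply: eq_bigr => m _; congr (_ * _).
rewrite /= !ltnS in wn wf.
have sz : (size (drop m w) <= size w)%N by rewrite size_drop leq_subr.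
by rewrite !IH// ?(leq_ltn_trans sz)// (leq_trans sz).
Qed.

Lemma renewal_nil : renewal [::] = 1. Proof. by []. Qed.

Lemma renewalE w : w != [::] ->
  renewal w = \sum_(m < size w) b (take m.+1 w) * renewal (drop m.+1 w).
Proof.
case: w => // a w _; rewrite {1}/renewal/=; apply: eq_bigr => m _.
by rewrite renewal_recE// size_drop leq_subr.
Qed.

Hypothesis b0 : forall w, 0 <= b w.

Lemma renewal_ge0 w : 0 <= renewal w.
Proof.
have [n] := ubnP (size w); elim: n w => // n IH w wn.
have [->|w0] := eqVneq w [::]; first by rewrite renewal_nil.
rewrite renewalE//; apply: sumr_ge0 => m _; rewrite mulr_ge0//.
apply: IH; rewrite size_drop -ltnS; apply: leq_trans wn.
by rewrite ltnS ltn_subrL/= lt0n size_eq0.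
Qed.

Lemma renewal_cat u w : u != [::] -> b u * renewal w <= renewal (u ++ w).
Proof.
move=> u0; have su : (0 < size u)%N by rewrite lt0n size_eq0.
have uw : ((size u).-1 < size (u ++ w))%N by rewrite size_cat prednK// leq_addr.
rewrite [leRHS]renewalE; last by rewrite -size_eq0 size_cat addn_eq0 size_eq0 negb_and u0.
rewrite (bigD1 (Ordinal uw))//= prednK// take_size_cat// drop_size_cat// lerDl.
by apply: sumr_ge0 => m _; rewrite mulr_ge0// renewal_ge0.
Qed.

Lemma renewal_gt0 w : (forall a, 0 < b [:: a]) -> 0 < renewal w.
Proof.
move=> ba; elim: w => [|a w IH]; first by rewrite renewal_nil.
by apply: lt_le_trans (@renewal_cat [:: a] w isT); rewrite mulr_gt0.
Qed.

(** The sum is the probability that [n] is a renewal time, for block lengths with a possibly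
    defective law; the induction conditions on the first block. *)
Lemma word_sum_renewal n :
  (forall n, \sum_(m < n) word_sum m.+1 b <= 1) -> word_sum n renewal <= 1.
Proof.
move=> b1; elim/ltn_ind: n => -[|n] IH; first by rewrite word_sum0 renewal_nil.
have -> : word_sum n.+1 renewal =
    word_sum n.+1 (fun w => \sum_(m < n.+1) b (take m.+1 w) * renewal (drop m.+1 w)).
  by apply: word_sum_ext => w wn; rewrite renewalE ?wn// -size_eq0 wn.
rewrite word_sum_sum (le_trans _ (b1 n.+1))//; apply: ler_sum => m _.
have mn : (m.+1 <= n.+1)%N by [].
rewrite -{1}(subnKC mn) word_sum_cat -[leRHS]mulr1 ler_wpM2l ?word_sum_ge0//.
by apply: IH; rewrite subSS ltnS leq_subr.
Qed.

End renewal.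

(* Probability that the word [u], sent through a channel that replaces each letter
   by a uniformly random one with probability [1 - r], is received as [w]. *)
Section noisy_channel.
Context (I : finType) (R : realType) (r : R).

Definition letter_channel (u w : I) : R := r * (w == u)%:R + (1 - r) / #|I|%:R.

Fixpoint word_channel (u w : seq I) : R :=
  if w is b :: w' then
    if u is a :: u' then letter_channel a b * word_channel u' w' else 1
  else 1.

Hypothesis r01 : 0 < r < 1.
Hypothesis I0 : (0 < #|I|)%N.

Lemma letter_channel_gt0 a b : 0 < letter_channel a b.
Proof.
case/andP: r01 => r0 r1.
by rewrite /letter_channel ltr_wpDl ?mulr_ge0 ?(ltW r0)// divr_gt0 ?subr_gt0 ?ltr0n.
Qed.

Lemma word_channel_gt0 u w : 0 < word_channel u w.
Proof. by elim: w u => [|b w IH] [|a u] //=; rewrite mulr_gt0// letter_channel_gt0. Qed.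

Lemma word_sum_channel u : word_sum (size u) (word_channel u) = 1.
Proof.
elim: u => [|a u IH]; first by rewrite word_sum0.
rewrite word_sumS/=; under eq_bigr do rewrite word_sumZ IH mulr1.
rewrite big_split/= -mulr_sumr (bigD1 a)//= eqxx big1 => [|i /negPf ->//].
rewrite addr0 mulr1 sumr_const -[_ *+ _]mulr_natr divfK ?subrKC//.
by rewrite pnatr_eq0 -lt0n.
Qed.

End noisy_channel.

(** * Itineraries: word probabilities and entropy *)

Section itineraries.
Context d (T : measurableType d) (R : realType) (P : probability T R).
Variable S : T -> T.
Hypothesis mS : measurable_fun setT S.
Hypothesis PS : invariant_measure S P.
Context (I : finType).
Variable lab : T -> I.
Hypothesis mlab : forall i, measurable (lab @^-1` [set i]).

Fixpoint itinerary n (x : T) : seq I :=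
  if n is m.+1 then lab x :: itinerary m (S x) else [::].

Lemma size_itinerary n x : size (itinerary n x) = n.
Proof. by elim: n x => //= n IH x; rewrite IH. Qed.

Lemma itineraryD m n x : itinerary (m + n) x = itinerary m x ++ itinerary n (iter m S x).
Proof. by elim: m x => //= m IH x; rewrite IH -iterS iterSr. Qed.

Definition word_cell (w : seq I) : set T := [set x | itinerary (size w) x = w].

Lemma measurable_word_cell w : measurable (word_cell w).
Proof.
elim: w => [|a w IH].
  rewrite (_ : word_cell _ = setT)//; by apply/seteqP; split.
rewrite (_ : word_cell _ = lab @^-1` [set a] `&` S @^-1` (word_cell w)).
  apply: measurableI => //.
  rewrite -[X in measurable X]setTI; exact: mS.
by apply/seteqP; split => x; rewrite /word_cell/= => -[-> ->].
Qed.

Definition word_prob (w : seq I) : R := fine (P (word_cell w)).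

Lemma word_probE w : P (word_cell w) = (word_prob w)%:E.
Proof. by rewrite fineK// fin_num_measure//; exact: measurable_word_cell. Qed.

Lemma word_prob_ge0 w : 0 <= word_prob w.
Proof. exact: fine_ge0. Qed.

Lemma word_prob_le1 w : word_prob w <= 1.
Proof.
by rewrite -lee_fin -word_probE probability_le1//; exact: measurable_word_cell.
Qed.

Lemma itinerary_indic (F : seq I -> R) n x :
  F (itinerary n x) = \sum_(w : n.-tuple I) F w * \1_(word_cell w) x.
Proof.
rewrite (bigD1 (Tuple (introT eqP (size_itinerary n x))))//= big1 => [|w wx].
  by rewrite addr0 indicE mem_set ?mulr1//; rewrite /word_cell/= size_itinerary.
rewrite indicE memNset ?mulr0// /word_cell/= size_tuple => nw.
by move/eqP: wx; apply; apply: val_inj.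
Qed.

Lemma measurable_itinerary (F : seq I -> R) n :
  measurable_fun setT (fun x => F (itinerary n x)).
Proof.
under eq_fun do rewrite itinerary_indic.
apply: measurable_sum => w; apply: measurable_funM => //.
exact/measurable_indic/measurable_word_cell.
Qed.

Lemma integral_itinerary (F : seq I -> R) n : (forall w, 0 <= F w) ->
  (\int[P]_x (F (itinerary n x))%:E = (word_sum n (fun w => word_prob w * F w))%:E)%E.
Proof.
move=> F0; under eq_integral do rewrite itinerary_indic -sumEFin.
have mw (w : n.-tuple I) : measurable_fun setT (fun x => (F w * \1_(word_cell w) x)%:E).
  apply/measurable_EFinP; apply: measurable_funM => //.
  exact/measurable_indic/measurable_word_cell.
rewrite ge0_integral_sum//; last by move=> w x _; rewrite lee_fin mulr_ge0.
rewrite /word_sum -sumEFin; apply: eq_bigr => w _.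
rewrite integral_indicE//; last exact: measurable_word_cell.
by rewrite [X in (_ * X)%E]word_probE -EFinM mulrC.
Qed.

Lemma measurable_itinerary_pred (Q : pred (seq I)) n :
  measurable [set x | Q (itinerary n x)].
Proof.
have := @measurable_itinerary (fun w => (Q w)%:R) n measurableT [set 1] (measurable_set1 1).
rewrite setTI; congr (measurable _); apply/seteqP; split => x /=; last by move=> ->.
by case: (Q _) => // /esym/eqP; rewrite oner_eq0.
Qed.

Lemma measure_itinerary_pred (Q : pred (seq I)) n :
  P [set x | Q (itinerary n x)] = (word_sum n (fun w => word_prob w * (Q w)%:R))%:E.
Proof.
rewrite -integral_itinerary; last by move=> w; exact: ler0n.
rewrite -[X in P X]setIT -integral_indic//; last exact: measurable_itinerary_pred.
apply: eq_integral => x _; rewrite indicE; congr ((nat_of_bool _)%:R%:E).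
by apply/idP/idP => [/set_mem//|h]; exact: mem_set.
Qed.

Lemma word_sum_prob n : word_sum n word_prob = 1.
Proof.
have := @integral_itinerary (fun=> 1) n (fun=> ler01).
rewrite integral_cst_probability => -[]; rewrite (_ : word_sum _ _ = word_sum n word_prob)//.
by apply: word_sum_ext => w _; rewrite mulr1.
Qed.

Definition word_entropy n : R := word_sum n (fun w => - (word_prob w * ln (word_prob w))).

Lemma word_entropy_ge0 n : 0 <= word_entropy n.
Proof.
apply: word_sum_ge0 => w; rewrite -mulrN mulr_ge0 ?word_prob_ge0// oppr_ge0.
exact/ln_le0/word_prob_le1.
Qed.

(* Markov's inequality and the Borel-Cantelli lemma. *)
Lemma barron (q : seq I -> R) (eta : R) : 0 < eta ->
  (forall w, 0 < q w) -> (forall n, word_sum n q <= 1) ->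
  {ae P, forall x, \forall n \near \oo,
    expR (- eta * n%:R) * q (itinerary n x) <= word_prob (itinerary n x)}.
Proof.
move=> eta0 q0 q1.
(* Words that [q] overrates by the factor [expR (eta * n)]. Their total probability is at most
   [expR (- eta * n)], which is summable. *)
pose bad n := fun w => word_prob w < expR (- eta * n%:R) * q w.
pose F n := [set x | bad n (itinerary n x)].
have mF n : measurable (F n) by exact: measurable_itinerary_pred.
have PF n : (P (F n) <= (expR (- eta) ^+ n)%:E)%E.
  have ee : expR (- eta * n%:R) = expR (- eta) ^+ n by rewrite -expRM_natl mulrC.
  rewrite measure_itinerary_pred lee_fin.
  rewrite -[leRHS]mulr1; apply: le_trans (ler_wpM2l (exprn_ge0 _ (expR_ge0 _)) (q1 n)).
  rewrite -word_sumZ; apply: ler_word_sum => w _.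
  rewrite /bad ee; case: ltP => h; first by rewrite mulr1 ltW.
  by rewrite mulr0 mulr_ge0 ?exprn_ge0 ?expR_ge0 ?ltW.
have : P (lim_sup_set F) = 0%E.
  apply: lim_sup_set_cvg0 => //.
  set r := expR (- eta) in PF.
  have r1 : r < 1 by rewrite /r expR_lt1 oppr_lt0.
  apply: (@le_lt_trans _ _ ((1 - r)^-1)%:E); last exact: ltry.
  apply: lime_le; first by apply: is_cvg_nneseries => n _ _; exact: measure_ge0.
  apply: nearW => n; apply: (@le_trans _ _ (\sum_(0 <= i < n) (r ^+ i)%:E)%E).
    by apply: lee_sum => i _; exact: PF.
  rewrite sumEFin lee_fin big_mkord -[leRHS]mul1r ler_pdivlMr ?subr_gt0// mulrC.
  by rewrite -opprB mulNr -subrX1 opprB gerBl exprn_ge0// expR_ge0.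
move=> F0; exists (lim_sup_set F); split => //.
  by apply: bigcap_measurable => // k _; exact: bigcup_measurable.
move=> x /= h n _; apply: contrapT => hn; apply: h; exists n => // m /= nm.
by rewrite leNgt; apply/negP => h; apply: hn; exists m.
Qed.

End itineraries.

(** * Coding itineraries with errors *)

Section coding.
Context d (T : measurableType d) (R : realType) (P : probability T R).
Variable S : T -> T.
Hypothesis mS : measurable_fun setT S.
Hypothesis PS : invariant_measure S P.
Context (I : finType).
Variable lab : T -> I.
Hypothesis mlab : forall i, measurable (lab @^-1` [set i]).

(** Agreement with [u] is demanded only while the orbit is in [Y]; the letters at other times are
    the noise that the channel pays for. *)
Fixpoint follows (Y : set T) (x : T) (u : seq I) : Prop :=
  if u is a :: v then (Y x -> lab x = a) /\ follows Y (S x) v else True.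

Lemma followsP Y x (u : nat -> I) m :
  (forall t, (t < m)%N -> Y (iter t S x) -> lab (iter t S x) = u t) ->
  follows Y x (mkseq u m).
Proof.
rewrite /mkseq -[iota 0 m]/(iota 0 m).
suff: forall s, (forall t, (t < m)%N -> Y (iter t S x) -> lab (iter t S x) = u (s + t)%N) ->
  follows Y x [seq u i | i <- iota s m] by move=> h hu; apply: (h 0%N).
elim: m x => //= m IH x s h; split; first by move=> Yx; rewrite (h 0%N)// addn0.
apply: IH => t tm; rewrite -iterSr addSnnS; exact: (h t.+1).
Qed.

Lemma measurable_follows Y u : measurable Y -> measurable [set x | follows Y x u].
Proof.
move=> mY; elim: u => [|a u IH] /=.
  rewrite (_ : [set _ | True] = setT)//.
rewrite (_ : [set _ | _] =
  (~` Y `|` lab @^-1` [set a]) `&` S @^-1` [set x | follows Y x u]).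
  apply: measurableI; first by apply: measurableU => //; exact: measurableC.
  by rewrite -[X in measurable X]setTI; exact: mS.
apply/seteqP; split => x /=.
  by move=> [h1 h2]; split => //; have [/h1|] := pselect (Y x); [right|left].
by move=> [h1 h2]; split => // Yx; case: h1.
Qed.

Variables (a eta : R) (C : nat -> seq (seq I)).
Hypothesis a0 : 0 <= a.
Hypothesis eta0 : 0 < eta.
Hypothesis C_size : forall m u, u \in C m -> size u = m.
Hypothesis C_card : forall m, (size (C m))%:R <= expR (a * m%:R).

Let k := #|I|.
Let r : R := expR (- eta).

(** A fair choice between two sources. One emits a single uniform letter, which makes every word
    possible. The other draws a length [m] with geometric probability [(1 - r) r^(m-1)], takes each
    word of [C m] with weight [expR (- (a * m))], of total at most 1 by [C_card], and sends it
    through the channel. *)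
Definition block_weight (w : seq I) : R :=
  (size w == 1)%:R / (2 * k%:R) +
  (1 - r) * r ^+ (size w).-1 / 2 *
    (expR (- (a * (size w)%:R)) * \sum_(u <- C (size w)) word_channel r u w).

(** The channel outputs any prescribed letter with probability at least [(1 - r) / k], whatever was
    sent. *)
Definition error_cost : R := - ln ((1 - r) / k%:R).

Let r01 : 0 < r < 1.
Proof. by rewrite /r expR_gt0 expR_lt1 oppr_lt0. Qed.

Let r0 : 0 < r. Proof. by case/andP: r01. Qed.
Let r1 : 0 < 1 - r. Proof. by rewrite subr_gt0; case/andP: r01. Qed.

Let k0 (x : T) : (0 < k)%N.
Proof. by apply/card_gt0P; exists (lab x). Qed.

Lemma block_weight_ge0 (x : T) w : 0 <= block_weight w.
Proof.
rewrite addr_ge0// ?divr_ge0 ?mulr_ge0// ?(ltW r1) ?exprn_ge0 ?(ltW r0) ?expR_ge0//.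
by apply: sumr_ge0 => u _; apply: ltW; exact: word_channel_gt0 (k0 x) _ _.
Qed.

Lemma block_weight1_ge (x : T) b : (2 * k%:R)^-1 <= block_weight [:: b].
Proof.
rewrite /block_weight eqxx mul1r lerDl.
rewrite !mulr_ge0// ?(ltW r1) ?exprn_ge0 ?(ltW r0) ?expR_ge0//.
by apply: sumr_ge0 => u _; apply: ltW; exact: word_channel_gt0 (k0 x) _ _.
Qed.

Lemma error_cost_ge0 (x : T) : 0 <= error_cost.
Proof.
rewrite oppr_ge0; apply: ln_le0; rewrite ler_pdivrMr ?ltr0n ?(k0 x)// mul1r.
apply: (@le_trans _ _ 1); first by rewrite gerBl ltW.
by rewrite ler1n (k0 x).
Qed.

(** Each of the two sources contributes at most 1/2: the single letters by counting, the codewords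
    by [C_card] and a geometric sum. *)
Lemma sum_word_sum_block_weight (x : T) n :
  \sum_(m < n) word_sum m.+1 block_weight <= 1.
Proof.
have block m : word_sum m.+1 block_weight <= (m == 0)%:R / 2 + (1 - r) * r ^+ m / 2.
  have -> : word_sum m.+1 block_weight =
    word_sum m.+1 (fun w : seq I => (m == 0)%:R / (2 * k%:R) * 1) +
    word_sum m.+1 (fun w => (1 - r) * r ^+ m / 2 * (expR (- (a * m.+1%:R)) *
       \sum_(u <- C m.+1) word_channel r u w)).
    rewrite -word_sumD; apply: word_sum_ext => w wm.
    by rewrite /block_weight wm mulr1.
  rewrite !word_sumZ; apply: lerD.
    case: m => [|m] /=; last by rewrite !mul0r.
    rewrite word_sumS; under eq_bigr do rewrite word_sum0.
    rewrite sumr_const -/k le_eqVlt; apply/orP; left; apply/eqP; field.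
    by rewrite pnatr_eq0 -lt0n (k0 x).
  rewrite -[leRHS]mulr1 ler_wpM2l ?divr_ge0 ?mulr_ge0 ?(ltW r1) ?exprn_ge0 ?(ltW r0)//.
  rewrite word_sum_sum (eq_big_seq (fun=> 1)); last first.
    move=> u uC; rewrite -{1}(C_size uC) word_sum_channel//; exact: k0.
  rewrite big_const_seq count_predT iter_addr_0 expRN ler_pdivrMl ?expR_gt0//.
  by rewrite mulr1; exact: C_card.
apply: (@le_trans _ _ (\sum_(m < n) ((m == 0 :> nat)%:R / 2 + (1 - r) * r ^+ m / 2))).
  by apply: ler_sum => i _; exact: block.
rewrite big_split/=.
have h1 : \sum_(i < n) (i == 0 :> nat)%:R / 2 <= 1 / 2 :> R.
  case: n => [|n]; first by rewrite big_ord0.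
  rewrite big_ord_recl/= big1 ?addr0// => i _; by rewrite mul0r.
have h2 : \sum_(i < n) (1 - r) * r ^+ i / 2 <= 1 / 2.
  rewrite -mulr_suml ler_wpM2r// -mulr_sumr.
  by rewrite -opprB mulNr -subrX1 opprB gerBl exprn_ge0// ltW.
lra.
Qed.

(** In [Y] the letter arrives unchanged, with probability at least [r = expR (- eta)]; outside
    nothing is known about it and [error_cost] is charged. *)
Lemma ln_word_channel Y x u : follows Y x u ->
  - ln (word_channel r u (itinerary S lab (size u) x)) <=
  birkhoff_sum S (fun y => eta + error_cost * \1_(~` Y) y) (size u) x.
Proof.
elim: u x => [|b u IH] x; first by rewrite birkhoff_sum0 /= ln1 oppr0.
move=> [hb /IH {}IH]; rewrite birkhoff_sumS/= lnM ?posrE//; last 2 first.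
  exact: letter_channel_gt0 (k0 x) _ _.
  exact: word_channel_gt0 (k0 x) _ _.
rewrite opprD lerD// /letter_channel.
have L0 : 0 < (1 - r) / k%:R by rewrite divr_gt0// ltr0n (k0 x).
have [Yx|nYx] := pselect (Y x).
  rewrite hb// eqxx mulr1 indicE memNset ?mulr0 ?addr0; last by move=> /(_ Yx).
  rewrite -[leRHS]opprK -(expRK (- eta)) lerN2 ler_ln ?posrE ?expR_gt0 ?addr_gt0//.
  by rewrite -/r lerDl ltW.
rewrite indicE mem_set// mulr1.
apply: (@le_trans _ _ error_cost); last by rewrite lerDr ltW.
rewrite lerN2 ler_ln ?posrE//; first by rewrite lerDr mulr_ge0// ltW.
by rewrite ltr_wpDl// mulr_ge0// ltW.
Qed.

Definition codebook_event Y m : set T := [set x | exists2 u, u \in C m & follows Y x u].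

Lemma measurable_codebook_event Y m : measurable Y -> measurable (codebook_event Y m).
Proof.
move=> mY; rewrite (_ : codebook_event Y m =
  \bigcup_(u in [set` C m]) [set x | follows Y x u]).
  apply: fin_bigcup_measurable => [|u _]; first exact: finite_seq.
  exact: measurable_follows.
by apply/seteqP; split => x [u]; exists u.
Qed.

Let c1 : R := ln (2 * k%:R).

(** The three [eta] per letter pay for the geometric law of the length, for the letters that arrive
    unchanged, and for the constant [ln 2 - ln (1 - r)] spread over at least [m0] letters. The price
    of an isolated letter is [c1]. *)
Lemma coding_bound Y (del : R) : measurable Y -> 0 < del ->
  P (lim_sup_set (codebook_event Y)) = 1%E ->
  exists B N, [/\ measurable B, (P B < del%:E)%E & forall n x,
    - ln (renewal block_weight (itinerary S lab n x)) <=
      birkhoff_sum S (fun y => a + 3 * eta + error_cost * \1_(~` Y) y) n x +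
      c1 * birkhoff_sum S (\1_B) n x + c1 * N%:R].
Proof.
move=> mY del0 PE.
pose m0 := (Num.truncn ((ln 2 - ln (1 - r)) / eta)).+1.
have m0P : ln 2 - ln (1 - r) <= eta * m0%:R.
  by rewrite -ler_pdivrMl// mulrC ltW//; exact: truncnS_gt.
have mE m := measurable_codebook_event m mY.
have PE1 : P (\bigcup_(n in [set n | (m0 <= n)%N]) codebook_event Y n) = 1%E.
  apply/eqP; rewrite eq_le probability_le1/=; last exact: bigcup_measurable.
  rewrite -PE; apply: lim_sup_set_ub => //.
have [N] := first_occurrence_bound mE del0 PE1.
set B := ~` _ => PB.
exists B, N; split => //.
  by apply: measurableC; apply: bigcup_measurable.
move=> n x.
have bge0 := block_weight_ge0 x.
have k1 := k0 x.
have bgt := block_weight1_ge x.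
have k20 : 0 < 2 * k%:R :> R by rewrite mulr_gt0// ltr0n.
have bgt0 b : 0 < block_weight [:: b] by apply: lt_le_trans (bgt b); rewrite invr_gt0.
have q0 w : 0 < renewal block_weight w by exact: renewal_gt0.
apply: (@greedy_parse T R S c1 N B _
  (fun n x => - ln (renewal block_weight (itinerary S lab n x)))).
- rewrite ln_ge0// -natrM ler1n muln_gt0//.
- move=> y; rewrite !addr_ge0 ?mulr_ge0 ?(ltW eta0) ?(error_cost_ge0 x)//.
- by move=> y; rewrite renewal_nil ln1 oppr0.
- move=> m y /=; rewrite -[X in _ <= X + _]opprK -opprD lerN2 -lnV ?posrE//.
  rewrite -lnM ?posrE ?invr_gt0// ler_ln ?posrE ?mulr_gt0 ?invr_gt0//.
  apply: le_trans (renewal_cat bge0 _ (_ : [:: lab y] != [::])) => //.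
  by rewrite ler_wpM2r// ltW.
move=> y /contrapT[m /= /andP[m0m mN] [u uC uf]].
have um := C_size uC.
exists m; split; [exact: leq_trans m0m|exact: ltnW|move=> n'].
rewrite itineraryD.
have nn : itinerary S lab m y != [::] by rewrite -size_eq0 size_itinerary -lt0n (leq_trans _ m0m).
set w := itinerary S lab m y in nn *.
set v := itinerary _ _ _ _.
(* Since [r < 1], writing [r ^+ m] for [r ^+ m.-1] only lowers the weight, and each letter of the
   block then costs the same. *)
have bw : (1 - r) / 2 * r ^+ m * expR (- (a * m%:R)) * word_channel r u w <= block_weight w.
  rewrite /block_weight size_itinerary ler_wpDl ?mulr_ge0 ?invr_ge0 ?(ltW k20)//.
  rewrite -!mulrA ler_wpM2l ?(ltW r1)// mulrCA ler_pM ?invr_ge0 ?exprn_ge0 ?(ltW r0)//.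
  - by rewrite !mulr_ge0 ?expR_ge0 ?invr_ge0// ltW// word_channel_gt0.
  - by rewrite ler_wiXn2l ?(ltW r0)// ?leq_pred//; case/andP: r01 => _ /ltW.
  rewrite ler_wpM2l ?invr_ge0// ler_wpM2l ?expR_ge0// (big_rem u)//= lerDl.
  by apply: sumr_ge0 => z _; rewrite ltW// word_channel_gt0.
have wc0 : 0 < word_channel r u w by exact: word_channel_gt0.
have bl0 : 0 < (1 - r) / 2 * r ^+ m * expR (- (a * m%:R)) * word_channel r u w.
  by rewrite !mulr_gt0// ?exprn_gt0 ?expR_gt0.
apply: (@le_trans _ _ (- ln ((1 - r) / 2 * r ^+ m * expR (- (a * m%:R)) * word_channel r u w
    * renewal block_weight v))).
  rewrite lerN2 ler_ln ?posrE//; last by rewrite mulr_gt0.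
  apply: le_trans (renewal_cat bge0 v nn).
  by rewrite ler_wpM2r// ltW.
rewrite !lnM ?posrE ?mulr_gt0 ?exprn_gt0 ?expR_gt0 ?invr_gt0//.
have lr : ln r = - eta by rewrite /r expRK.
rewrite lnV ?posrE// lnXn// expRK lr -(mulr_natr (- eta)).
have -> : birkhoff_sum S (fun y => a + 3 * eta + error_cost * \1_(~` Y) y) m y =
    (a + 2 * eta) * m%:R +
    birkhoff_sum S (fun y => eta + error_cost * \1_(~` Y) y) m y.
  rewrite -(birkhoff_sum_cst S _ m y) -birkhoff_sum_add; apply: eq_bigr => t _ /=; ring.
have := ln_word_channel uf; rewrite um -/w.
have : eta * m0%:R <= eta * m%:R by rewrite ler_pM2l// ler_nat.
move: m0P; lra.
Qed.

End coding.

(** * From codebooks to entropy and probability bounds *)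

Section local_entropy.
Context d (T : measurableType d) (R : realType) (P : probability T R).
Variable S : T -> T.
Hypothesis mS : measurable_fun setT S.
Hypothesis PS : invariant_measure S P.
Hypothesis ergS : ergodic S P.
Context (I : finType).
Variable lab : T -> I.
Hypothesis mlab : forall i, measurable (lab @^-1` [set i]).

Local Notation itin := (itinerary S lab).
Local Notation prob := (word_prob P S lab).
Local Notation entropy := (word_entropy P S lab).

Section coding_consequences.
Variables (a eta : R) (C : nat -> seq (seq I)) (Y : set T).
Hypothesis a0 : 0 <= a.
Hypothesis eta0 : 0 < eta.
Hypothesis C_size : forall m u, u \in C m -> size u = m.
Hypothesis C_card : forall m, (size (C m))%:R <= expR (a * m%:R).
Hypothesis mY : measurable Y.
Hypothesis PE : P (lim_sup_set (codebook_event S lab C Y)) = 1%E.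

Let rate := a + 3 * eta + error_cost I eta * fine (P (~` Y)).

(** Code lengths are dominated by ergodic sums of small mean; [word_entropy_coding] integrates this
    domination, and [word_prob_coding] applies Birkhoff's bound to it. *)
Lemma coding_bound_integrated (del : R) : 0 < del ->
  exists (g : T -> R) (K : R) (q : seq I -> R),
  [/\ [/\ measurable_fun setT g, forall x, 0 <= g x & 0 <= K],
      (\int[P]_x (g x)%:E < (rate + del)%:E)%E,
      forall w : seq I, 0 < q w, forall n, word_sum n q <= 1 &
      forall n x, - ln (q (itin n x)) <= birkhoff_sum S g n x + K].
Proof.
move=> del0; have k0 : (0 < #|I|)%N by apply/card_gt0P; exists (lab point).
set c1 := ln (2 * #|I|%:R : R).
have c10 : 0 <= c1 by rewrite ln_ge0// -natrM ler1n muln_gt0.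
have L0 : 0 <= error_cost I eta := error_cost_ge0 lab eta0 point.
(* A visit to the set [B] of [coding_bound] costs [c1]; with this bound on its measure the mean cost
   of the visits is below [del]. *)
have d0 : 0 < del / (c1 + 1) by rewrite divr_gt0// ltr_wpDl.
have [B [N [mB PB h]]] := coding_bound mS mlab a0 eta0 C_size mY d0 PE.
set L := error_cost I eta in h L0 *.
pose g0 y : R := a + 3 * eta + L * \1_(~` Y) y.
have mYC := measurableC mY.
have mg0 : measurable_fun setT g0.
  by apply: measurable_funD => //; apply: measurable_funM.
have mgB : measurable_fun setT (fun y => c1 * \1_B y).
  by apply: measurable_funM => //; exact: measurable_indic.
have g00 y : 0 <= g0 y.
  by rewrite /g0 !addr_ge0 ?mulr_ge0 ?(ltW eta0).
have gB0 y : 0 <= c1 * \1_B y by rewrite mulr_ge0.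
exists (g0 \+ (fun y => c1 * \1_B y)), (c1 * N%:R), (renewal (block_weight a eta C)).
have bge0 : forall w, 0 <= block_weight a eta C w := block_weight_ge0 lab a C eta0 point.
split.
- split; [exact: measurable_funD|by move=> x; rewrite addr_ge0|by rewrite mulr_ge0].
- under eq_integral do rewrite EFinD.
  rewrite ge0_integralD//; last 4 first.
  + by move=> x _; rewrite lee_fin.
  + exact/measurable_EFinP.
  + by move=> x _; rewrite lee_fin.
  + exact/measurable_EFinP.
  rewrite integral_indicE//.
  under eq_integral do rewrite EFinD.
  rewrite ge0_integralD//; last 3 first.
  + by move=> x _; rewrite lee_fin addr_ge0// mulr_ge0// ltW.
  + by move=> x _; rewrite lee_fin mulr_ge0.
  + by apply/measurable_EFinP; apply: measurable_funM => //; exact: measurable_indic.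
  rewrite integral_cst_probability integral_indicE//.
  move: PB; rewrite -[X in (X < _)%E]fineK ?fin_num_measure// lte_fin.
  rewrite -[P B]fineK ?fin_num_measure// -[P (~` Y)]fineK ?fin_num_measure//.
  rewrite -!EFinM -!EFinD lte_fin /rate => PB; rewrite ltrD2l.
  set p := fine (P B) in PB *.
  have : p * (c1 + 1) < del by rewrite -ltr_pdivlMr// ltr_wpDl.
  have : 0 <= p by exact: fine_ge0.
  nra.
- move=> w; apply: renewal_gt0 => // b.
  apply: (lt_le_trans _ (block_weight1_ge lab a C eta0 point b)).
  by rewrite invr_gt0 mulr_gt0// ltr0n.
- move=> n; apply: word_sum_renewal => //; exact: (sum_word_sum_block_weight lab eta0 C_size C_card point).
- by move=> n x; rewrite birkhoff_sum_add birkhoff_sumZ; exact: h.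
Qed.

(** By Gibbs' inequality the entropy is at most the mean code length; the constant [K] is absorbed
    in half of [del]. *)
Lemma word_entropy_coding (del : R) : 0 < del ->
  \forall n \near \oo, entropy n <= (rate + del) * n%:R.
Proof.
move=> del0; have d2 : 0 < del / 2 by lra.
have [g [K [q [[mg g0 K0] Ig q0 q1 h]]]] := coding_bound_integrated d2.
have ql1 w : q w <= 1.
  apply: le_trans (q1 (size w)).
  rewrite /word_sum (bigD1 (Tuple (introT eqP (erefl (size w)))))//= lerDl.
  by apply: sumr_ge0 => v _; exact: ltW.
have lq0 w : 0 <= - ln (q w) by rewrite oppr_ge0 ln_le0.
have If : (\int[P]_x (g x)%:E)%E \is a fin_num.
  rewrite ge0_fin_numE ?(lt_trans Ig) ?ltry//.
  by apply: integral_ge0 => x _; rewrite lee_fin.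
have key n : entropy n <= (rate + del / 2) * n%:R + K.
  apply: (@le_trans _ _ (word_sum n (fun w => prob w * - ln (q w)))).
    apply: gibbs_inequality => //; first by move=> w; exact: word_prob_ge0.
    exact: word_sum_prob.
  rewrite -lee_fin -(integral_itinerary P mS mlab n lq0).
  apply: (@le_trans _ _ (\int[P]_x (birkhoff_sum S g n x + K)%:E)%E).
    apply: ge0_le_integral => //.
    - by move=> x _; rewrite lee_fin.
    - apply/measurable_EFinP.
      exact: (measurable_itinerary mS mlab (fun w => - ln (q w))).
    - apply/measurable_EFinP/measurable_funD => //; exact: measurable_birkhoff_sum.
    - by move=> x _; rewrite lee_fin; exact: h.
  rewrite integral_birkhoff_sumD_cst//.
  move: Ig; rewrite -(fineK If) lte_fin => Ig.
  rewrite -EFinM -EFinD lee_fin lerD2r mulrC ler_wpM2r//; exact: ltW.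
near=> n; apply: le_trans (key n) _.
suff : K <= del / 2 * n%:R by lra.
rewrite -ler_pdivrMl//.
near: n; exact: nbhs_infty_ger.
Unshelve. all: by end_near. Qed.

(** The [eta] added to the rate of the entropy bound is the loss in [barron]. *)
Lemma word_prob_coding (del : R) : 0 < del ->
  {ae P, forall x, \forall n \near \oo,
    expR (- (rate + eta + del) * n%:R) <= prob (itin n x)}.
Proof.
move=> del0; have d2 : 0 < del / 2 by lra.
have [g [K [q [[mg g0 K0] Ig q0 q1 h]]]] := coding_bound_integrated d2.
have B1 := birkhoff_eventually_le mS PS ergS mg g0 Ig.
have B2 := @barron _ _ _ P S mS I lab mlab q eta eta0 q0 q1.
apply: filterS2 B1 B2 => x h1 h2; near=> n.
have p0 : 0 < prob (itin n x).
  apply: (@lt_le_trans _ _ (expR (- eta * n%:R) * q (itin n x))).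
    by rewrite mulr_gt0// expR_gt0.
  by near: n.
rewrite -[leRHS]lnK ?posrE// ler_expR.
apply: (@le_trans _ _ (ln (expR (- eta * n%:R) * q (itin n x)))).
  rewrite lnM ?posrE ?expR_gt0// expRK.
  have := h n x.
  have : birkhoff_sum S g n x <= (rate + del / 2) * n%:R by near: n.
  have : K <= del / 2 * n%:R.
    rewrite -ler_pdivrMl//.
    near: n; exact: nbhs_infty_ger.
  lra.
rewrite ler_ln ?posrE ?mulr_gt0 ?expR_gt0//.
by near: n.
Unshelve. all: by end_near. Qed.

End coding_consequences.

(* A family of pairwise disjoint sets [V m y] that is maximal among those of measure
   at least [expR (- a m)] provides the codebook. *)
Lemma local_dichotomy (V : nat -> T -> set T) (phi : T -> I) (Y : set T) (a : R) :
  measurable Y ->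
  (forall m x, measurable (V m x)) ->
  (forall m x, (P (V m.+1 x) <= P (V m (S x)))%E) ->
  (forall m x y, V m x `&` V m y !=set0 -> forall t, (t < m)%N ->
     Y (iter t S x) -> lab (iter t S x) = phi (iter t S y)) ->
  (forall a', a' < a -> {ae P, forall x, \forall n \near \oo,
     (P (V n x) < (expR (- a' * n%:R))%:E)%E}) \/
  exists C : nat -> seq (seq I),
    [/\ forall m u, u \in C m -> size u = m,
        forall m, (size (C m))%:R <= expR (a * m%:R) &
        P (lim_sup_set (codebook_event S lab C Y)) = 1%E].
Proof.
move=> mY mV VS Vphi.
(* The points where [V] is infinitely often large at some rate [a' < a]. A step along [S] shortens
   the length by one, which the gap between [a'] and [a] absorbs; hence the existential rate. *)
pose G := [set x | exists2 a', a' < a & forall n0, exists2 n, (n0 <= n)%N &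
   ((expR (- a' * n%:R))%:E <= P (V n x))%E].
pose VV m (s : seq T) i := if (i < size s)%N then V m (nth point s i) else set0.
pose separated m (s : seq T) :=
  (forall i, (i < size s)%N -> ((expR (- a * m%:R))%:E <= P (VV m s i))%E) /\
  trivIset setT (VV m s).
have sep_size m s : separated m s -> (size s)%:R <= expR (a * m%:R).
  move=> [sa sI].
  have mVV i : measurable (VV m s i) by rewrite /VV; case: ifP.
  have : (\sum_(i < size s) P (VV m s i) <= 1)%E.
    rewrite -measure_bigsetU// probability_le1//.
    by apply: bigsetU_measurable.
  move=> /(le_trans _) h.
  have {h} : (\sum_(i < size s) (expR (- a * m%:R))%:E <= 1)%E.
    by apply: h; apply: lee_sum => i _; exact: sa.
  rewrite sumEFin lee_fin sumr_const card_ord mulNr expRN -[_ *+ _]mulr_natl.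
  by rewrite ler_pdivrMr ?expR_gt0// mul1r.
have maximal m : exists2 s, separated m s & forall x, ~ separated m (x :: s).
  pose Q n := `[< exists2 s, separated m s & size s = n >].
  have Q0 : exists n, Q n.
    exists 0%N; apply/asboolP; exists [::] => //; split => //.
    by apply/trivIsetP => i j _ _ _; rewrite /VV/= setI0.
  have Qb n : Q n -> (n <= Num.truncn (expR (a * m%:R)))%N.
    move=> /asboolP[s /sep_size h <-].
    by rewrite truncn_ge_nat// expR_ge0.
  case: (ex_maxnP Q0 Qb) => n /asboolP[s sep sn] nmax.
  exists s => // x sepx.
  have /nmax : Q n.+1 by apply/asboolP; exists (x :: s) => //=; rewrite sn.
  by rewrite ltnn.
have [code codeP] := choice (fun m => let: ex_intro2 s h1 h2 := maximal m in
  ex_intro (fun s => separated m s /\ forall x, ~ separated m (x :: s)) s (conj h1 h2)).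
pose C m := [seq mkseq (fun t => phi (iter t S y)) m | y <- code m].
have C_size m u : u \in C m -> size u = m.
  by move=> /mapP[y _ ->]; rewrite size_mkseq.
have C_card m : (size (C m))%:R <= expR (a * m%:R).
  by rewrite size_map; apply: sep_size; case: (codeP m).
(* By maximality a large [V m x] meets some [V m y] of the family, and the codeword read off [y]
   through [phi] describes [x] at its times in [Y]. *)
have cover m x : ((expR (- a * m%:R))%:E <= P (V m x))%E -> codebook_event S lab C Y m x.
  move=> Vx; have [[sa /trivIsetP sI] smax] := codeP m.
  have [y ycode Vxy] : exists2 y, y \in code m & V m x `&` V m y !=set0.
    apply: contrapT => no; apply: (smax x); split.
      by move=> [//|i]; exact: sa.
    have disj y : y \in code m -> V m x `&` V m y = set0.
      move=> ys; apply/eqP; rewrite -[_ == _]negbK; apply/negP => /set0P h.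
      by apply: no; exists y.
    have disj0 i : V m x `&` VV m (code m) i = set0.
      rewrite /VV; case: ifP => [si|_]; last by rewrite setI0.
      exact/disj/mem_nth.
    apply/trivIsetP => -[|i] [|j] _ _ ij //.
    - exact: disj0.
    - by rewrite setIC; exact: disj0.
    - exact: sI.
  exists (mkseq (fun t => phi (iter t S y)) m); first exact: map_f.
  by apply: followsP => t tm; exact: Vphi Vxy t tm.
have GG' : G `<=` lim_sup_set (codebook_event S lab C Y).
  move=> x [a' a'a Gx] n0 _; have [n n0n h] := Gx n0; exists n => //.
  apply: cover; apply: le_trans h; rewrite lee_fin ler_expR ler_wpM2r//; lra.
have mG' : measurable (lim_sup_set (codebook_event S lab C Y)).
  apply: bigcap_measurable => // n _; apply: bigcup_measurable => m _.
  exact: measurable_codebook_event.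
have GS x : G x -> G (S x).
  move=> [a' a'a Gx]; exists ((a' + a) / 2); first lra.
  move=> n0; pose n1 := Num.truncn (a' / ((a - a') / 2)).
  have [[//|n] n0n h] := Gx (n0 + n1.+1).+1.
  exists n; first lia.
  apply: le_trans (le_trans h (VS _ _)); rewrite lee_fin ler_expR.
  have : a' < (a - a') / 2 * n%:R.
    rewrite -ltr_pdivrMl; last lra.
    rewrite mulrC; apply: (lt_le_trans (truncnS_gt _)).
    rewrite ler_nat -/n1; lia.
  rewrite -(natr1 n); lra.
case: (ergodic_forward_invariant mS PS ergS GS GG' mG') => [G0|G1]; last first.
  by right; exists C.
left => a' a'a; apply: (negligibleS _ G0) => x /= h; exists a' => //.
move=> n0; apply: contrapT => no; apply: h; exists n0 => // n /= n0n.
by rewrite ltNge; apply/negP => h; apply: no; exists n.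
Qed.

End local_entropy.

(** * The entropy rate *)

Section entropy_rate.
Context d (T : measurableType d) (R : realType) (P : probability T R).
Variable S : T -> T.
Hypothesis mS : measurable_fun setT S.
Hypothesis PS : invariant_measure S P.
Hypothesis ergS : ergodic S P.
Context (I : finType).
Variable lab : T -> I.
Hypothesis mlab : forall i, measurable (lab @^-1` [set i]).

Local Notation itin := (itinerary S lab).
Local Notation prob := (word_prob P S lab).
Local Notation entropy := (word_entropy P S lab).

Lemma nth_itinerary i0 n x t : (t < n)%N -> nth i0 (itin n x) t = lab (iter t S x).
Proof. by elim: n x t => // n IH x [|t] //= tn; rewrite IH// -iterSr. Qed.

Lemma word_entropy_le_ln_card n : entropy n <= ln #|I|%:R * n%:R.
Proof.
have k0 : (0 < #|I|)%N by apply/card_gt0P; exists (lab point).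
have k0R : 0 < #|I|%:R :> R by rewrite ltr0n.
pose q (w : seq I) : R := (#|I|%:R ^+ size w)^-1.
apply: (@le_trans _ _ (word_sum n (fun w => prob w * - ln (q w)))).
  apply: gibbs_inequality.
  - by move=> w; exact: word_prob_ge0.
  - by move=> w; rewrite invr_gt0 exprn_gt0.
  - exact: word_sum_prob.
  - rewrite /word_sum (eq_bigr (fun=> (#|I|%:R ^+ n)^-1)).
      by rewrite sumr_const card_tuple -[_ *+ _]mulr_natl natrX divff// gt_eqF// exprn_gt0.
    by move=> w _; rewrite /q size_tuple.
have -> : word_sum n (fun w => prob w * - ln (q w)) =
    word_sum n (fun w => (ln #|I|%:R * n%:R) * prob w).
  apply: word_sum_ext => w wn; rewrite mulrC /q wn lnV ?posrE ?exprn_gt0// opprK.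
  by rewrite lnXn// mulr_natr.
by rewrite word_sumZ word_sum_prob// mulr1.
Qed.

(* If almost every itinerary had probability less than [expR (- b n)] eventually,
   the entropy would exceed [h n]; otherwise likely words form the codebooks. *)
Lemma entropy_dichotomy (h a : R) :
  (forall n0, exists n, [/\ (n0 <= n)%N, (0 < n)%N & entropy n <= h * n%:R]) -> h < a ->
  (\forall n \near \oo, entropy n <= a * n%:R) /\
  {ae P, forall x, \forall n \near \oo, expR (- a * n%:R) <= prob (itin n x)}.
Proof.
move=> Hh ha.
have h0 : 0 <= h.
  have [n [_ n0 hn]] := Hh 0%N.
  have := le_trans (word_entropy_ge0 P mS mlab n) hn.
  by rewrite pmulr_lge0// ltr0n.
pose b := (h + a) / 2; have b0 : 0 <= b by rewrite /b; lra.
have hb : h < b by rewrite /b; lra.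
pose V n x := word_cell S lab (itin n x).
have mV n x : measurable (V n x) by exact: measurable_word_cell.
have VS m x : (P (V m.+1 x) <= P (V m (S x)))%E.
  have := measure_preimage_iter mS PS 1 (mV m (S x)) => /= <-.
  apply: le_measure; rewrite ?inE//.
    exact: (measurable_preimage_iter mS 1).
  by move=> y; rewrite /V /word_cell /= !size_itinerary => -[_].
have Vphi m x y : V m x `&` V m y !=set0 -> forall t, (t < m)%N ->
     [set: T] (iter t S x) -> lab (iter t S x) = lab (iter t S y).
  move=> [z []]; rewrite /V /word_cell /= !size_itinerary => zx zy t tm _.
  by rewrite -(nth_itinerary (lab x) x tm) -zx zy nth_itinerary.
have [low|[C [C_size C_card PE]]] :=
  @local_dichotomy _ _ _ P S mS PS ergS I lab mlab V lab setT b measurableT mV VS Vphi.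
  exfalso.
  pose a' := (h + b) / 2; have a'b : a' < b by rewrite /a'; lra.
  have ha' : h < a' by rewrite /a'; lra.
  have a'0 : 0 < a' by lra.
  have {}low := low a' a'b.
  pose E n := \bigcap_(m in [set m | (n <= m)%N]) [set x | prob (itin m x) < expR (- a' * m%:R)].
  have mE n : measurable (E n).
    apply: bigcap_measurable => [|m _]; first by exists n => /=.
    exact: (measurable_itinerary_pred R mS mlab (fun w => prob w < expR (- a' * m%:R))).
  have PE : P (\bigcup_(n in [set n | (0 <= n)%N]) E n) = 1%E.
    apply/eqP; rewrite eq_le probability_le1/=; last by apply: bigcup_measurable.
    have mU : measurable (\bigcup_(n in [set n | (0 <= n)%N]) E n) by apply: bigcup_measurable.
    suff PU : P (~` \bigcup_(n in [set n | (0 <= n)%N]) E n) = 0%E.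
      by have := probability_setC P (measurableC mU); rewrite setCK PU sube0 => ->.
    apply/negligibleP; first exact: measurableC.
    apply: negligibleS low => x /= nE [N _ hN]; apply: nE; exists N => // m /= Nm.
    have := hN m Nm; rewrite /V word_probE//.
  (* At a time [n] with [entropy n <= h * n], the words of probability below [expR (- a' * n)] carry
     at most the mass [h / a']. The threshold is the complement of this to 1. *)
  have e0 : 0 < (a' - h) / a' by rewrite divr_gt0// subr_gt0.
  have [N PN] := first_occurrence_bound mE e0 PE.
  have [n [Nn n0 Hn]] := Hh N.
  pose Q w := expR (- a' * n%:R) <= prob w.
  have PQ : word_sum n (fun w => prob w * (Q w)%:R) < (a' - h) / a'.
    rewrite -lte_fin -(measure_itinerary_pred P mS mlab Q n).
    apply: le_lt_trans PN; apply: le_measure; rewrite ?inE.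
    - exact: (measurable_itinerary_pred R mS mlab).
    - by apply: measurableC; apply: bigcup_measurable.
    - move=> x; rewrite /Q/= => Qx [m /= mN] /(_ n).
      have mn : (m <= n)%N by apply: leq_trans Nn; exact: ltnW.
      by move=> /(_ mn) /=; rewrite ltNge Qx.
  have : a' * n%:R * (1 - word_sum n (fun w => prob w * (Q w)%:R)) <= entropy n.
    rewrite -[X in X - _](word_sum_prob P mS mlab n) -word_sumB -word_sumZ; apply: ler_word_sum => w _.
    have p0 := word_prob_ge0 P S lab w.
    rewrite /Q; case: (leP (expR (- a' * n%:R)) (prob w)) => hw.
      rewrite mulr1 subrr mulr0 -mulrN mulr_ge0// oppr_ge0.
      exact/ln_le0/word_prob_le1.
    rewrite mulr0 subr0 mulrC -mulrN.
    move: p0; rewrite le_eqVlt => /orP[/eqP <-|p0]; first by rewrite !mul0r.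
    rewrite ler_pM2l//.
    by rewrite lerNr -mulNr -(expRK (- a' * n%:R)) ler_ln ?posrE ?expR_gt0// ltW.
  move=> /le_trans/(_ Hn).
  set s := word_sum _ _ in PQ *.
  have n0R : 0 < n%:R :> R by rewrite ltr0n.
  rewrite -mulrA [n%:R * _]mulrC mulrA ler_pM2r//.
  have : s * a' < a' - h by rewrite -ltr_pdivlMr.
  by nra.
have aY : fine (P (~` [set: T])) = 0 by rewrite setCT measure0.
(* The rates obtained below are [b + 4 * eta] and [b + 5 * eta], both under [a]. *)
pose eta := (a - b) / 8.
have eta0 : 0 < eta by rewrite /eta /b; lra.
split.
  have := word_entropy_coding mS PS mlab b0 eta0 C_size C_card measurableT PE eta0.
  apply: filterS => n; rewrite aY mulr0 addr0 => /le_trans; apply.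
  by rewrite ler_wpM2r// /eta /b; lra.
have := word_prob_coding mS PS ergS mlab b0 eta0 C_size C_card measurableT PE eta0.
apply: filterS => x; apply: filterS => n; rewrite aY mulr0 addr0; apply: le_trans.
by rewrite ler_expR ler_wpM2r// /eta /b; lra.
Qed.

(** The infimum of this set is the lower limit of [entropy n / n]; [entropy_dichotomy] makes it a
    limit without an appeal to subadditivity. *)
Let entropy_bounds := [set h : R | forall n0, exists n,
  [/\ (n0 <= n)%N, (0 < n)%N & entropy n <= h * n%:R]].

Definition entropy_rate : R := inf entropy_bounds.

Let has_inf_entropy_bounds : has_inf entropy_bounds.
Proof.
split; first by exists (ln #|I|%:R) => n0; exists n0.+1; split => //; exact: word_entropy_le_ln_card.
exists 0 => h /(_ 0%N)[n [_ n0 hn]].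
have := le_trans (word_entropy_ge0 P mS mlab n) hn.
by rewrite pmulr_lge0// ltr0n.
Qed.

Lemma entropy_rate_lt a : entropy_rate < a ->
  (\forall n \near \oo, entropy n <= a * n%:R) /\
  {ae P, forall x, \forall n \near \oo, expR (- a * n%:R) <= prob (itin n x)}.
Proof.
move=> ha; have e0 : 0 < a - entropy_rate by rewrite subr_gt0.
have [h hh] := inf_adherent e0 has_inf_entropy_bounds.
by rewrite addrC subrK; exact: entropy_dichotomy.
Qed.

Lemma entropy_rate_gt a : a < entropy_rate ->
  \forall n \near \oo, a * n%:R < entropy n.
Proof.
move=> ha; apply: contrapT => no.
suff : entropy_rate <= a by rewrite leNgt ha.
apply: ge_inf; first by case: has_inf_entropy_bounds.
move=> n0; apply: contrapT => h; apply: no; exists n0.+1 => // n /= n0n.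
rewrite ltNge; apply/negP => hn; apply: h; exists n; split => //; first exact: ltnW.
exact: leq_ltn_trans n0n.
Qed.

Lemma cvg_entropy_rate : n%:R^-1 * entropy n @[n --> \oo] --> entropy_rate.
Proof.
apply/cvgrPdist_le => e e0.
have [h1 _] : _ /\ _ := @entropy_rate_lt (entropy_rate + e) (ltr_pwDr e0 (lexx _)).
have h2 : \forall n \near \oo, (entropy_rate - e) * n%:R < entropy n.
  by apply: entropy_rate_gt; rewrite ltrBlDr ltrDl.
near=> n; have n0 : 0 < n%:R :> R by rewrite ltr0n; near: n; exists 1%N.
rewrite ler_distlC mulrC ler_pdivlMr// ler_pdivrMr//.
by apply/andP; split; [apply: ltW; near: n|near: n].
Unshelve. all: by end_near. Qed.

(** If the sets [V] were not eventually small, their codebooks would compress itineraries below the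
    entropy rate. The label at [x] is predicted by [phi] from another centre [y], and only at times
    in [Y]: this leaves room for uncertain labels near boundaries. *)
Lemma local_entropy_ge (V : nat -> T -> set T) (phi : T -> I) (Y : set T) (a eta a' : R) :
  measurable Y ->
  (forall m x, measurable (V m x)) ->
  (forall m x, (P (V m.+1 x) <= P (V m (S x)))%E) ->
  (forall m x y, V m x `&` V m y !=set0 -> forall t, (t < m)%N ->
     Y (iter t S x) -> lab (iter t S x) = phi (iter t S y)) ->
  0 <= a -> 0 < eta ->
  a + 3 * eta + error_cost I eta * fine (P (~` Y)) < entropy_rate -> a' < a ->
  {ae P, forall x, \forall n \near \oo, (P (V n x) < (expR (- a' * n%:R))%:E)%E}.
Proof.
move=> mY mV VS Vphi a0 eta0 small a'a.
have [low|[C [C_size C_card PE]]] :=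
  @local_dichotomy _ _ _ P S mS PS ergS I lab mlab V phi Y a mY mV VS Vphi.
  exact: low.
exfalso; set rate := (X in X < _) in small.
pose del := (entropy_rate - rate) / 2.
have del0 : 0 < del by rewrite /del; lra.
have h1 := word_entropy_coding mS PS mlab a0 eta0 C_size C_card mY PE del0.
have : rate + del < entropy_rate by rewrite /del; lra.
move=> /entropy_rate_gt h2.
have [n h12] : exists n, (rate + del) * n%:R < entropy n <= (rate + del) * n%:R.
  near \oo => n; exists n; apply/andP; split; near: n; [exact: h2|exact: h1].
by move: h12 => /andP[/lt_le_trans h /h]; rewrite ltxx.
Unshelve. all: by end_near. Qed.

End entropy_rate.

(** * Prehistories and the entropy of the past *)

Lemma g_sigma_algebra_ind (T : pointedType) (G : set (set T)) (Q : set T -> Prop) :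
  Q set0 -> (forall A, G A -> Q A) -> (forall A, Q A -> Q (~` A)) ->
  (forall A : (set T)^nat, (forall n, Q (A n)) -> Q (\bigcup_n A n)) ->
  forall A : set (g_sigma_algebraType G), measurable A -> Q A.
Proof.
move=> Q0 QG QC QU A; apply: smallest_sub => //; split => // B QB.
by rewrite setTD; exact: QC.
Qed.

Lemma measurable_fun_g_sigma_algebra d (T : measurableType d) (U : pointedType)
    (G : set (set U)) (f : T -> U) :
  (forall A, G A -> measurable (f @^-1` A)) ->
  measurable_fun setT (f : T -> g_sigma_algebraType G).
Proof.
move=> mf _ A mA; rewrite setTI.
apply: (g_sigma_algebra_ind (Q := fun A => measurable (f @^-1` A))) mA => //.
- by rewrite preimage_set0.
- by move=> B mB; rewrite -preimage_setC; exact: measurableC.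
- by move=> B mB; rewrite preimage_bigcup; exact: bigcupT_measurable.
Qed.

(** * Borel sets and compact metric spaces *)

Section borel_sets.
Context (X : ptopologicalType).

Lemma open_borel (A : set X) : open A -> measurable (A : set (borel X)).
Proof. by move=> oA; exact: sub_sigma_algebra. Qed.

Lemma closed_borel (A : set X) : closed A -> measurable (A : set (borel X)).
Proof.
move=> cA; rewrite -[A]setCK; apply: measurableC; apply: open_borel.
exact: closed_openC.
Qed.

End borel_sets.

Lemma continuous_borel (X Y : ptopologicalType) (f : X -> Y) :
  continuous f -> measurable_fun setT (f : borel X -> borel Y).
Proof.
move=> cf; apply: measurable_fun_g_sigma_algebra => A oA; apply: open_borel.
by apply: open_comp => // x _; exact: cf.
Qed.

Section metric_spaces.
Context (R : realType) (X : pmetricType R).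
Implicit Types (x y z : X) (e r : R).

Lemma ballP x e y : ball x e y <-> mdist x y < e.
Proof. by rewrite ballEmdist. Qed.

Lemma open_mball x e : open [set y : X | mdist x y < e].
Proof.
rewrite openE => y /= xy; apply/nbhs_ballP.
exists (e - mdist x y) => /=; first by rewrite subr_gt0.
move=> z /ballP yz /=; rewrite (le_lt_trans (metric_triangle x y z))//.
by rewrite -ltrBrDl.
Qed.

Lemma closed_mball x e : closed [set y : X | mdist x y <= e].
Proof.
rewrite -[X in closed X]setCK; apply: open_closedC.
rewrite openE => y /= /negP; rewrite -ltNge => xy; apply/nbhs_ballP.
exists (mdist x y - e) => /=; first by rewrite subr_gt0.
move=> z /ballP yz /=; apply/negP; rewrite -ltNge.
have := metric_triangle x z y; rewrite (metric_sym z y); lra.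
Qed.

(** The balls are centred in [K], but [Q] concerns the whole ball in [X], so that points of [K] can
    be compared with nearby points outside. *)
Lemma lebesgue_number (K : set X) (Q : set X -> Prop) :
  compact K -> (forall A B, A `<=` B -> Q B -> Q A) ->
  (forall x, K x -> exists2 r, 0 < r & Q [set y | mdist x y < r]) ->
  exists2 e, 0 < e & forall x, K x -> Q [set y | mdist x y < e].
Proof.
move=> /compact_near_coveringP cK Qmono Qloc.
have := cK R 0^'+ (fun e x => Q [set y | mdist x y < e]) _.
case.
  move=> x /Qloc[r r0 Qr].
  exists ([set y | mdist x y < r / 2], [set e | 0 < e < r / 2]) => /=.
    split; first by apply/nbhs_ballP; exists (r / 2) => /=; [lra|move=> y /ballP].
    exists (r / 2) => /=; first lra.
    move=> e; rewrite /ball_/= sub0r normrN => h e0.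
    by rewrite e0/= (le_lt_trans (ler_norm _) h).
  move=> [y e] /= [xy /andP[_ er]]; apply: Qmono Qr => z /= yz.
  have := metric_triangle x y z; lra.
move=> e /= e0 h; exists (e / 2); first lra.
apply: h => /=; last lra.
by rewrite sub0r normrN gtr0_norm; lra.
Qed.

Hypothesis cX : compact [set: X].

Lemma compact_finite_net e : 0 < e ->
  exists s : seq X, forall x, exists2 y, y \in s & mdist y x < e.
Proof.
move=> e0; have := cX; rewrite compact_cover.
move=> /(_ X setT (fun x => [set y | mdist x y < e])) [].
- by move=> x _; exact: open_mball.
- by move=> x _; exists x => //=; rewrite mdistxx.
move=> D _ h; exists (finmap.enum_fset D) => x.
by have [y yD xy] := h x I; exists y.
Qed.

Lemma compact_small_partition e : 0 < e ->
  exists n (A : 'I_n -> set X),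
    measurable_partition (A : 'I_n -> set (borel X)) /\
    forall i x y, A i x -> A i y -> mdist x y < e.
Proof.
move=> e0; have e2 : 0 < e / 2 by lra.
have [s hs] := compact_finite_net e2.
pose B i := [set x | mdist (nth point s i) x < e / 2].
exists (size s), (fun i : 'I_(size s) => B i `\` \bigcup_(j in [set j | (j < i)%N]) B j).
have mB i : measurable (B i : set (borel X)) by apply: open_borel; exact: open_mball.
split; last first.
  move=> i x y [+ _] [+ _]; rewrite /B/= => ix iy.
  by have := metric_triangle x (nth point s i) y; rewrite (metric_sym x (nth point s i)); lra.
split.
- by move=> i; apply: measurableD => //; apply: bigcup_measurable.
- apply/trivIsetP => i j _ _ ij; apply/seteqP; split => // x [[xi hi] [xj hj]].
  have [ij'|ji|/val_inj/eqP] := ltngtP i j; last by rewrite (negPf ij).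
  + by apply: hj; exists i.
  + by apply: hi; exists j.
- apply/seteqP; split => // x _.
  pose Q i := (i < size s)%N && `[< B i x >].
  have Q0 : exists i, Q i.
    have [y ys yx] := hs x; exists (index y s); rewrite /Q index_mem ys /=.
    by apply/asboolP; rewrite /B/= nth_index.
  case: (ex_minnP Q0) => i /andP[si /asboolP Bi] imin.
  exists (Ordinal si) => //; split => // -[j /= ji Bj].
  have /imin : Q j by rewrite /Q (ltn_trans ji)//=; apply/asboolP.
  by rewrite leqNgt ji.
Qed.

Lemma distance_to_closed_lb (C : set X) x : closed C -> ~ C x ->
  exists n : nat, forall y, C y -> n.+1%:R^-1 <= mdist x y.
Proof.
move=> cC nCx.
have : nbhs x (~` C) by apply: open_nbhs_nbhs; split => //; exact: closed_openC.
move=> /nbhs_ballP[e /= e0 he]; exists (Num.truncn e^-1) => y Cy.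
rewrite leNgt; apply/negP => xy; apply: (he y) Cy; apply/ballP.
apply: (lt_trans xy); rewrite -[ltRHS]invrK ltf_pV2 ?posrE ?invr_gt0 ?ltr0n//.
exact: truncnS_gt.
Qed.

Variable mu : probability (borel X) R.

(** The sets with this property form a sigma-algebra containing the open sets. Approximating from
    both sides at once turns complements into a swap. *)
Lemma borel_regular (A : set (borel X)) e : measurable A -> 0 < e ->
  exists (C O : set X), [/\ closed C, open O, C `<=` A, A `<=` O & (mu (O `\` C) < e%:E)%E].
Proof.
move=> mA; move: e; pattern A; apply: (g_sigma_algebra_ind _ _ _ _ mA) => {A mA}.
- by move=> e e0; exists set0, set0; split => //; [exact: closed0|exact: open0|rewrite setD0 measure0].
- move=> O oO e e0.
  (* Closed sets that exhaust [O]: the points at distance at least [1 / (n + 1)] from its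
     complement. *)
  pose C n := [set x | forall y, ~ O y -> n.+1%:R^-1 <= mdist x y].
  have cC n : closed (C n).
    have -> : C n = \bigcap_(y in ~` O) [set x | n.+1%:R^-1 <= mdist x y].
      by apply/seteqP; split.
    apply: closed_bigI => y _; rewrite -[X in closed X]setCK; apply: open_closedC.
    rewrite (_ : ~` _ = [set x | mdist y x < n.+1%:R^-1]); first exact: open_mball.
    by apply/seteqP; split => x /=; rewrite metric_sym ltNge => /negP.
  have CO n : C n `<=` O.
    move=> x Cx; apply: contrapT => nOx; have := Cx x nOx.
    by rewrite mdistxx leNgt invr_gt0 ltr0n.
  have mO : measurable (O : set (borel X)) := open_borel oO.
  have mOC n : measurable (O `\` C n : set (borel X)).
    by apply: measurableD => //; exact: closed_borel.
  have : mu (O `\` C n) @[n --> \oo] --> mu (\bigcap_n (O `\` C n)).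
    apply: nonincreasing_cvg_mu => //.
    - by rewrite (le_lt_trans (probability_le1 _ _))// ltry.
    - exact: bigcap_measurable.
    - move=> m n mn; apply/subsetPset => x [Ox nCx]; split => // Cx; apply: nCx => y nOy.
      by apply: le_trans (Cx y nOy); rewrite lef_pV2 ?posrE ?ltr0n// ler_nat.
  have -> : \bigcap_n (O `\` C n) = set0.
    apply/seteqP; split => // x h; have [Ox _] := h 0%N I.
    have [n hn] := @distance_to_closed_lb (~` O) x (open_closedC oO) (fun nO => nO Ox).
    by have [_ nC] := h n I; apply: nC => y; exact: hn.
  rewrite measure0 => /fine_cvgP[_] /cvgrPdist_lt /(_ e e0)[N _ /(_ N (leqnn N))] /=.
  rewrite sub0r normrN => h; exists (C N), O; split => //.
  rewrite -[X in (X < _)%E](@fineK _ (mu (O `\` C N))) ?fin_num_measure// lte_fin.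
  by rewrite (le_lt_trans (ler_norm _)).
- move=> A IH e e0; have [C [U [clC opU CA AU h]]] := IH e e0.
  exists (~` U), (~` C); split.
  + exact: open_closedC.
  + exact: closed_openC.
  + exact: subsetC.
  + exact: subsetC.
  + by rewrite setDE setCK setIC -setDE.
- move=> A IH e e0.
  (* These errors add up to at most [e / 2]. The other half pays for replacing the union of all the
     inner sets, which need not be closed, by a finite union [D n]. *)
  have en n : 0 < e / (4 * 2 ^+ n) by rewrite divr_gt0// mulr_gt0// exprn_gt0.
  have /choice[CO hCO] : forall n, exists CO : set X * set X,
      [/\ closed CO.1, open CO.2, CO.1 `<=` A n, A n `<=` CO.2 &
      (mu (CO.2 `\` CO.1) < (e / (4 * 2 ^+ n))%:E)%E].
    by move=> n; have [C [U h]] := IH n _ (en n); exists (C, U).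
  pose C n := (CO n).1; pose O := \bigcup_n (CO n).2.
  pose D n := \bigcup_(i in [set i | (i < n)%N]) C i.
  have mC n : measurable (C n : set (borel X)) by apply: closed_borel; case: (hCO n).
  have mO n : measurable ((CO n).2 : set (borel X)) by apply: open_borel; case: (hCO n).
  have mOO : measurable (O : set (borel X)) by exact: bigcupT_measurable.
  have mD n : measurable (D n : set (borel X)) by apply: bigcup_measurable.
  have cD n : closed (D n).
    by apply: closed_bigcup => [|i _]; [exact: finite_II|case: (hCO i)].
  have mUC : measurable (\bigcup_n C n : set (borel X)) by exact: bigcupT_measurable.
  have half : (mu (O `\` \bigcup_n C n) <= (e / 2)%:E)%E.
    apply: (@le_trans _ _ (\sum_(0 <= n <oo) mu ((CO n).2 `\` C n))%E).
      apply: measure_sigma_subadditive.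
      - by move=> n; exact: measurableD.
      - exact: measurableD.
      - by move=> x [[n _ Onx] nC]; exists n => //; split => // Cx; apply: nC; exists n.
    apply: lime_le; first by apply: is_cvg_nneseries => n _ _; exact: measure_ge0.
    apply: nearW => n; apply: (@le_trans _ _ (\sum_(0 <= i < n) (e / (4 * 2 ^+ i))%:E)%E).
      by apply: lee_sum => i _; case: (hCO i) => _ _ _ _ /ltW.
    rewrite sumEFin lee_fin big_mkord.
    suff -> : \sum_(i < n) e / (4 * 2 ^+ i) = e / 2 - e / 2 * 2^-1 ^+ n.
      by rewrite gerBl mulr_ge0// ?exprn_ge0//; lra.
    elim: n => [|n IHn]; first by rewrite big_ord0 expr0 mulr1 subrr.
    rewrite big_ord_recr/= IHn exprS exprVn; field.
    by rewrite expf_neq0.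
  have : mu (O `\` D n) @[n --> \oo] --> mu (\bigcap_n (O `\` D n)).
    apply: nonincreasing_cvg_mu => //.
    - by rewrite (le_lt_trans (probability_le1 _ _))// ?ltry//; exact: measurableD.
    - by move=> n; exact: measurableD.
    - by apply: bigcap_measurable => // n _; exact: measurableD.
    - move=> m n mn; apply/subsetPset => x [Ox nDx]; split => // -[i /= im Cx]; apply: nDx.
      by exists i => //=; exact: leq_trans mn.
  have -> : \bigcap_n (O `\` D n) = O `\` \bigcup_n C n.
    apply/seteqP; split => x.
      move=> h; split; first by case: (h 0%N I).
      by move=> [n _ Cx]; have [_] := h n.+1 I; apply; exists n => /=.
    by move=> [Ox nC] n _; split => // -[i _ Cx]; apply: nC; exists i.
  have mOC : measurable (O `\` \bigcup_n C n : set (borel X)) by exact: measurableD.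
  rewrite -(fineK (fin_num_measure mu _ mOC)) lee_fin in half.
  rewrite -(fineK (fin_num_measure mu _ mOC)).
  move=> /fine_cvgP[_] /cvgrPdist_lt /(_ (e / 2)).
  case; first lra.
  move=> N _ /(_ N (leqnn N)) /=; rewrite ltr_distlC => /andP[_ h].
  exists (D N), O; split => //.
  + by apply: bigcup_open => n _; case: (hCO n).
  + by move=> x [n _ Cx]; exists n => //; have [_ _ + _ _] := hCO n; apply.
  + by move=> x [n _ Ax]; exists n => //; have [_ _ _ + _] := hCO n; apply.
  + rewrite -[X in (X < _)%E](@fineK _ (mu (O `\` D N))) ?fin_num_measure//; last exact: measurableD.
    by rewrite lte_fin; lra.
Qed.

End metric_spaces.

(** * The shift on prehistories *)

Section inverse_limit_process.
Context (R : realType) (X : pmetricType R).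
Variable f : X -> X.
Local Notation Omega := {ptws nat -> X}.

(** On [inverse_limit] this is the inverse of \hat f: it forgets [x_0]. *)
Definition left_shift (xh : Omega) : Omega := fun i => xh i.+1.

Lemma iter_shift n (xh : Omega) i : iter n left_shift xh i = xh (i + n)%N.
Proof.
by elim: n i => [|n IH] i; rewrite ?addn0// iterS {1}/left_shift IH addSnnS.
Qed.

Lemma coordinate_continuous n : continuous (fun xh : Omega => xh n).
Proof. exact: (@proj_continuous _ (fun=> X : topologicalType) n). Qed.

Lemma shift_continuous : continuous left_shift.
Proof.
move=> xh.
have FF : Filter (left_shift @ xh) := fmap_filter left_shift (nbhs_filter xh).
have H := @cvg_sup _ nat (fun i => Topological.class
  (initial_topology (fun g : (forall i : nat, (fun=> X : topologicalType) i) => g i)))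
  (left_shift @ xh) (left_shift xh) FF.
apply H => i A /= [_ [[B oB <-] Bxi sBA]].
have : nbhs xh ((fun y : Omega => y i.+1) @^-1` B).
  by apply: coordinate_continuous; apply: open_nbhs_nbhs; split.
by apply: filterS => y By; exact: sBA.
Qed.

Lemma measurable_coord n :
  measurable_fun setT ((fun xh => xh n) : borel Omega -> borel X).
Proof.
apply: measurable_fun_g_sigma_algebra => A oA; apply: sub_sigma_algebra.
by apply: open_comp oA => x _; exact: coordinate_continuous.
Qed.

Lemma measurable_shift : measurable_fun setT (left_shift : borel Omega -> borel Omega).
Proof.
apply: measurable_fun_g_sigma_algebra => A oA; apply: sub_sigma_algebra.
by apply: open_comp oA => x _; exact: shift_continuous.
Qed.

Lemma closed_equalizer (Y : topologicalType) (u v : Y -> X) :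
  continuous u -> continuous v -> closed [set y | u y = v y].
Proof.
move=> cu cv; rewrite -[X in closed X]setCK; apply: open_closedC.
rewrite openE => y /= uv.
pose e := mdist (u y) (v y) / 2.
have e0 : 0 < e by rewrite divr_gt0// mdist_gt0; exact/eqP.
have hu : \forall z \near y, mdist (u y) (u z) < e.
  have : nbhs y (u @^-1` ball (u y) e) by apply: cu; exact: nbhsx_ballx.
  by apply: filterS => z /= /ballP.
have hv : \forall z \near y, mdist (v y) (v z) < e.
  have : nbhs y (v @^-1` ball (v y) e) by apply: cv; exact: nbhsx_ballx.
  by apply: filterS => z /= /ballP.
apply: filterS2 hu hv => z uz vz /= uvz.
have := metric_triangle (u y) (v z) (v y).
rewrite -[in mdist (u y) (v z)]uvz (metric_sym (v z)).
move: uz vz; rewrite /e; lra.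
Qed.

Hypothesis cf : continuous f.

Lemma closed_inverse_limit : closed (inverse_limit f).
Proof.
rewrite (_ : inverse_limit f = \bigcap_i [set xh : Omega | f (xh i.+1) = xh i]).
  apply: closed_bigI => i _; apply: closed_equalizer; last exact: coordinate_continuous.
  by move=> xh; apply: continuous_comp; [exact: coordinate_continuous|exact: cf].
by apply/seteqP; split => xh h i; [move=> _; exact: h|exact: h].
Qed.

Lemma measurable_inverse_limit : measurable (inverse_limit f : set (borel Omega)).
Proof.
rewrite -[X in measurable X]setCK; apply: measurableC; apply: sub_sigma_algebra.
exact: closed_openC closed_inverse_limit.
Qed.

Lemma compact_inverse_limit : compact [set: X] -> compact (inverse_limit f).
Proof.
move=> cX.
have cT := @tychonoff nat (fun=> X : topologicalType) (fun=> setT) (fun=> cX).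
by apply: (@subclosed_compact Omega _ _ closed_inverse_limit cT).
Qed.

Lemma inverse_limit_iter (xh : Omega) n i : inverse_limit f xh ->
  iter n f (xh (n + i)%N) = xh i.
Proof.
by move=> xhL; elim: n => // n IH; rewrite iterSr addSn xhL IH.
Qed.

Variables (mu : probability (borel X) R) (muh : probability (borel Omega) R).
Hypothesis lift : is_inverse_limit_lift f mu muh.

(** The shift undoes [inverse_limit_map] on every sequence, by computation, so the invariance of
    [muh] is applied to the preimage of [A] under the shift. Ergodicity passes over for the same
    reason. *)
Lemma muh_shift_invariant :
  invariant_measure (left_shift : borel Omega -> borel Omega) muh.
Proof.
move=> A mA; have [_ inv _ _] := lift.
rewrite -inv; last by rewrite -[X in measurable X]setTI; exact: measurable_shift.
by congr (muh _); apply/seteqP; split.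
Qed.

Lemma muh_shift_ergodic : ergodic (left_shift : borel Omega -> borel Omega) muh.
Proof.
move=> A mA AS; have [_ _ erg _] := lift; apply: erg => //.
by rewrite -[in LHS]AS; apply/seteqP; split.
Qed.

Lemma muh_coord n (A : set (borel X)) : measurable A ->
  muh ((fun xh : Omega => xh n) @^-1` A) = mu A.
Proof.
move=> mA; have [_ _ _ law] := lift.
rewrite -law//.
rewrite -[RHS](measure_preimage_iter measurable_shift muh_shift_invariant n).
  by congr (muh _); apply/seteqP; split => xh; rewrite /= iter_shift.
by rewrite -[X in measurable X]setTI; exact: measurable_coord.
Qed.

Lemma ae_inverse_limit : {ae muh, forall xh, inverse_limit f xh}.
Proof.
exists (~` inverse_limit f); split => //.
- by apply: measurableC; exact: measurable_inverse_limit.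
- rewrite probability_setC; last exact: measurable_inverse_limit.
  by have [-> _ _ _] := lift; rewrite subee.
Qed.

Lemma muh_eq_inverse_limit (A B : set (borel Omega)) :
  measurable A -> measurable B ->
  (forall xh, inverse_limit f xh -> A xh <-> B xh) -> muh A = muh B.
Proof.
move=> mA mB AB; have mL := measurable_inverse_limit.
have null (C : set (borel Omega)) : measurable C -> muh C = muh (C `&` inverse_limit f).
  move=> mC; rewrite (measureDI muh mC mL).
  rewrite [X in (X + _)%E](_ : _ = 0%E) ?add0e//.
  have L0 : muh (~` inverse_limit f) = 0%E.
    by rewrite probability_setC//; have [-> _ _ _] := lift; rewrite subee.
  have sub : C `\` inverse_limit f `<=` ~` inverse_limit f by move=> x [].
  apply: subset_measure0 sub _ => //; [exact: measurableD|exact: measurableC].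
rewrite (null A mA) (null B mB); congr (muh _).
by apply/seteqP; split => xh [h hL]; split => //; apply/(AB xh hL).
Qed.

End inverse_limit_process.

Lemma partition_label d (T : measurableType d) (I : Type) (A : I -> set T) :
  measurable_partition A -> exists lab : T -> I, forall x i, A i x <-> lab x = i.
Proof.
move=> [_ tA UA].
have ex x : exists i, A i x.
  by have : [set: T] x by []; rewrite -UA => -[i _ Aix]; exists i.
have [lab labP] := choice ex; exists lab => x i; split; last by move=> <-.
by move=> Aix; apply: tA => //; exists x.
Qed.

Section inverse_limit_entropy.
Context (R : realType) (X : pmetricType R).
Variable f : X -> X.
Local Notation Omega := {ptws nat -> X}.
Local Notation shiftO := (@left_shift R X : borel Omega -> borel Omega).
Hypothesis cf : continuous f.
Variables (mu : probability (borel X) R) (muh : probability (borel Omega) R).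
Hypothesis lift : is_inverse_limit_lift f mu muh.

Section partition.
Context (k : nat) (A : 'I_k -> set X).
Hypothesis pA : measurable_partition (A : 'I_k -> set (borel X)).
Variable labX : X -> 'I_k.
Hypothesis labXP : forall x i, A i x <-> labX x = i.

Definition label0 (xh : borel Omega) : 'I_k := labX (xh 0%N).

Lemma measurable_label0 i : measurable (label0 @^-1` [set i]).
Proof.
have -> : label0 @^-1` [set i] = (fun xh : Omega => xh 0%N) @^-1` A i.
  by apply/seteqP; split => xh; rewrite /label0/= labXP.
rewrite -[X in measurable X]setTI; apply: measurable_coord => //.
by have [] := pA.
Qed.

Lemma itinerary_labelE n (xh : borel Omega) :
  itinerary shiftO label0 n xh = mkseq (fun t => labX (xh t)) n.
Proof.
apply: (@eq_from_nth _ (label0 xh)); rewrite size_itinerary ?size_mkseq// => t tn.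
rewrite nth_itinerary// nth_mkseq// /label0.
by congr labX; exact: (iter_shift t (xh : Omega) 0%N).
Qed.

Lemma measurable_itinerary_cell n (w : {ffun 'I_n -> 'I_k}) :
  measurable (itinerary_cell (f : borel X -> borel X) (A : 'I_k -> set (borel X)) w).
Proof.
rewrite (_ : itinerary_cell _ _ w =
    \bigcap_(i in [set: 'I_n]) (iter i f @^-1` A (w i) : set (borel X))).
  apply: fin_bigcap_measurable => // i _.
  have mA : measurable (A (w i) : set (borel X)) by have [] := pA.
  exact: (measurable_preimage_iter (continuous_borel cf) i mA).
by apply/seteqP; split => x h i //; [move=> _; exact: h|exact: h].
Qed.

(** Time is reversed: the forward orbit of a point of the past visits the cells in the order
    opposite to that in which the past of [x_0] reads them. *)
Lemma itinerary_cell_prob n (w : {ffun 'I_n -> 'I_k}) :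
  mu (itinerary_cell (f : borel X -> borel X) (A : 'I_k -> set (borel X)) w) =
  (word_prob muh shiftO label0 [tuple w (rev_ord i) | i < n])%:E.
Proof.
have mS := @measurable_shift R X.
rewrite -(word_probE muh mS measurable_label0).
have mcell := measurable_itinerary_cell w.
(* The forward orbit starts at coordinate [n - 1], so that its last letter is read at [x_0]; for
   [n = 0] the cell is the whole space. *)
rewrite -(muh_coord lift n.-1 mcell); apply: (muh_eq_inverse_limit cf lift).
- rewrite -[X in measurable X]setTI; exact: measurable_coord.
- exact: (measurable_word_cell mS measurable_label0).
move=> xh xhL.
have uE (i : 'I_n) : nth (label0 xh) [tuple w (rev_ord i) | i < n] i = w (rev_ord i).
  by rewrite -tnth_nth tnth_mktuple.
have su := size_tuple [tuple w (rev_ord i) | i < n].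
move: uE su; move: (tval _) => u uE su.
rewrite /word_cell /itinerary_cell /= su itinerary_labelE; split.
  move=> h; apply: (@eq_from_nth _ (label0 xh)); rewrite ?size_mkseq ?su// => t tn.
  rewrite nth_mkseq// (uE (Ordinal tn)).
  apply/labXP; have := h (rev_ord (Ordinal tn)).
  rewrite /= -(@inverse_limit_iter R X f xh (n - t.+1) t xhL).
  by rewrite (_ : n.-1 = (n - t.+1 + t)%N) //; lia.
move=> h i; apply/labXP.
have ni : (n - i.+1 < n)%N by have := ltn_ord i; lia.
have := uE (rev_ord i); rewrite rev_ordK -h /= nth_mkseq// => <-; congr labX.
rewrite -(@inverse_limit_iter R X f xh i (n - i.+1) xhL); congr (iter _ _ (xh _)).
by have := ltn_ord i; lia.
Qed.

(** Reversal permutes the words of length [n], so [f] and the shift on pasts have the same block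
    entropies. *)
Lemma join_entropyE n :
  join_entropy (f : borel X -> borel X) mu (A : 'I_k -> set (borel X)) n =
  (word_entropy muh shiftO label0 n)%:E.
Proof.
rewrite /join_entropy /word_entropy /word_sum -sumEFin.
rewrite (reindex (fun u : n.-tuple 'I_k => [ffun i => tnth u (rev_ord i)])); last first.
  exists (fun w : {ffun 'I_n -> 'I_k} => [tuple w (rev_ord i) | i < n]).
    by move=> u _; apply: eq_from_tnth => i; rewrite tnth_mktuple ffunE rev_ordK.
  by move=> w _; apply/ffunP => i; rewrite ffunE tnth_mktuple rev_ordK.
apply: eq_bigr => u _; rewrite itinerary_cell_prob.
have -> : [tuple [ffun i => tnth u (rev_ord i)] (rev_ord i) | i < n] = u.
  by apply: eq_from_tnth => i; rewrite tnth_mktuple ffunE rev_ordK.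
set p := word_prob _ _ _ _.
have : 0 <= p by exact: word_prob_ge0.
rewrite le_eqVlt /xlogx_opp => /orP[/eqP <-|p0]; first by rewrite !mul0r mul0e oppe0 oppr0.
by rewrite lne_EFin// -EFinM.
Qed.

Lemma partition_entropyE :
  partition_entropy (f : borel X -> borel X) mu (A : 'I_k -> set (borel X)) =
  (entropy_rate muh shiftO label0)%:E.
Proof.
apply/cvg_lim => //.
under eq_fun do rewrite join_entropyE -EFinM.
apply: cvg_EFin; first by apply: nearW.
apply: cvg_entropy_rate.
- exact: measurable_shift.
- exact: (muh_shift_invariant lift).
- exact: (muh_shift_ergodic lift).
- exact: measurable_label0.
Qed.

End partition.
End inverse_limit_entropy.

(** * Past balls: the two halves of the Brin-Katok formula *)

Section past_balls.
Context (R : realType) (X : pmetricType R).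
Variable f : X -> X.
Local Notation Omega := {ptws nat -> X}.
Local Notation shiftO := (@left_shift R X : borel Omega -> borel Omega).

Definition past_ball (n : nat) (xh : Omega) (e : R) : set Omega :=
  [set yh | forall i, (i <= n)%N -> mdist (xh i) (yh i) < e].

Lemma measurable_past_ball n xh e : measurable (past_ball n xh e : set (borel Omega)).
Proof.
rewrite (_ : past_ball n xh e = \bigcap_(i in [set i | (i <= n)%N])
    ((fun yh : Omega => yh i) @^-1` [set y | mdist (xh i) y < e] : set (borel Omega))).
  apply: bigcap_measurableType => i _; rewrite -[X in measurable X]setTI.
  by apply: measurable_coord => //; apply: open_borel; exact: open_mball.
by apply/seteqP; split => yh h i; exact: h.
Qed.

Lemma past_ball_shift n xh e :
  past_ball n.+1 xh e `<=` shiftO @^-1` past_ball n (left_shift xh) e.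
Proof. by move=> yh h i ni; exact: (h i.+1). Qed.

Hypothesis cX : compact [set: X].
Hypothesis cf : continuous f.
Variables (mu : probability (borel X) R) (muh : probability (borel Omega) R).
Hypothesis lift : is_inverse_limit_lift f mu muh.

Let mS := @measurable_shift R X.
Let invS := muh_shift_invariant lift.
Let ergS := muh_shift_ergodic lift.

Lemma partition_compact_cores (k : nat) (A : 'I_k -> set X) (del : R) :
  measurable_partition (A : 'I_k -> set (borel X)) -> 0 < del ->
  exists K : 'I_k -> set X,
    [/\ forall i, closed (K i), forall i, K i `<=` A i &
        (mu (~` \bigcup_i K i) < del%:E)%E].
Proof.
move=> [mA tA UA] del0.
(* The divisor [k + 1] covers [k = 0] and makes the sum of the [k] errors strictly less than
   [del]. *)
have d0 : 0 < del / k.+1%:R by rewrite divr_gt0.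
have ex i : exists K : set X, [/\ closed K, K `<=` A i & (mu (A i `\` K) < (del / k.+1%:R)%:E)%E].
  have [K [U [clK opU KA AU h]]] := borel_regular mu (mA i) d0.
  exists K; split => //; apply: le_lt_trans h.
  apply: le_measure; rewrite ?inE.
  - by apply: measurableD => //; exact: closed_borel.
  - by apply: measurableD; [exact: open_borel|exact: closed_borel].
  - by move=> x [Ax Kx]; split => //; exact: AU.
have [K hK] := choice ex; exists K; split; [by move=> i; case: (hK i)..|].
pose F (n : nat) : set (borel X) := if insub n is Some i then A i `\` K i else set0.
have mF n : measurable (F n).
  rewrite /F; case: insubP => [i _ _|_] //.
  by apply: measurableD => //; apply: closed_borel; case: (hK i).
have sub : ~` (\bigcup_i K i) `<=` \big[setU/set0]_(n < k) F n.
  move=> x nKx; have : [set: X] x by [].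
  rewrite -[X in X x]UA => -[i _ Aix].
  rewrite -(bigcup_mkord k F); exists (val i) => /=; first exact: ltn_ord.
  by rewrite /F valK; split => // Kix; apply: nKx; exists i.
have mK : measurable (~` \bigcup_i K i : set (borel X)).
  apply: measurableC; apply: fin_bigcup_measurable => // i _.
  by apply: closed_borel; case: (hK i).
apply: (@le_lt_trans _ _ (mu (\big[setU/set0]_(n < k) F n))).
  by apply: le_measure; rewrite ?inE//; exact: bigsetU_measurable.
apply: (le_lt_trans (Boole_inequality _ (fun i _ => mF i))).
apply: (@le_lt_trans _ _ (\sum_(n < k) (del / k.+1%:R)%:E)%E).
  apply: lee_sum => i _; rewrite /F valK; apply: ltW; by case: (hK i).
rewrite sumEFin lte_fin sumr_const card_ord -[_ *+ _]mulr_natl mulrCA.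
by rewrite gtr_pMr// ltr_pdivrMr// mul1r ltr_nat.
Qed.

(** A small ball about [x] avoids all members that do not contain [x], and at most one contains it;
    compactness makes the radius uniform. *)
Lemma closed_family_separation (k : nat) (K : 'I_k -> set X) :
  (forall i, closed (K i)) -> (forall i j x, K i x -> K j x -> i = j) ->
  exists2 e : R, 0 < e & forall x y z i j,
    mdist x y < e -> mdist x z < e -> K i y -> K j z -> i = j.
Proof.
move=> clK disK.
pose Q (B : set X) := forall y z i j, B y -> B z -> K i y -> K j z -> i = j.
have [|x _|e e0 he] := @lebesgue_number R X setT Q cX.
- by move=> A B AB QB y z i j /AB By /AB Bz; exact: QB.
- pose C := \bigcup_(j in [set j | ~ K j x]) K j.
  have clC : closed C.
    by apply: closed_bigcup => [|j _]; [exact: finite_finset|exact: clK].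
  have : nbhs x (~` C).
    by apply: open_nbhs_nbhs; split; [exact: closed_openC|move=> [j]].
  move=> /nbhs_ballP[r /= r0 hr]; exists r => // y z i j xy xz Kiy Kjz.
  have core w l : mdist x w < r -> K l w -> K l x.
    move=> xw Klw; apply: contrapT => nKx; have /hr : ball x r w by apply/ballP.
    by apply; exists l.
  exact: (disK i j x (core _ _ xy Kiy) (core _ _ xz Kjz)).
- by exists e => // x y z i j; exact: (he x I).
Qed.

(** A finite partition of entropy [rho > a] is shrunk to closed cores. Within the separation radius
    [e] at most one core is visible, so a past ball of radius [e / 2] determines the label at each
    time spent in a core. *)
Theorem past_ball_entropy_ge (a : R) :
  (a%:E < metric_entropy (f : borel X -> borel X) mu)%E ->
  exists2 e, 0 < e & {ae muh, forall xh, \forall n \near \oo,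
    (muh (past_ball n xh e) <= (expR (- a * n%:R))%:E)%E}.
Proof.
move=> /ereal_sup_gt[_ [k [A [pA ->]]]].
have [labX labXP] := partition_label pA.
rewrite (partition_entropyE cf lift pA labXP) lte_fin.
set rho := entropy_rate _ _ _ => arho.
have mlab := measurable_label0 pA labXP.
have [an|a0] := ltP a 0.
  exists 1 => //; apply: aeW => xh; apply: nearW => n.
  apply: (@le_trans _ _ 1%E); first by rewrite probability_le1//; exact: measurable_past_ball.
  by rewrite lee_fin -[leLHS]expR0 ler_expR mulr_ge0// oppr_ge0 ltW.
(* First [eta], on which [L] depends, then [del] with [L * del <= (rho - a) / 8]: the total
   [(a + rho) / 2 + 3 * eta + L * del] stays below [rho]. *)
pose eta := (rho - a) / 16; have eta0 : 0 < eta by rewrite /eta; lra.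
pose L := error_cost 'I_k eta.
have L0 : 0 <= L := error_cost_ge0 (label0 labX) eta0 point.
pose del := (rho - a) / (8 * (L + 1)).
have del0 : 0 < del by rewrite divr_gt0 ?subr_gt0//; lra.
have [K [clK KA muK]] := partition_compact_cores pA del0.
have disK i j x : K i x -> K j x -> i = j.
  by move=> /KA /labXP <- /KA /labXP <-.
have [e e0 sepK] := closed_family_separation clK disK.
pose Y : set (borel Omega) := (fun xh : Omega => xh 0%N) @^-1` \bigcup_i K i.
have mKU : measurable (\bigcup_i K i : set (borel X)).
  by apply: fin_bigcup_measurable => // i _; exact: closed_borel.
have mY : measurable Y.
  by rewrite -[X in measurable X]setTI; exact: measurable_coord.
have PY : (muh (~` Y) < del%:E)%E.
  by rewrite -(muh_coord lift 0 (measurableC mKU)) in muK.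
(* The index of the core visible from [yh 0], with the label of [yh 0] as default when no core is in
   sight. *)
pose phi (yh : borel Omega) : 'I_k :=
  xget (label0 labX yh) [set i | exists2 z, mdist (yh 0%N) z < e & K i z].
exists (e / 2); first lra.
have a1a : a < (a + rho) / 2 by lra.
apply: (filterS _ (@local_entropy_ge _ _ R muh shiftO mS invS ergS _ _ mlab
  (fun n xh => past_ball n xh (e / 2)) phi Y ((a + rho) / 2) eta a mY _ _ _ _ eta0 _ a1a)).
- by move=> xh; apply: filterS => n /ltW.
- by move=> m xh; exact: measurable_past_ball.
- move=> m xh.
  have := measure_preimage_iter mS invS 1 (measurable_past_ball m (left_shift xh) (e / 2)) => /= <-.
  apply: le_measure; rewrite ?inE.
  + exact: measurable_past_ball.
  + apply: (measurable_preimage_iter mS 1); exact: measurable_past_ball.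
  + exact: past_ball_shift.
- move=> m xh yh [zh [xz yz]] t tm [i _].
  rewrite /phi /label0 !(iter_shift t (_ : Omega) 0%N) add0n => Kix.
  have xty : mdist (yh t) (xh t) < e.
    have := xz t (ltnW tm); have := yz t (ltnW tm).
    have := metric_triangle (yh t) (zh t) (xh t); rewrite (metric_sym (zh t)); lra.
  have /(xgetPex (labX (yh t))) [z ytz Kz] :
      exists j, [set i | exists2 z, mdist (yh t) z < e & K i z] j by exists i, (xh t).
  rewrite (sepK _ _ _ _ _ ytz xty Kz Kix); apply/labXP; exact: KA.
- lra.
- have : fine (muh (~` Y)) < del.
    by rewrite -lte_fin fineK// fin_num_measure//; exact: measurableC.
  rewrite -/L; set p := fine _ => pdel.
  have : p * (8 * (L + 1)) < rho - a by rewrite -ltr_pdivlMr//; lra.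
  have p0 : 0 <= p by exact: fine_ge0.
  rewrite -/rho /eta; nra.
Qed.

(** Cells of diameter less than [e] put a cylinder inside the past ball, and [entropy_rate_lt]
    bounds the cylinder from below. *)
Theorem past_ball_entropy_le (b e : R) :
  (metric_entropy (f : borel X -> borel X) mu < b%:E)%E -> 0 < e ->
  {ae muh, forall xh, \forall n \near \oo,
    ((expR (- b * n%:R))%:E <= muh (past_ball n xh e))%E}.
Proof.
move=> hb e0; have [k [A [pA diam]]] := compact_small_partition cX e0.
have [labX labXP] := partition_label pA.
have mlab := measurable_label0 pA labXP.
have : ((entropy_rate muh shiftO (label0 labX))%:E < b%:E)%E.
  apply: le_lt_trans hb; rewrite -(partition_entropyE cf lift pA labXP).
  by apply: ereal_sup_ubound; exists k, A.
rewrite lte_fin => rb; set rho := entropy_rate _ _ _ in rb.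
pose b' := (rho + b) / 2.
have rb' : rho < b' by rewrite /b'; lra.
have [_] := entropy_rate_lt mS invS ergS mlab rb'.
apply: filterS => xh [N _ hN].
near=> n.
(* A past ball up to [n] constrains [n + 1] coordinates; the gap between [b'] and [b] pays for the
   additional letter. *)
apply: (@le_trans _ _ (expR (- b' * n.+1%:R))%:E).
  rewrite lee_fin ler_expR.
  have : b' <= (b - b') * n%:R.
    have bb : 0 < b - b' by rewrite /b'; lra.
    rewrite -ler_pdivrMl//; near: n; exact: nbhs_infty_ger.
  rewrite -(natr1 n); lra.
have Nn : (N <= n.+1)%N by apply: leqW; near: n; exists N.
apply: (@le_trans _ _ (muh (word_cell shiftO (label0 labX) (itinerary shiftO (label0 labX) n.+1 xh)))).
  by rewrite (word_probE muh mS mlab) lee_fin; exact: hN.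
apply: le_measure; rewrite ?inE.
- exact: (measurable_word_cell mS mlab).
- exact: measurable_past_ball.
move=> yh; rewrite /word_cell size_itinerary !itinerary_labelE => h i ni.
apply: (diam (labX (xh i))); apply/labXP => //.
have := congr1 (fun s => nth (label0 labX xh) s i) h.
by rewrite (itinerary_labelE labX n.+1 yh) !(nth_mkseq _ _ (ni : (i < n.+1)%N)).
Unshelve. all: by end_near. Qed.

End past_balls.

(** * Jacobian and inverse balls *)

Section local_homeomorphism.
Context (R : realType) (X : pmetricType R).
Variable f : X -> X.
Hypothesis cX : compact [set: X].
Hypothesis cf : continuous f.
Hypothesis lif : locally_injective f.

Lemma injectivity_radius :
  exists2 e : R, 0 < e & forall x y, mdist x y < e -> f x = f y -> x = y.
Proof.
pose Q (B : set X) := forall y z, B y -> B z -> f y = f z -> y = z.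
have [|x _|e e0 he] := @lebesgue_number R X setT Q cX.
- by move=> A B AB QB y z /AB By /AB Bz; exact: QB.
- have [U /nbhs_ballP[r /= r0 rU] injU] := lif x; exists r => // y z xy xz.
  by apply: injU; apply/mem_set/rU/ballP.
- exists e => // x y xy; apply: (he x I) => //=; by rewrite mdistxx.
Qed.

Lemma closed_image (C : set X) : closed C -> closed (f @` C).
Proof.
move=> clC; apply: compact_closed; first exact: metric_hausdorff.
apply: continuous_compact; first exact: continuous_subspaceT.
exact: subclosed_compact clC cX _.
Qed.

(** Closed sets have closed images by compactness, and injectivity on [C] makes images commute with
    complements relative to [C]; induction over the Borel sets does the rest. *)
Lemma measurable_image_closed (C E : set (borel X)) :
  closed (C : set X) -> (forall x y, C x -> C y -> f x = f y -> x = y) ->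
  measurable E -> measurable (f @` (E `&` C) : set (borel X)).
Proof.
move=> clC injC mE.
have mC (D : set X) : closed D -> measurable (f @` D : set (borel X)).
  by move=> clD; apply: closed_borel; exact: closed_image.
have compl (B : set X) : f @` (~` B `&` C) = f @` C `\` f @` (B `&` C).
  apply/seteqP; split => y.
    move=> [x [nBx Cx] <-]; split; first by exists x.
    by move=> [z [Bz Cz] /injC zx]; apply: nBx; rewrite -zx.
  by move=> [[x Cx <-] h]; exists x => //; split => // Bx; apply: h; exists x.
apply: (g_sigma_algebra_ind (Q := fun E => measurable (f @` (E `&` C) : set (borel X)))
  _ _ _ _ mE) => [|U opU|B mB|B mB].
- by rewrite set0I image_set0.
- rewrite -[U]setCK compl; apply: measurableD; first exact: mC.
  by apply: mC; exact: closedI (open_closedC opU) clC.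
- by rewrite compl; apply: measurableD => //; exact: mC.
- by rewrite setI_bigcupl image_bigcup; exact: bigcupT_measurable.
Qed.

Lemma measurable_image (E : set (borel X)) :
  measurable E -> measurable (f @` E : set (borel X)).
Proof.
move=> mE; have [e e0 he] := injectivity_radius.
have e3 : 0 < e / 3 by lra.
have [s hs] := compact_finite_net cX e3.
pose C (y : X) := [set x : X | mdist y x <= e / 3].
have -> : f @` E = \bigcup_(y in [set` s]) f @` (E `&` C y).
  apply/seteqP; split => z.
    move=> [x Ex <-]; have [y ys yx] := hs x; exists y => //; exists x => //.
    by split => //; exact: ltW.
  by move=> [y _ [x [Ex _] <-]]; exists x.
apply: fin_bigcup_measurable => [|y _]; first exact: finite_seq.
apply: measurable_image_closed => //; first exact: closed_mball.
move=> x z; rewrite /C/= => yx yz; apply: he.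
have := metric_triangle x y z; rewrite (metric_sym x y); lra.
Qed.

Variables (mu : probability (borel X) R) (J : X -> R).
Hypothesis jac : is_jacobian (f : borel X -> borel X) mu (J : borel X -> R).

Let mJ : measurable_fun setT (J : borel X -> R). Proof. by case: jac. Qed.
Let J1 x : 1 <= J x. Proof. by case: jac. Qed.
Let J0 x : 0 <= J x. Proof. by rewrite (le_trans ler01)// J1. Qed.

(** The cells of [is_jacobian] cut [E] into pieces whose images remain disjoint, because [f] is
    injective on all of [E]. *)
Lemma measure_image (E : set (borel X)) : measurable E ->
  (forall x y, E x -> E y -> f x = f y -> x = y) ->
  mu (f @` E) = (\int[mu]_(x in E) (J x)%:E)%E.
Proof.
move=> mE injE; have [_ _ [A [[mA tA UA] injA muA]]] := jac.
have EU : E = \bigcup_i (E `&` A i) by rewrite -setI_bigcupr UA setIT.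
have mEA i : measurable (E `&` A i) by exact: measurableI.
have tEA : trivIset setT (fun i => E `&` A i) by exact: trivIset_setIl.
rewrite {1}EU image_bigcup measure_bigcup; last 2 first.
- by move=> i _; exact: measurable_image.
- move=> i j _ _ [y [[x [Ex Aix] <-] [z [Ez Ajz] zx]]].
  by apply: (tA i j I I); exists x; split => //; rewrite -(injE _ _ Ez Ex zx).
rewrite [in RHS]EU ge0_integral_bigcup//; last 2 first.
- by apply/measurable_EFinP; apply: measurable_funTS.
- by move=> x _; rewrite lee_fin.
rewrite (eq_eseriesl _ _ (fun i => in_setT i)).
by apply: eq_eseriesr => i _; apply: muA => //; exact: subIsetr.
Qed.

Lemma measure_image_bounds (E : set (borel X)) (l u : R) : measurable E ->
  (forall x y, E x -> E y -> f x = f y -> x = y) -> 0 <= l ->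
  (forall x, E x -> l <= J x <= u) ->
  (l%:E * mu E <= mu (f @` E) <= u%:E * mu E)%E.
Proof.
move=> mE injE l0 hJ; rewrite measure_image// -!integral_cst//.
have mJE : measurable_fun E (fun x : borel X => (J x)%:E).
  by apply/measurable_EFinP; apply: measurable_funTS.
apply/andP; split; apply: ge0_le_integral => //.
- by move=> x /hJ/andP[h _]; rewrite lee_fin.
- by move=> x _; rewrite lee_fin.
- by move=> x /hJ/andP[_ h]; rewrite lee_fin.
Qed.

End local_homeomorphism.

(** * Transport of past balls to time 0 *)

Section inverse_balls.
Context (R : realType) (X : pmetricType R).
Variable f : X -> X.
Local Notation Omega := {ptws nat -> X}.
Local Notation shiftO := (@left_shift R X : borel Omega -> borel Omega).

(** Level [j = 0] is the inverse Bowen ball, level [j = n] has the measure of a past ball, and [f]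
    maps each level onto the preceding one. *)
Definition shadow_set (n : nat) (xh : Omega) (e : R) (j : nat) : set X :=
  [set y | exists2 yh : Omega, inverse_limit f yh &
     yh j = y /\ forall i, (i <= n)%N -> mdist (xh i) (yh i) < e].

Lemma inverse_bowen_ballE n xh e : inverse_bowen_ball f n xh e = shadow_set n xh e 0.
Proof. by []. Qed.

Lemma image_shadow_set n xh e j : f @` shadow_set n xh e j.+1 = shadow_set n xh e j.
Proof.
apply/seteqP; split => y.
  by move=> [_ [yh yhL [<- h]] <-]; exists yh => //; split => //; exact: yhL.
by move=> [yh yhL [<- h]]; exists (yh j.+1); [exists yh|exact: yhL].
Qed.

Lemma shadow_set_ball n xh e j : (j <= n)%N ->
  shadow_set n xh e j `<=` [set y | mdist (xh j) y < e].
Proof. by move=> jn y [yh yhL [<- h]]; exact: h. Qed.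

Hypothesis cX : compact [set: X].
Hypothesis cf : continuous f.

Lemma closed_inverse_limit_proj : closed ((fun yh : Omega => yh 0%N) @` inverse_limit f).
Proof.
apply: compact_closed; first exact: metric_hausdorff.
have c0 : continuous (fun yh : Omega => yh 0%N) := @coordinate_continuous R X 0.
exact: (continuous_compact (continuous_subspaceT c0) (compact_inverse_limit cf cX)).
Qed.

(** The coordinate [x_{-n}] determines all later ones, so shadowing becomes a condition on forward
    iterates, next to the existence of some prehistory. In this form the set is visibly Borel. *)
Lemma shadow_set_endE n xh e : shadow_set n xh e n =
  (fun yh : Omega => yh 0%N) @` inverse_limit f `&`
  \bigcap_(i in [set i | (i <= n)%N]) (iter (n - i) f @^-1` [set y | mdist (xh i) y < e]).
Proof.
apply/seteqP; split => z.
  move=> [yh yhL [<- h]]; split.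
    exists (iter n (@left_shift R X) yh); last by rewrite iter_shift.
    by move=> i; rewrite !iter_shift; exact: yhL.
  move=> i /= ni; have := inverse_limit_iter (n - i) i yhL.
  by rewrite subnK// => ->; exact: h.
move=> [[zh zhL <-] hz].
(* The forward orbit of [zh 0] fills the coordinates up to [n], and the past [zh] is glued behind
   it. *)
pose yh : Omega := fun i => if (i <= n)%N then iter (n - i) f (zh 0%N) else zh (i - n)%N.
exists yh.
  move=> i; rewrite /yh; have [ni|ni] := leqP i.+1 n.
    by rewrite (ltnW ni) -iterS subnSK.
  move: ni; rewrite ltnS leq_eqVlt => /orP[/eqP <-|ni].
    by rewrite leqnn subnn subSnn; exact: zhL.
  by rewrite leqNgt ni/= subSn ?(ltnW ni)//; exact: zhL.
split; first by rewrite /yh leqnn subnn.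
by move=> i ni; rewrite /yh ni; exact: hz.
Qed.

Lemma measurable_shadow_set_end n xh e :
  measurable (shadow_set n xh e n : set (borel X)).
Proof.
rewrite shadow_set_endE; apply: measurableI.
  by apply: closed_borel; exact: closed_inverse_limit_proj.
apply: bigcap_measurableType => i _.
apply: (measurable_preimage_iter (continuous_borel cf)).
by apply: open_borel; exact: open_mball.
Qed.

Variables (mu : probability (borel X) R) (muh : probability (borel Omega) R).
Hypothesis lift : is_inverse_limit_lift f mu muh.

Lemma measure_shadow_set_end n xh e :
  mu (shadow_set n xh e n) = muh (past_ball n xh e).
Proof.
have mE := measurable_shadow_set_end n xh e.
rewrite -(muh_coord lift n mE); apply: (muh_eq_inverse_limit cf lift).
- rewrite -[X in measurable X]setTI; exact: measurable_coord.
- exact: measurable_past_ball.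
move=> yh yhL; split; last by move=> h; exists yh.
move=> [zh zhL [zy h]] i ni.
rewrite -(@inverse_limit_iter R X f yh (n - i) i yhL) subnK// -zy.
have := @inverse_limit_iter R X f zh (n - i) i zhL; rewrite subnK// => ->.
exact: h.
Qed.

Hypothesis lif : locally_injective f.

Lemma measurable_shadow_set n xh e j : (j <= n)%N ->
  measurable (shadow_set n xh e j : set (borel X)).
Proof.
move=> jn; rewrite -(subKn jn); elim: (n - j)%N (leq_subr j n) => [|k IH] kn.
  rewrite subn0; exact: measurable_shadow_set_end.
rewrite -image_shadow_set subnSK//; apply: (measurable_image cX cf lif).
by apply: IH; exact: ltnW.
Qed.

Lemma measurable_inverse_bowen_ball n xh e :
  measurable (inverse_bowen_ball f n xh e : set (borel X)).
Proof. by rewrite inverse_bowen_ballE; exact: measurable_shadow_set. Qed.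

Variable J : X -> R.
Hypothesis jac : is_jacobian (f : borel X -> borel X) mu (J : borel X -> R).

(** Level [n - k] lies in the ball about [xh (n - k)], where [f] is injective and [ln J] varies by
    at most [c]; this gives one factor per step. The centres met are [x_{-n}], ..., [x_{-1}], whence
    coordinate 1 in the ergodic sums. *)
Lemma inverse_bowen_ball_bounds (e : R) (c : X -> R) :
  (forall x y z, mdist x y < e -> mdist x z < e -> f y = f z -> y = z) ->
  (forall x y, mdist x y < e -> `|ln (J y) - ln (J x)| <= c x) ->
  forall n xh,
  ((expR (birkhoff_sum shiftO (fun yh => ln (J (yh 1%N)) - c (yh 1%N)) n xh))%:E *
     muh (past_ball n xh e) <= mu (inverse_bowen_ball f n xh e) <=
   (expR (birkhoff_sum shiftO (fun yh => ln (J (yh 1%N)) + c (yh 1%N)) n xh))%:E *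
     muh (past_ball n xh e))%E.
Proof.
move=> injf osc n xh.
have J1 x : 1 <= J x by have [_ + _] := jac; apply.
have J0 x : 0 < J x by rewrite (lt_le_trans ltr01).
pose l j := expR (ln (J (xh j)) - c (xh j)).
pose u j := expR (ln (J (xh j)) + c (xh j)).
have step k : (k <= n)%N ->
  ((\prod_(i < k) l (n - i)%N)%:E * muh (past_ball n xh e) <=
     mu (shadow_set n xh e (n - k)) <=
   (\prod_(i < k) u (n - i)%N)%:E * muh (past_ball n xh e))%E.
  elim: k => [|k IH] kn.
    by rewrite !big_ord0 subn0 measure_shadow_set_end !mul1e lexx.
  have /andP[IHl IHu] := IH (ltnW kn).
  have nk : (n - k <= n)%N := leq_subr k n.
  have mT := measurable_shadow_set xh e nk.
  have lu0 : 0 <= l (n - k)%N by exact: expR_ge0.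
  have injT x y : shadow_set n xh e (n - k) x -> shadow_set n xh e (n - k) y ->
      f x = f y -> x = y.
    by move=> /(shadow_set_ball nk) /= h1 /(shadow_set_ball nk) /= h2; exact: injf h1 h2.
  have JT x : shadow_set n xh e (n - k) x -> l (n - k)%N <= J x <= u (n - k)%N.
    move=> /(shadow_set_ball nk) /= /osc; rewrite ler_distl => /andP[h1 h2].
    by rewrite -[J x]lnK ?posrE// !ler_expR h1 h2.
  have /andP[h1 h2] := measure_image_bounds cX cf lif jac mT injT lu0 JT.
  rewrite -image_shadow_set subnSK// !big_ord_recr/=.
  apply/andP; split.
    apply: le_trans h1; rewrite mulrC EFinM -muleA lee_wpmul2l// lee_fin//.
  apply: (le_trans h2); rewrite mulrC EFinM -muleA lee_wpmul2l// lee_fin expR_ge0//.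
have prodE (a : nat -> R) : \prod_(i < n) expR (a (n - i)%N) = expR (\sum_(i < n) a i.+1).
  rewrite -expR_sum; congr expR; rewrite [RHS](reindex_inj rev_ord_inj)/=.
  by apply: eq_bigr => i _; rewrite subnSK.
have bsE (F : X -> R) : birkhoff_sum shiftO (fun yh => F (yh 1%N)) n xh = \sum_(i < n) F (xh i.+1).
  by apply: eq_bigr => i _; rewrite (iter_shift i (xh : Omega) 1).
have := step n (leqnn n); rewrite subnn -inverse_bowen_ballE.
rewrite (prodE (fun j => ln (J (xh j)) - c (xh j))) (prodE (fun j => ln (J (xh j)) + c (xh j))).
by rewrite (bsE (fun x => ln (J x) - c x)) (bsE (fun x => ln (J x) + c x)).
Qed.

End inverse_balls.

(** * Folding entropy *)

Section integration.
Context d (T : measurableType d) (R : realType) (mu : {measure set T -> \bar R}).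
Local Open Scope ereal_scope.
Import HBNNSimple.

(** No measurability is assumed, since the result is applied to local inverse entropies and to
    entropies of conditional measures. A simple function below [u], cut off on the null set [N], is
    below [v] and keeps its integral. *)
Let le_nnintegral_ae (u v : T -> \bar R) (N : set T) : measurable N -> mu N = 0 ->
  (forall x, 0 <= u x) -> (forall x, 0 <= v x) -> (forall x, ~ N x -> u x = v x) ->
  \int[mu]_x u x <= \int[mu]_x v x.
Proof.
move=> mN N0 u0 v0 uv; rewrite ge0_integralTE// [leRHS]ge0_integralTE//.
apply: ge_ereal_sup => _ [h hu <-].
pose h' := proj_nnsfun h (measurableC mN).
apply: (@le_trans _ _ (sintegral mu h')); last first.
  apply: ereal_sup_ubound; exists h' => // x.
  change ((h x * \1_(~` N) x)%:E <= v x).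
  have [Nx|nNx] := pselect (N x).
    by rewrite indicE memNset ?mulr0// => /(_ Nx).
  by rewrite indicE mem_set// mulr1 -uv.
rewrite -!integralT_nnsfun le_eqVlt; apply/orP; left; apply/eqP.
apply: ge0_ae_eq_integral => //.
- exact/measurable_EFinP.
- exact/measurable_EFinP.
- by move=> x _; rewrite lee_fin.
- by move=> x _; rewrite lee_fin.
exists N; split => // x /=; apply: contra_notP => nNx _.
change ((h x)%:E = (h x * \1_(~` N) x)%:E).
by rewrite indicE mem_set// mulr1.
Qed.

Lemma integral_eq_ae (f g : T -> \bar R) :
  {ae mu, forall x, f x = g x} -> \int[mu]_x f x = \int[mu]_x g x.
Proof.
move=> [N [mN N0 fgN]].
have fg x : ~ N x -> f x = g x by move=> nNx; apply: contrapT => h; apply: nNx; exact: fgN.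
rewrite integralE [in RHS]integralE; congr (_ - _); apply/eqP; rewrite eq_le;
  apply/andP; split; apply: (le_nnintegral_ae mN N0) => // x /fg fgx;
  by rewrite ?funeposE ?funenegE fgx.
Qed.

End integration.

Section weighted_comp.
Import HBNNSimple.

(** Extension from indicators through simple functions and monotone convergence. The weight [v] will
    be an indicator on one side of a change of variables and a Jacobian on the other. *)
Lemma ge0_integral_weighted_comp d1 d2 (T1 : measurableType d1)
    (T2 : measurableType d2) (R : realType) (m1 : {measure set T1 -> \bar R})
    (m2 : {measure set T2 -> \bar R}) (u : T1 -> T2) (v : T1 -> R) :
  measurable_fun setT u -> measurable_fun setT v -> (forall x, 0 <= v x) ->
  (forall E, measurable E -> (\int[m1]_x (v x * \1_E (u x))%:E = m2 E)%E) ->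
  forall phi : T2 -> \bar R, measurable_fun setT phi -> (forall y, (0 <= phi y)%E) ->
  (\int[m1]_x ((v x)%:E * phi (u x)) = \int[m2]_y phi y)%E.
Proof.
move=> mu_ mv v0 H phi mphi phi0.
pose h := nnsfun_approx measurableT mphi.
have hphi y : (h n y)%:E @[n --> \oo] --> phi y by exact: cvg_nnsfun_approx.
have mhu n : measurable_fun setT (fun x => h n (u x)) by exact: measurableT_comp.
have -> : (\int[m2]_y phi y = limn (fun n => \int[m2]_y (h n y)%:E))%E.
  rewrite -monotone_convergence//.
  - by apply: eq_integral => y _; apply/esym/cvg_lim => //; exact: hphi.
  - by move=> n; exact/measurable_EFinP.
  - by move=> n y _; rewrite lee_fin.
  - by move=> y _ a b ab; rewrite lee_fin; exact/lefP/nd_nnsfun_approx.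
have -> : (\int[m1]_x ((v x)%:E * phi (u x)) =
    limn (fun n => \int[m1]_x (v x * h n (u x))%:E))%E.
  rewrite -monotone_convergence//.
  - apply: eq_integral => x _; apply/esym/cvg_lim => //.
    under eq_fun do rewrite EFinM.
    by apply: cvgeZl => //; exact: hphi.
  - by move=> n; apply/measurable_EFinP; exact: measurable_funM.
  - by move=> n x _; rewrite lee_fin mulr_ge0.
  - by move=> x _ a b ab; rewrite lee_fin ler_wpM2l//; exact/lefP/nd_nnsfun_approx.
congr (limn _); apply/funext => n; move: (h n) (mhu n) => {phi mphi phi0 h hphi mhu} {n} h mhu.
have mE r : measurable (h @^-1` [set r]) by [].
have mind r : measurable_fun setT (fun x => v x * \1_(h @^-1` [set r]) (u x)).
  apply: measurable_funM => //; apply: measurableT_comp => //; exact: measurable_indic.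
have r0 r : r \in range h -> 0 <= r.
  by rewrite inE => -[y _ <-]; exact: fun_ge0.
rewrite integralT_nnsfun sintegralE.
transitivity (\int[m1]_x (\sum_(r \in range h) (r * (v x * \1_(h @^-1` [set r]) (u x)))%:E))%E.
  apply: eq_integral => x _; rewrite fsumEFin//; congr (_%:E).
  rewrite (fimfunE h (u x)) mulr_fsumr//.
  by apply: eq_fsbigr => r _; rewrite mulrCA.
rewrite ge0_integral_fsum//.
- apply: eq_fsbigr => r /r0 rr; under eq_integral do rewrite EFinM.
  rewrite ge0_integralZl ?H//.
  + exact/measurable_EFinP.
  + by move=> x _; rewrite lee_fin mulr_ge0.
- by move=> r; apply/measurable_EFinP; exact: measurable_funM.
- move=> r x _; rewrite lee_fin.
  have [hr|hr] := eqVneq (h (u x)) r; last first.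
    by rewrite indicE memNset ?mulr0//= => /eqP; rewrite (negPf hr).
  by rewrite !mulr_ge0// -hr; exact: fun_ge0.
Qed.

End weighted_comp.

Lemma ae_eq_density d (T : measurableType d) (R : realType)
    (P : probability T R) (g1 g2 : T -> \bar R) :
  measurable_fun setT g1 -> measurable_fun setT g2 ->
  (forall x, 0 <= g1 x)%E -> (\int[P]_x g1 x < +oo)%E ->
  (forall A, measurable A ->
    \int[P]_x (g1 x * (\1_A x)%:E) = \int[P]_x (g2 x * (\1_A x)%:E))%E ->
  {ae P, forall x, g1 x = g2 x}.
Proof.
move=> mg1 mg2 g10 ig1 h.
have : ae_eq P setT g1 g2.
  apply: integral_ae_eq => //.
    by apply/integrableP; split=> //; under eq_integral do rewrite gee0_abs//.
  move=> E _ mE; rewrite integral_mkcond [RHS]integral_mkcond.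
  have e (g : T -> \bar R) : (\int[P]_x (g \_ E) x = \int[P]_x (g x * (\1_E x)%:E))%E.
    apply: eq_integral => x _; rewrite patchE indicE.
    by case: ifP => _; rewrite ?mule1 ?mule0.
  by rewrite !e h.
by apply: filterS => x; exact.
Qed.

Lemma ae_imply d (T : measurableType d) (R : realType)
    (P : {measure set T -> \bar R}) (A B : T -> Prop) :
  (forall x, A x -> B x) -> {ae P, forall x, A x} -> {ae P, forall x, B x}.
Proof. by move=> AB; apply: filterS. Qed.

Lemma ae_imply2 d (T : measurableType d) (R : realType)
    (P : {measure set T -> \bar R}) (A B C : T -> Prop) :
  (forall x, A x -> B x -> C x) -> {ae P, forall x, A x} ->
  {ae P, forall x, B x} -> {ae P, forall x, C x}.
Proof. by move=> ABC; apply: filterS2. Qed.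

Section full_set.
Context d (T : measurableType d) (R : realType).
Variables (m : {measure set T -> \bar R}) (S : set T).
Hypotheses (mS : measurable S) (mT : m setT = 1%E) (mS1 : m S = 1%E).

Lemma full_setC : m (~` S) = 0%E.
Proof.
have : (m setT = m (setT `\` S) + m (setT `&` S))%E by exact: measureDI.
rewrite mT setTI mS1 setTD => /eqP.
case: (m _) => [r| |] //=.
by rewrite -EFinD eqe -subr_eq subrr eq_sym => /eqP ->.
Qed.

Lemma full_setC_sub E : measurable E -> E `<=` ~` S -> m E = 0%E.
Proof.
move=> mE ES; apply/eqP; rewrite eq_le measure_ge0 andbT -full_setC.
by apply: le_measure => //; rewrite inE//; exact: measurableC.
Qed.

Lemma full_setI A : measurable A -> m (A `&` S) = m A.
Proof.
move=> mA; have -> : (m A = m (A `\` S) + m (A `&` S))%E by exact: measureDI.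
by rewrite [m (A `\` S)]full_setC_sub ?add0e//; exact: measurableD.
Qed.

End full_set.

Section folding.
Context (R : realType) (X : pmetricType R).
Variable f : X -> X.
Hypothesis cX : compact [set: X].
Hypothesis cf : continuous f.
Hypothesis lif : locally_injective f.
Variables (mu : probability (borel X) R) (J : X -> R).
Hypothesis invmu : invariant_measure (f : borel X -> borel X) mu.
Hypothesis jac : is_jacobian (f : borel X -> borel X) mu (J : borel X -> R).

Let mJ : measurable_fun setT (J : borel X -> R). Proof. by case: jac. Qed.
Let J1 x : 1 <= J x. Proof. by case: jac. Qed.
Let J0 x : 0 < J x. Proof. by rewrite (lt_le_trans ltr01)// J1. Qed.

Lemma injective_partition : exists N (K : nat -> set X),
  [/\ measurable_partition (K : nat -> set (borel X)),
      forall n, (N <= n)%N -> K n = set0 &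
      forall n x y, K n x -> K n y -> f x = f y -> x = y].
Proof.
have [e e0 he] := injectivity_radius cX lif.
have [N [A [[mA tA UA] diam]]] := compact_small_partition cX e0.
pose K n := if insub n is Some i then A i else set0.
have KE (i : 'I_N) : K i = A i by rewrite /K valK.
exists N, K; split.
- split.
  + by move=> n; rewrite /K; case: insubP => [i _ _|_] //; exact: measurable0.
  + move=> i j _ _; rewrite /K; case: insubP => [i' _ <-|_]; last by move=> [x []].
    case: insubP => [j' _ <-|_]; last by move=> [x []].
    by move=> h; congr val; apply: tA.
  + apply/seteqP; split => // x _; have : [set: X] x by [].
    by rewrite -[X in X x]UA => -[i _ Aix]; exists (val i) => //; rewrite KE.
- by move=> n Nn; rewrite /K insubF// ltnNge Nn.
- move=> n x y; rewrite /K; case: insubP => [i _ _|_] // Ax Ay; apply: he; exact: diam Ax Ay.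
Qed.

Section branches.
Variables (N : nat) (K : nat -> set X).
Hypothesis pK : measurable_partition (K : nat -> set (borel X)).
Hypothesis KN : forall n, (N <= n)%N -> K n = set0.
Hypothesis injK : forall n x y, K n x -> K n y -> f x = f y -> x = y.

Let mK n : measurable (K n : set (borel X)). Proof. by case: pK. Qed.

Let mfK n : measurable (f @` K n : set (borel X)).
Proof. exact: (measurable_image cX cf lif). Qed.

(** The inverse branch of [f] with values in [K n]. Off the image of [K n] it takes the value
    [point], and there [branch_weight] vanishes. *)
Definition branch n (x : X) : X := xget point [set y | K n y /\ f y = x].

Lemma branchK n y : K n y -> branch n (f y) = y.
Proof.
move=> Ky; rewrite /branch; case: xgetP => [z _ [Kz fz]|/(_ y)]; last by case.
exact: injK Kz Ky fz.
Qed.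

Lemma branchP n x : (f @` K n) x -> K n (branch n x) /\ f (branch n x) = x.
Proof. by move=> [y Ky <-]; rewrite branchK. Qed.

Lemma measurable_branch n : measurable_fun setT (branch n : borel X -> borel X).
Proof.
move=> _ A mA; rewrite setTI.
have -> : branch n @^-1` A =
    f @` (A `&` K n) `|` (~` (f @` K n) `&` [set x : X | A point]).
  apply/seteqP; split => x /=.
    move=> Ax; have [fx|nfx] := pselect ((f @` K n) x).
      by left; have [Kb fb] := branchP fx; exists (branch n x).
    right; split => //; move: Ax; rewrite /branch; case: xgetP => // y _ [Ky fy].
    by case: nfx; exists y.
  move=> [[y [Ay Ky] <-]|[nfx Ap]]; first by rewrite branchK.
  rewrite /branch; case: xgetP => // y _ [Ky fy].
  by case: nfx; exists y.
apply: measurableU.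
  by apply: (measurable_image cX cf lif); exact: measurableI.
apply: measurableI; first exact: measurableC.
by have [Ap|nAp] := pselect (A point); [rewrite (_ : [set _ | _] = setT)|rewrite (_ : [set _ | _] = set0)] => //;
  apply/seteqP; split.
Qed.

(** The conditional mass of the preimage of [x] in [K n]: a point [y] of a fiber gets the mass
    [1 / J y]. *)
Definition branch_weight n (x : X) : R := \1_(f @` K n) x / J (branch n x).

Lemma branch_weight_ge0 n x : 0 <= branch_weight n x.
Proof. by rewrite /branch_weight divr_ge0// ltW. Qed.

Lemma measurable_branch_jacobianV n :
  measurable_fun setT ((fun x => (J (branch n x))^-1) : borel X -> R).
Proof.
have -> : (fun x => (J (branch n x))^-1) =
    (fun x => expR (- ln (J (branch n x)))).
  by apply/funext => x; rewrite expRN lnK ?posrE.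
apply: (measurableT_comp (@measurable_expR R)).
apply: measurable_funN; apply: (measurableT_comp (@measurable_ln R)).
exact: (measurableT_comp mJ (measurable_branch n)).
Qed.

Lemma measurable_branch_weight n :
  measurable_fun setT (branch_weight n : borel X -> R).
Proof.
apply: measurable_funM; first exact: measurable_indic.
exact: measurable_branch_jacobianV.
Qed.

(* Change of variables along the branch: [f] maps the measure [J mu] on [K n] to
   [mu] on [f (K n)]. *)
Lemma integral_branch n (phi : X -> \bar R) :
  measurable_fun setT (phi : borel X -> \bar R) -> (forall x, (0 <= phi x)%E) ->
  (\int[mu]_x ((branch_weight n x)%:E * phi (branch n x)) =
   \int[mu]_y ((\1_(K n) y)%:E * phi y))%E.
Proof.
move=> mphi phi0.
(* Both sides are compared with an integral over the image of [K n], reached by the identity in [h1]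
   and by [f] in [h2]. *)
pose m2 := mrestr mu (mfK n).
pose Phi (x : X) : \bar R := ((J (branch n x))^-1%:E * phi (branch n x))%E.
have Phi0 x : (0 <= Phi x)%E by rewrite mule_ge0// lee_fin invr_ge0 ltW.
have mPhi : measurable_fun setT (Phi : borel X -> \bar R).
  apply: emeasurable_funM.
    by apply/measurable_EFinP; exact: measurable_branch_jacobianV.
  exact: (measurableT_comp mphi (measurable_branch n)).
have mind (A : set (borel X)) : measurable A -> measurable_fun setT (\1_A : borel X -> R).
  by move=> mA; exact: measurable_indic.
have h1 : (\int[mu]_x ((\1_(f @` K n) x)%:E * Phi x) = \int[m2]_x Phi x)%E.
  apply: (@ge0_integral_weighted_comp _ _ (borel X) (borel X) R mu m2 id (\1_(f @` K n))) => //.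
  move=> E mE; rewrite -[RHS]/(mu (E `&` f @` K n)) setIC.
  have := integral_indicE mu (measurableI _ _ (mfK n) mE) (@ler01 R); rewrite mul1e => <-.
  by apply: eq_integral => x _; rewrite indicI mul1r.
have h2 : (\int[mu]_y ((J y * \1_(K n) y)%:E * Phi (f y)) = \int[m2]_x Phi x)%E.
  apply: (@ge0_integral_weighted_comp _ _ (borel X) (borel X) R mu m2 f (fun y => J y * \1_(K n) y)) => //.
  - exact: continuous_borel.
  - by apply: measurable_funM => //; exact: mind.
  - by move=> y; rewrite mulr_ge0// ltW.
  - move=> E mE; rewrite /m2 /= /mrestr.
    have -> : E `&` f @` K n = f @` (K n `&` f @^-1` E).
      apply/seteqP; split => x.
        by move=> [Ex [y Ky fy]]; exists y => //; split => //=; rewrite fy.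
      by move=> [y [Ky Ey] <-]; split => //; exists y.
    have mKE : measurable (K n `&` f @^-1` E : set (borel X)).
      apply: measurableI => //.
      by rewrite -[X in measurable X]setTI; exact: (continuous_borel cf).
    rewrite (measure_image cX cf lif jac mKE); last first.
      by move=> x y [Kx _] [Ky _]; exact: injK Kx Ky.
    rewrite [RHS]integral_mkcond; apply: eq_integral => y _.
    rewrite patchE indicE indicE -mulrA -natrM mulnb.
    by rewrite (_ : _ && _ = (y \in K n `&` f @^-1` E)) ?in_setI//; case: ifP => _; rewrite ?mulr1 ?mulr0.
have -> : (\int[mu]_x ((branch_weight n x)%:E * phi (branch n x)) =
    \int[mu]_x ((\1_(f @` K n) x)%:E * Phi x))%E.
  by apply: eq_integral => x _; rewrite /Phi muleA -EFinM.
rewrite h1 -h2; apply: eq_integral => y _.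
have [Ky|nKy] := pselect (K n y); last by rewrite indicE memNset// mulr0 !mul0e.
rewrite indicE mem_set// mulr1 mul1e /Phi branchK// muleA -EFinM divff ?mul1e//.
by rewrite gt_eqF.
Qed.
Lemma sum_indic_partition y : \sum_(i < N) \1_(K i) y = 1 :> R.
Proof.
case: pK => _ tK UK.
have : [set: X] y by [].
rewrite -UK => -[i _ Ky].
have iN : (i < N)%N.
  by rewrite ltnNge; apply/negP => /KN Ki; rewrite Ki in Ky.
rewrite (bigD1 (Ordinal iN))//= indicE mem_set// big1 ?addr0// => j ji.
rewrite indicE memNset// => Kjy; move/eqP: ji; apply; apply/val_inj => /=.
by apply: tK => //; exists y.
Qed.

(** The transfer operator with weight [1 / J] preserves integrals against [mu]. *)
Lemma integral_sum_branch (phi : X -> \bar R) :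
  measurable_fun setT (phi : borel X -> \bar R) -> (forall x, (0 <= phi x)%E) ->
  (\int[mu]_x (\sum_(i < N) (branch_weight i x)%:E * phi (branch i x)) =
   \int[mu]_y phi y)%E.
Proof.
move=> mphi phi0; rewrite ge0_integral_sum//; last 2 first.
- move=> i; apply: emeasurable_funM.
    by apply/measurable_EFinP; exact: measurable_branch_weight.
  exact: (measurableT_comp mphi (measurable_branch i)).
- by move=> i x _; rewrite mule_ge0// lee_fin branch_weight_ge0.
under eq_bigr do rewrite integral_branch//.
rewrite -ge0_integral_sum//; last 2 first.
- move=> i; apply: emeasurable_funM => //.
  by apply/measurable_EFinP; exact: measurable_indic.
- by move=> i x _; rewrite mule_ge0// lee_fin.
apply: eq_integral => y _; rewrite -ge0_sume_distrl//.
by rewrite sumEFin sum_indic_partition mul1e.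
Qed.

Lemma branch_weight_fiber n x (g : X -> R) :
  branch_weight n x * g (f (branch n x)) = branch_weight n x * g x.
Proof.
have [fx|nfx] := pselect ((f @` K n) x); first by have [_ ->] := branchP fx.
by rewrite /branch_weight indicE memNset// !mul0r.
Qed.

Definition total_weight x : R := \sum_(i < N) branch_weight i x.

Lemma measurable_total_weight :
  measurable_fun setT (total_weight : borel X -> R).
Proof. by apply: measurable_sum => i; exact: measurable_branch_weight. Qed.

Let mfpre (A : set (borel X)) : measurable A -> measurable (f @^-1` A : set (borel X)).
Proof. by move=> mA; rewrite -[X in measurable X]setTI; exact: (continuous_borel cf). Qed.

Let mindE (A : set (borel X)) : measurable A ->
  measurable_fun setT ((fun x => (\1_A x)%:E) : borel X -> \bar R).
Proof. by move=> mA; apply/measurable_EFinP; exact: measurable_indic. Qed.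

Let int_indic (A : set (borel X)) : measurable A ->
  (\int[mu]_x (\1_A x)%:E = mu A)%E.
Proof. by move=> mA; rewrite integral_indic// setIT. Qed.

Let total_weight_indic (A : set (borel X)) : measurable A ->
  (\int[mu]_x ((total_weight x)%:E * (\1_A x)%:E) = mu A)%E.
Proof.
move=> mA; rewrite -invmu// -(int_indic (mfpre mA)).
rewrite -[RHS]integral_sum_branch//; last by apply: mindE; exact: mfpre.
apply: eq_integral => x _.
rewrite -EFinM /total_weight mulr_suml -sumEFin; apply: eq_bigr => i _.
by rewrite -branch_weight_fiber -EFinM.
Qed.

(** By invariance [total_weight] integrates over each [A] to [mu (f^{-1} A) = mu A]: it is the
    density of [mu] with respect to itself. *)
Lemma total_weight_ae : {ae mu, forall x, total_weight x = 1}.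
Proof.
have : {ae mu, forall x, (total_weight x)%:E = 1%E}.
  apply: ae_eq_density => //.
  - by apply/measurable_EFinP; exact: measurable_total_weight.
  - by move=> x; rewrite lee_fin sumr_ge0// => i _; exact: branch_weight_ge0.
  - have := total_weight_indic (@measurableT _ (borel X)).
    under eq_integral do rewrite indicT mule1.
    by move=> ->; rewrite probability_setT ltry.
  - move=> A mA; rewrite total_weight_indic// -int_indic//.
    by apply: eq_integral => x _; rewrite mul1e.
by apply: ae_imply => x [].
Qed.

(** The point mass on the null set where the weights fail to add up to 1 makes this a probability
    kernel everywhere. *)
Definition fiber_kernel (x : borel X) : {measure set (borel X) -> \bar R} :=
  if total_weight x == 1 then
    (msum (fun i => mscale (NngNum (branch_weight_ge0 i x))
      (dirac (branch i x : borel X))) N : {measure set (borel X) -> \bar R})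
  else (dirac x : {measure set (borel X) -> \bar R}).

Lemma fiber_kernelE x (A : set (borel X)) : total_weight x = 1 ->
  (fiber_kernel x A =
   \sum_(i < N) (branch_weight i x)%:E * (\1_A (branch i x))%:E)%E.
Proof. by rewrite /fiber_kernel => ->; rewrite eqxx. Qed.

Let measurable_fiber_kernel (A : set (borel X)) : measurable A ->
  measurable_fun setT (fiber_kernel ^~ A).
Proof.
move=> mA.
have -> : (fiber_kernel ^~ A) = (fun x => if total_weight x == 1
    then (\sum_(i < N) (branch_weight i x)%:E * (\1_A (branch i x))%:E)%E
    else (\1_A x)%:E).
  by apply/funext => x; rewrite /fiber_kernel; case: ifP.
apply: measurable_fun_ifT.
- apply: measurable_fun_eqr => //; exact: measurable_total_weight.
- apply: emeasurable_sum => i; apply: emeasurable_funM.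
    by apply/measurable_EFinP; exact: measurable_branch_weight.
  exact: (measurableT_comp (mindE mA) (measurable_branch i)).
- exact: mindE.
Qed.

HB.instance Definition _ := isKernel.Build _ _ (borel X) (borel X) R
  fiber_kernel measurable_fiber_kernel.

Let prob_fiber_kernel x : fiber_kernel x [set: borel X] = 1%E.
Proof.
have [w1|w1] := eqVneq (total_weight x) 1.
  rewrite fiber_kernelE// -[RHS]/(1%:E) -w1 -sumEFin.
  by apply: eq_bigr => i _; rewrite indicT mule1.
rewrite /fiber_kernel (negbTE w1). exact: (@probability_setT _ _ R (\d_x)).
Qed.

HB.instance Definition _ := Kernel_isProbability.Build _ _ (borel X) (borel X) R
  fiber_kernel prob_fiber_kernel.

Lemma measurable_fiber x : measurable (f @^-1` [set x] : set (borel X)).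
Proof.
apply: mfpre; apply: closed_borel; apply: accessible_closed_set1.
apply: hausdorff_accessible; exact: metric_hausdorff.
Qed.

Lemma ex_fiber_disintegration :
  exists kappa : R.-pker (borel X) ~> (borel X),
    fiber_disintegration (f : borel X -> borel X) mu kappa.
Proof.
exists fiber_kernel; split.
  move=> A mA; rewrite -(int_indic mA) -[LHS]integral_sum_branch//; last exact: mindE.
  apply: integral_eq_ae; apply: ae_imply total_weight_ae => x w1.
  by rewrite fiber_kernelE.
apply: ae_imply total_weight_ae => x w1; rewrite fiber_kernelE//.
rewrite -[RHS]/(1%:E) -w1 -sumEFin; apply: eq_bigr => i _.
have [fx|nfx] := pselect ((f @` K i) x).
  by rewrite indicE mem_set ?mule1//=; have [_ ->] := branchP fx.
by rewrite /branch_weight [\1_(f @` _) _]indicE memNset// mul0r mul0e.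
Qed.

Section uniqueness.
Variable kappa : R.-pker (borel X) ~> (borel X).
Hypothesis dis : fiber_disintegration (f : borel X -> borel X) mu kappa.

Let kT x : kappa x [set: borel X] = 1%E. Proof. exact: prob_kernel. Qed.

(** Uniqueness of conditional measures, tested on cells: over any [A] both sides integrate to the
    measure of the part of [K n] that [f] maps into [A]. *)
Lemma disintegration_cell n :
  {ae mu, forall x, kappa x (K n) = (branch_weight n x)%:E}.
Proof.
case: dis => dis1 dis2.
have kle x : (kappa x (K n) <= 1)%E.
  by rewrite -(kT x); apply: le_measure; rewrite ?inE.
apply: ae_eq_density.
- exact: measurable_kernel.
- by apply/measurable_EFinP; exact: measurable_branch_weight.
- by move=> x; exact: measure_ge0.
- apply: (@le_lt_trans _ _ (\int[mu]_x (cst 1%E x))%E).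
    by apply: ge0_le_integral => //; exact: measurable_kernel.
  by rewrite integral_cst_probability ltry.
move=> A mA.
have mKA : measurable (K n `&` f @^-1` A : set (borel X)).
  by apply: measurableI => //; exact: mfpre.
transitivity (mu (K n `&` f @^-1` A)).
  rewrite dis1//; apply: integral_eq_ae; apply: ae_imply dis2 => x kx.
  have mF := measurable_fiber x.
  rewrite indicE; have [Ax|nAx] := pselect (A x).
    rewrite mem_set// mule1.
    rewrite -(full_setI mF (kT x) kx mKA).
    rewrite -(full_setI mF (kT x) kx (mK n)).
    congr (kappa x _); apply/seteqP; split => y; last by move=> [[Ky _] fyx].
    by move=> [Ky fyx]; split => //; split => //=; rewrite fyx.
  rewrite memNset// mule0 (full_setC_sub mF (kT x) kx)// => y [_ Afy] /= fyx.
  by apply: nAx; rewrite -fyx.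
rewrite -(int_indic mKA).
transitivity (\int[mu]_x ((branch_weight n x)%:E * ((\1_A (f (branch n x)))%:E)))%E.
  rewrite (integral_branch n (phi := fun y => (\1_A (f y))%:E))//.
    by apply: eq_integral => y _; rewrite indicI EFinM.
  by apply: (mindE (A := f @^-1` A)); exact: mfpre.
by apply: eq_integral => x _; rewrite -!EFinM branch_weight_fiber.
Qed.

Let measurable_point (y : X) : measurable ([set y] : set (borel X)).
Proof.
apply: closed_borel; apply: accessible_closed_set1.
apply: hausdorff_accessible; exact: metric_hausdorff.
Qed.

(** A fiber meets each cell in at most one point, so the cell masses are point masses [1 / J y],
    each contributing [ln (J y) / J y]. Countability of the fiber excludes the infinite case of
    [point_entropy]. *)
Lemma point_entropy_fiber x : kappa x (f @^-1` [set x]) = 1%E ->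
  (forall n, kappa x (K n) = (branch_weight n x)%:E) ->
  (point_entropy (kappa x) =
   \sum_(i < N) (branch_weight i x)%:E * (ln (J (branch i x)))%:E)%E.
Proof.
move=> kx kK; case: pK => _ tK UK.
have mF := measurable_fiber x.
have pt0 y : f y <> x -> kappa x [set y] = 0%E.
  by move=> fyx; apply: (full_setC_sub mF (kT x) kx) => // _ -> .
have pt n y : K n y -> f y = x -> kappa x [set y] = ((J y)^-1)%:E.
  move=> Ky fyx.
  have -> : (J y)^-1 = branch_weight n x.
    rewrite /branch_weight indicE mem_set; last by exists y.
    by rewrite -fyx branchK// mul1r.
  rewrite -kK -(full_setI mF (kT x) kx (mK n)).
  congr (kappa x _); apply/seteqP; split => z; first by move=> ->.
  by move=> [Kz fzx]; apply: (injK Kz Ky); rewrite fyx.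
have xl0 y : f y <> x -> xlogx_opp (kappa x [set y]) = 0%E.
  by move=> /pt0 ->; rewrite /xlogx_opp mul0e oppe0.
have xl n y : K n y -> f y = x ->
    xlogx_opp (kappa x [set y]) = ((J y)^-1 * ln (J y))%:E.
  move=> Ky fyx; rewrite (pt n)// /xlogx_opp lne_EFin ?invr_gt0//.
  by rewrite lnV ?posrE// -EFinM -EFinN mulrN opprK.
rewrite /point_entropy asboolT; last first.
  exists (f @^-1` [set x]); split; [exact: measurable_fiber| |exact: full_setC].
  apply: (@sub_countable _ _ _ (\bigcup_(n in [set: nat]) [set branch n x])); last first.
    by apply: bigcup_countable.
  apply: subset_card_le => y fyx; have : [set: X] y by [].
  rewrite -UK => -[n _ Ky]; exists n => //=.
  by rewrite -fyx branchK.
have xl_ge0 y : (0 <= xlogx_opp (kappa x [set y]))%E.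
  have [fyx|/xl0 -> //] := pselect (f y = x).
  have : [set: X] y by [].
  rewrite -UK => -[n _ Ky].
  by rewrite (xl n)// lee_fin mulr_ge0 ?ln_ge0// invr_ge0 ltW.
transitivity (\esum_(y in [set: borel X])
    \sum_(i < N) (\1_(K i) y)%:E * xlogx_opp (kappa x [set y]))%E.
  apply: eq_esum => y _; rewrite -ge0_sume_distrl//.
  by rewrite sumEFin sum_indic_partition mul1e.
rewrite esum_sum; last by move=> y i _ _; rewrite mule_ge0// lee_fin.
apply: eq_bigr => i _.
transitivity (\esum_(y in [set branch i x])
    ((branch_weight i x)%:E * (ln (J (branch i x)))%:E))%E; last first.
  rewrite esum_set1// mule_ge0// lee_fin ?branch_weight_ge0//.
  by rewrite ln_ge0.
rewrite [RHS]esum_mkcond; apply: eq_esum => y _.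
have bw0 : ~ (f @` K i) x -> branch_weight i x = 0.
  by move=> h; rewrite /branch_weight indicE memNset ?mul0r.
have [Ky|nKy] := pselect (K i y); last first.
  rewrite [\1_(K i) y]indicE memNset// mul0e; case: ifP => //; rewrite inE => ybi.
  rewrite bw0 ?mul0e// => /branchP[+ _]; rewrite -ybi; exact: nKy.
rewrite [\1_(K i) y]indicE mem_set// mul1e.
have [fyx|fyx] := pselect (f y = x).
  have yb : y = branch i x by rewrite -fyx branchK.
  rewrite (xl i)// mem_set//= -yb -EFinM; congr (_%:E).
  by rewrite /branch_weight indicE mem_set -?yb ?mul1r//; exists y.
rewrite xl0//; case: ifP => //; rewrite inE => ybi.
rewrite bw0 ?mul0e// => /branchP[_]; rewrite -ybi; exact: fyx.
Qed.

Lemma integral_point_entropy :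
  (\int[mu]_x point_entropy (kappa x) = \int[mu]_x (ln (J x))%:E)%E.
Proof.
rewrite -[RHS]integral_sum_branch.
- apply: integral_eq_ae.
  have h : {ae mu, forall x, forall n, kappa x (K n) = (branch_weight n x)%:E}.
    by apply/ae_foralln => n; exact: disintegration_cell.
  case: dis => _ dis2.
  by apply: filterS2 dis2 h => x; exact: point_entropy_fiber.
- apply/measurable_EFinP; exact: (measurableT_comp (@measurable_ln R) mJ).
- by move=> x; rewrite lee_fin ln_ge0.
Qed.

End uniqueness.

End branches.

(** Uniqueness gives every disintegration the same value; existence keeps [xget] from returning its
    default 0. *)
Lemma folding_entropyE :
  folding_entropy (f : borel X -> borel X) mu = (\int[mu]_x (ln (J x))%:E)%E.
Proof.
have [N [K [pK KN injK]]] := injective_partition.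
rewrite /folding_entropy; case: xgetP => [h _ [kappa dis ->]|].
  exact: (integral_point_entropy pK KN injK dis).
have [kappa dis] := ex_fiber_disintegration pK KN injK.
by move=> /(_ (\int[mu]_x point_entropy (kappa x))%E); case; exists kappa.
Qed.

End folding.

(** * Local inverse entropy *)

Section limits.
Context (R : realType).
Implicit Types (u : (\bar R)^nat) (a H : \bar R).

Lemma limn_einf_ge u a : (\forall n \near \oo, (a <= u n)%E) -> (a <= limn_einf u)%E.
Proof.
move=> [N _ hN]; rewrite limn_einf_lim; apply: lime_ge; first exact: is_cvg_einfs.
near=> n; apply: le_ereal_inf_tmp => _ [k /= nk <-]; apply: hN => /=.
by apply: leq_trans nk; near: n; exact: nbhs_infty_ge.
Unshelve. all: by end_near. Qed.

Lemma limn_esup_le u a : (\forall n \near \oo, (u n <= a)%E) -> (limn_esup u <= a)%E.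
Proof.
move=> [N _ hN]; rewrite limn_esup_lim; apply: lime_le; first exact: is_cvg_esups.
near=> n; apply: ge_ereal_sup => _ [k /= nk <-]; apply: hN => /=.
by apply: leq_trans nk; near: n; exact: nbhs_infty_ge.
Unshelve. all: by end_near. Qed.

(** Testing with all real [a < H] treats a finite [H] and [+oo] alike, as is needed when the entropy
    of [f] is infinite. *)
Lemma cvge_from_below (T : Type) (F : set_system T) (FF : Filter F)
    (g : T -> \bar R) H : H != -oo%E ->
  (\forall x \near F, (g x <= H)%E) ->
  (forall a : R, (a%:E < H)%E -> \forall x \near F, (a%:E <= g x)%E) ->
  g @ F --> H.
Proof.
case: H => [r| |]// _ gle gge; last first.
  by apply/cvgeyPge => A; apply: gge; exact: ltry.
apply/fine_cvgP; split.
  have := gge (r - 1); rewrite lte_fin => /(_ _) h.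
  near=> x; rewrite fin_numElt; apply/andP; split.
    apply: (@lt_le_trans _ _ (r - 1)%:E); first exact: ltNyr.
    by near: x; apply: h; lra.
  by apply: (@le_lt_trans _ _ r%:E); [near: x|exact: ltry].
apply/cvgrPdist_le => e e0.
have h : \forall x \near F, ((r - e)%:E <= g x)%E by apply: gge; rewrite lte_fin; lra.
near=> x => /=.
have : (g x <= r%:E)%E by near: x.
have : ((r - e)%:E <= g x)%E by near: x.
case: (g x) => [t| |]//=; rewrite !lee_fin => h1 h2.
by rewrite ger0_norm; lra.
Unshelve. all: by end_near. Qed.

Lemma ae_forall_rat d (T : measurableType d) (P : {measure set T -> \bar R})
    (A : rat -> T -> Prop) :
  (forall q, {ae P, forall x, A q x}) -> {ae P, forall x, forall q, A q x}.
Proof.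
move=> h; pose B n x := if unpickle n is Some q then A q x else True.
have : {ae P, forall x, forall n, B n x}.
  apply: ae_foralln => n; rewrite /B; case: (unpickle n) => [q|]; first exact: h.
  exact: aeW.
by apply: ae_imply => x Bx q; have := Bx (pickle q); rewrite /B pickleK.
Qed.

Lemma le_from_rat a H : H != -oo%E ->
  (forall q : rat, (H < (ratr q)%:E)%E -> (a <= (ratr q)%:E)%E) -> (a <= H)%E.
Proof.
case: H => [r| |]// _ h; last exact: leey.
apply/lee_addgt0Pr => e e0.
have [|q] := @rat_in_itvoo R r (r + e); first by lra.
rewrite in_itv/= => /andP[q1 q2].
by apply: (le_trans (h q _)); rewrite ?lte_fin// -EFinD lee_fin ltW.
Qed.

Lemma rat_between (a : R) H : (a%:E < H)%E ->
  exists2 q : rat, a < ratr q & ((ratr q)%:E < H)%E.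
Proof.
case: H => [r| |]//; last first.
  move=> _; have [|q] := @rat_in_itvoo R a (a + 1); first by lra.
  by rewrite in_itv/= => /andP[q1 q2]; exists q => //; exact: ltry.
rewrite lte_fin => ar; have [q] := rat_in_itvoo ar.
by rewrite in_itv/= => /andP[q1 q2]; exists q => //; rewrite lte_fin.
Qed.

End limits.

(** * The formula for the inverse entropy *)

Section inverse_entropy_formula.
Context (R : realType) (X : pmetricType R).
Variable f : X -> X.
Local Notation Omega := {ptws nat -> X}.
Local Notation shiftO := (@left_shift R X : borel Omega -> borel Omega).
Hypothesis cX : compact [set: X].
Hypothesis cf : continuous f.
Hypothesis lif : locally_injective f.
Variables (mu : probability (borel X) R) (muh : probability (borel Omega) R).
Hypothesis lift : is_inverse_limit_lift f mu muh.
Variable J : X -> R.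
Hypothesis jac : is_jacobian (f : borel X -> borel X) mu (J : borel X -> R).
Hypothesis clD : closed (discontinuities J).
Hypothesis D0 : mu (discontinuities J) = 0%E.
Variable L : R.
Hypothesis J_le : forall x, ln (J x) <= L.

Let mJ : measurable_fun setT (J : borel X -> R). Proof. by case: jac. Qed.
Let J1 x : 1 <= J x. Proof. by case: jac. Qed.
Let lnJ0 x : 0 <= ln (J x). Proof. exact: ln_ge0. Qed.
Let L0 : 0 <= L. Proof. exact: le_trans (lnJ0 point) (J_le point). Qed.

Let mlnJ : measurable_fun setT ((fun x => ln (J x)) : borel X -> R).
Proof. exact: (measurableT_comp (@measurable_ln R) mJ). Qed.

(** Regularity encloses the null set of discontinuities in an open [U] of small measure. On the
    compact complement [J] is continuous at every point, and the variation is uniformly small; on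
    [U] it is bounded by the range [[0, L]] of [ln J]. *)
Lemma log_jacobian_oscillation (r eta : R) : 0 < r -> 0 < eta ->
  exists e (U : set X), [/\ 0 < e, open U, (mu U < eta%:E)%E &
    forall x y, mdist x y < e -> `|ln (J y) - ln (J x)| <= r + L * \1_U x].
Proof.
move=> r0 eta0.
have mD : measurable (discontinuities J : set (borel X)) by exact: closed_borel.
have [C [U [clC oU CD DU CU]]] := borel_regular mu mD eta0.
have cU : compact (~` U).
  by apply: (@subclosed_compact _ _ setT) => //; exact: open_closedC.
pose Q (B : set X) := forall y z, B y -> B z -> `|ln (J y) - ln (J z)| <= r.
have [||e e0 he] := @lebesgue_number R X (~` U) Q cU.
- by move=> A B AB QB y z /AB By /AB Bz; exact: QB.
- move=> x nUx.
  have cJ : {for x, continuous J} by apply: contrapT => h; apply: nUx; exact: DU.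
  have clnJ : {for x, continuous (fun y => ln (J y))}.
    apply: (@continuous_comp _ _ _ J (@ln R)) => //.
    by apply: continuous_ln; rewrite (lt_le_trans ltr01).
  have r2 : 0 < r / 2 by rewrite divr_gt0.
  move/cvgrPdist_le : clnJ => /(_ _ r2) /nbhs_ballP[s /= s0 hs].
  exists s => // y z xy xz.
  have hy := hs y; have hz := hs z; rewrite !ballP in hy hz.
  have {}hy := hy xy; have {}hz := hz xz.
  move: hy hz; rewrite /= !ler_norml => /andP[? ?] /andP[? ?].
  by apply/andP; split; lra.
have mU : measurable (U : set (borel X)) by exact: open_borel.
have mC : measurable (C : set (borel X)) by exact: closed_borel.
exists e, U; split => //.
- have -> : (mu U = mu (U `\` C) + mu (U `&` C))%E by exact: measureDI.
  suff -> : mu (U `&` C) = 0%E by rewrite adde0.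
  apply/eqP; rewrite eq_le measure_ge0 andbT -D0.
  by apply: le_measure; rewrite ?inE//; [exact: measurableI|move=> x [_ /CD]].
- move=> x y xy; have [Ux|nUx] := pselect (U x).
    rewrite indicE mem_set// mulr1 ler_norml.
    have := lnJ0 x; have := lnJ0 y; have := J_le x; have := J_le y.
    by move=> ? ? ? ?; apply/andP; split; lra.
  rewrite indicE memNset// mulr0 addr0; apply: (he x nUx y x) => //=.
  by rewrite mdistxx.
Qed.

Let F := fine (\int[mu]_x (ln (J x))%:E).

Let intF : (\int[mu]_x (ln (J x))%:E = F%:E)%E.
Proof.
rewrite fineK// ge0_fin_numE; last by apply: integral_ge0 => x _; rewrite lee_fin.
apply: (@le_lt_trans _ _ (\int[mu]_x L%:E)%E); last first.
  by rewrite integral_cst_probability ltry.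
apply: ge0_le_integral => //.
- by move=> x _; rewrite lee_fin.
- exact/measurable_EFinP.
- by move=> x _; rewrite lee_fin.
Qed.

Let int_compl : (\int[mu]_x (L - ln (J x))%:E = (L - F)%:E)%E.
Proof.
have h : (\int[mu]_x (L - ln (J x))%:E + F%:E = L%:E)%E.
  rewrite -intF -ge0_integralD//.
  - by under eq_integral do rewrite -EFinD subrK; rewrite integral_cst_probability.
  - by move=> x _; rewrite lee_fin subr_ge0.
  - by apply/measurable_EFinP; exact: measurable_funB.
  - by move=> x _; rewrite lee_fin.
  - exact/measurable_EFinP.
case: (\int[mu]_x (L - ln (J x))%:E)%E h => [t| |]//.
by rewrite -EFinD EFinB => -[<-]; rewrite -EFinB addrK.
Qed.

(** The mean is at most [t + r + L * mu U <= t + 2 * r]; the third [r] gives the strict inequality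
    that Birkhoff's bound asks for. *)
Let int_error (g : X -> R) (t r : R) (U : set (borel X)) :
  measurable_fun setT (g : borel X -> R) -> (forall x, 0 <= g x) ->
  (\int[mu]_x (g x)%:E = t%:E)%E -> 0 < r -> measurable U ->
  (L%:E * mu U <= r%:E)%E ->
  {ae muh, forall xh : Omega, \forall n \near \oo,
    birkhoff_sum shiftO (fun yh => g (yh 1%N) + (r + L * \1_U (yh 1%N))) n xh <=
    (t + 3 * r) * n%:R}.
Proof.
move=> mg g0 gt r0 mU LU.
have mc : measurable_fun setT ((fun x => r + L * \1_U x) : borel X -> R).
  by apply: measurable_funD => //; apply: measurable_funM => //; exact: measurable_indic.
have c0 x : 0 <= r + L * \1_U x by rewrite addr_ge0 ?(ltW r0)// mulr_ge0.
have mgc : measurable_fun setT ((fun x => g x + (r + L * \1_U x)) : borel X -> R).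
  exact: measurable_funD.
apply: (birkhoff_eventually_le (@measurable_shift R X)
  (muh_shift_invariant lift) (muh_shift_ergodic lift)
  (phi := fun yh : Omega => g (yh 1%N) + (r + L * \1_U (yh 1%N)))).
- exact: (measurableT_comp mgc (@measurable_coord R X 1)).
- by move=> yh; rewrite addr_ge0.
rewrite (integral_comp_preserving (m2 := mu) (f := fun yh : borel Omega => yh 1%N)
  (g := fun x => (g x + (r + L * \1_U x))%:E)).
- have -> : (\int[mu]_x (g x + (r + L * \1_U x))%:E =
      \int[mu]_x (g x)%:E + \int[mu]_x (r + L * \1_U x)%:E)%E.
    rewrite -ge0_integralD//.
    + by move=> x _; rewrite lee_fin.
    + exact/measurable_EFinP.
    + by move=> x _; rewrite lee_fin.
    + exact/measurable_EFinP.
  rewrite gt.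
  have -> : (\int[mu]_x (r + L * \1_U x)%:E = r%:E + L%:E * mu U)%E.
    rewrite -integral_indicE// -(integral_cst_probability mu r%:E) -ge0_integralD//.
    + by move=> x _; rewrite lee_fin ltW.
    + by move=> x _; rewrite lee_fin mulr_ge0.
    + by apply/measurable_EFinP; apply: measurable_funM => //; exact: measurable_indic.
  apply: (@le_lt_trans _ _ (t%:E + (r%:E + r%:E))%E); first by rewrite !leeD2l.
  by rewrite -!EFinD lte_fin; lra.
- exact: measurable_coord.
- by move=> A mA; exact: (muh_coord lift).
- exact/measurable_EFinP.
- by move=> x; rewrite lee_fin addr_ge0.
Qed.

Lemma jacobian_cocycle_bounds (r : R) : 0 < r ->
  exists2 e, 0 < e & exists c : X -> R,
  [/\ forall x y, mdist x y < e -> `|ln (J y) - ln (J x)| <= c x,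
    {ae muh, forall xh : Omega, \forall n \near \oo,
      birkhoff_sum shiftO (fun yh => ln (J (yh 1%N)) + c (yh 1%N)) n xh <=
      (F + 3 * r) * n%:R} &
    {ae muh, forall xh : Omega, \forall n \near \oo,
      (F - 3 * r) * n%:R <=
      birkhoff_sum shiftO (fun yh => ln (J (yh 1%N)) - c (yh 1%N)) n xh}].
Proof.
move=> r0; have eta0 : 0 < r / (L + 1) by rewrite divr_gt0// ltr_wpDl.
have [e [U [e0 oU Ueta osc]]] := log_jacobian_oscillation r0 eta0.
have mU : measurable (U : set (borel X)) by exact: open_borel.
have LU : (L%:E * mu U <= r%:E)%E.
  apply: (@le_trans _ _ (L%:E * (r / (L + 1))%:E)%E).
    by apply: lee_wpmul2l; rewrite ?lee_fin// ltW.
  rewrite -EFinM lee_fin mulrCA ger_pMr// ler_pdivrMr ?mul1r ?lerDl//.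
  by rewrite ltr_wpDl.
exists e => //; exists (fun x => r + L * \1_U x); split => //.
  exact: (int_error mlnJ lnJ0 intF r0 mU LU).
have mcompl : measurable_fun setT ((fun x => L - ln (J x)) : borel X -> R).
  exact: measurable_funB.
have compl0 x : 0 <= L - ln (J x) by rewrite subr_ge0.
have := int_error mcompl compl0 int_compl r0 mU LU.
apply: ae_imply => xh; apply: filterS => n.
have -> : birkhoff_sum shiftO (fun yh => L - ln (J (yh 1%N)) + (r + L * \1_U (yh 1%N))) n xh =
    L * n%:R -
    birkhoff_sum shiftO (fun yh => ln (J (yh 1%N)) - (r + L * \1_U (yh 1%N))) n xh.
  rewrite -(birkhoff_sum_cst shiftO L n xh) /birkhoff_sum -sumrB.
  by apply: eq_bigr => i _; ring.
lra.
Qed.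

Lemma past_ball_mono n (xh : Omega) (e1 e2 : R) : e1 <= e2 ->
  past_ball n xh e1 `<=` past_ball n xh e2.
Proof. by move=> e12 yh h i ni; rewrite (lt_le_trans (h i ni)). Qed.

Lemma inverse_bowen_ball_mono n (xh : Omega) (e1 e2 : R) : e1 <= e2 ->
  inverse_bowen_ball f n xh e1 `<=` inverse_bowen_ball f n xh e2.
Proof.
move=> e12 y [yh yhL [<- h]]; exists yh => //; split => // i ni.
by rewrite (lt_le_trans (h i ni)).
Qed.

Let le_mu_inverse_bowen_ball n (xh : Omega) (e1 e2 : R) : e1 <= e2 ->
  (mu (inverse_bowen_ball f n xh e1) <= mu (inverse_bowen_ball f n xh e2))%E.
Proof.
move=> e12; apply: le_measure; rewrite ?inE; [exact: (measurable_inverse_bowen_ball cX cf)..|].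
exact: inverse_bowen_ball_mono.
Qed.

Let rate_ge n (xh : Omega) e (a : R) : (0 < n)%N ->
  (mu (inverse_bowen_ball f n xh e) <= (expR (- a * n%:R))%:E)%E ->
  (a%:E <= inverse_ball_rate f mu xh e n)%E.
Proof.
move=> n0 h; have n0' : 0 < n%:R :> R by rewrite ltr0n.
have : (lne (mu (inverse_bowen_ball f n xh e)) <= (- a * n%:R)%:E)%E.
  rewrite -[X in (_ <= X%:E)%E]expRK -lne_EFin ?expR_gt0// lee_lne//.
    by rewrite in_itv/= measure_ge0 leey.
  by rewrite in_itv/= lee_fin expR_ge0 leey.
rewrite /inverse_ball_rate; case: (lne _) => [t| |]//=; last first.
  by move=> _; rewrite /= mulry gtr0_sg ?invr_gt0// mul1e leey.
rewrite lee_fin => ht; rewrite -?EFinN -?EFinM lee_fin mulrC ler_pdivlMr//; lra.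
Qed.

Let rate_le n (xh : Omega) e (a : R) : (0 < n)%N ->
  ((expR (- a * n%:R))%:E <= mu (inverse_bowen_ball f n xh e))%E ->
  (inverse_ball_rate f mu xh e n <= a%:E)%E.
Proof.
move=> n0 h; have n0' : 0 < n%:R :> R by rewrite ltr0n.
have : ((- a * n%:R)%:E <= lne (mu (inverse_bowen_ball f n xh e)))%E.
  rewrite -[X in (X%:E <= _)%E]expRK -lne_EFin ?expR_gt0// lee_lne//.
    by rewrite in_itv/= lee_fin expR_ge0 leey.
  by rewrite in_itv/= measure_ge0 leey.
rewrite /inverse_ball_rate; case: (lne _) => [t| |]//=; last first.
  by move=> _; rewrite /= mulrNy gtr0_sg ?invr_gt0// mul1e leNye.
rewrite lee_fin => ht; rewrite -?EFinN -?EFinM lee_fin mulrC ler_pdivrMr//; lra.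
Qed.

(** The error function [c] does not depend on [e], so one null set and one threshold for [n] serve
    all radii [e <= e0]. *)
Lemma inverse_bowen_ball_measure (r : R) : 0 < r -> exists2 e0, 0 < e0 &
  {ae muh, forall xh : Omega, \forall n \near \oo, forall e, e <= e0 ->
    ((expR ((F - 3 * r) * n%:R))%:E * muh (past_ball n xh e) <=
       mu (inverse_bowen_ball f n xh e) <=
     (expR ((F + 3 * r) * n%:R))%:E * muh (past_ball n xh e))%E}.
Proof.
move=> r0; have [ei ei0 inj] := injectivity_radius cX lif.
have [eo eo0 [c [osc upper lower]]] := jacobian_cocycle_bounds r0.
(* Half the injectivity radius, since two points of a ball of radius [e] may be almost [2 * e]
   apart. *)
exists (Num.min (ei / 2) eo); first by rewrite lt_min eo0 divr_gt0.
apply: ae_imply2 upper lower => xh; apply: filterS2 => n up lo e.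
rewrite le_min => /andP[ei2 eeo].
have inj' x y z : mdist x y < e -> mdist x z < e -> f y = f z -> y = z.
  move=> xy xz; apply: inj; apply: (le_lt_trans (metric_triangle y x z)).
  by rewrite (metric_sym y x); lra.
have osc' x y : mdist x y < e -> `|ln (J y) - ln (J x)| <= c x.
  by move=> xy; apply: osc; exact: lt_le_trans eeo.
have /andP[h1 h2] := inverse_bowen_ball_bounds cX cf lift lif jac inj' osc' n xh.
apply/andP; split.
  by apply: le_trans h1; apply: lee_wpmul2r; rewrite ?lee_fin ?ler_expR.
by apply: (le_trans h2); apply: lee_wpmul2r; rewrite ?lee_fin ?ler_expR.
Qed.

Let h := metric_entropy (f : borel X -> borel X) mu.

(** With [r = (a - F - a') / 3] the exponents [F + 3 * r] and [- a] add up to [- a']. Monotonicity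
    in the radius handles all small [e] at once. *)
Lemma inverse_ball_rate_ge (a a' : R) : (a%:E < h)%E -> a' < a - F ->
  exists2 e0, 0 < e0 & {ae muh, forall xh : Omega, forall e, e <= e0 ->
    (a'%:E <= limn_einf (inverse_ball_rate f mu xh e))%E}.
Proof.
move=> ah a'a.
have [ee ee0 ent] := past_ball_entropy_ge cX cf lift ah.
have r0 : 0 < (a - F - a') / 3 by rewrite divr_gt0//; lra.
have [eo eo0 comp] := inverse_bowen_ball_measure r0.
exists (Num.min ee eo); first by rewrite lt_min ee0.
apply: ae_imply2 ent comp => xh ent comp e; rewrite le_min => /andP[eee eeo].
apply: limn_einf_ge; near=> n.
have n0 : (0 < n)%N by near: n; exact: nbhs_infty_gt.
apply: rate_ge => //.
have /(_ _ eeo) /andP[_ le1] : forall e, e <= eo ->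
    ((expR ((F - 3 * ((a - F - a') / 3)) * n%:R))%:E * muh (past_ball n xh e) <=
       mu (inverse_bowen_ball f n xh e) <=
     (expR ((F + 3 * ((a - F - a') / 3)) * n%:R))%:E * muh (past_ball n xh e))%E.
  by near: n.
apply: (le_trans le1).
have pe : (muh (past_ball n xh e) <= (expR (- a * n%:R))%:E)%E.
  apply: (@le_trans _ _ (muh (past_ball n xh ee))); last by near: n.
  by apply: le_measure; rewrite ?inE; [exact: measurable_past_ball..|exact: past_ball_mono].
apply: (le_trans (lee_wpmul2l _ pe)); first by rewrite lee_fin expR_ge0.
by rewrite -EFinM -expRD lee_fin ler_expR -mulrDl ler_wpM2r//; lra.
Unshelve. all: by end_near. Qed.

Lemma inverse_ball_rate_le (b b' : R) : (h < b%:E)%E -> b - F < b' ->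
  {ae muh, forall xh : Omega, forall e, 0 < e ->
    (limn_esup (inverse_ball_rate f mu xh e) <= b'%:E)%E}.
Proof.
move=> hb bb'.
have r0 : 0 < (b' - (b - F)) / 3 by rewrite divr_gt0//; lra.
have [eo eo0 comp] := inverse_bowen_ball_measure r0.
(* Countably many radii tending to 0, to keep a single null set; a ball of any radius contains a
   ball of one of these. *)
pose ek k : R := Num.min eo k.+1%:R^-1.
have ek0 k : 0 < ek k by rewrite lt_min eo0 invr_gt0 ltr0n.
have ent : {ae muh, forall xh : Omega, forall k, \forall n \near \oo,
    ((expR (- b * n%:R))%:E <= muh (past_ball n xh (ek k)))%E}.
  by apply: ae_foralln => k; exact: (past_ball_entropy_le cX cf lift hb (ek0 k)).
apply: ae_imply2 ent comp => xh ent comp e e0.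
have [k ke] : exists k, ek k <= e.
  exists (Num.truncn e^-1); rewrite ge_min; apply/orP; right.
  by rewrite invf_ple ?posrE// ltW// truncnS_gt.
apply: limn_esup_le; near=> n.
have n0 : (0 < n)%N by near: n; exact: nbhs_infty_gt.
apply: rate_le => //.
apply: (le_trans _ (le_mu_inverse_bowen_ball n xh ke)).
have : forall e, e <= eo ->
    ((expR ((F - 3 * ((b' - (b - F)) / 3)) * n%:R))%:E * muh (past_ball n xh e) <=
       mu (inverse_bowen_ball f n xh e) <=
     (expR ((F + 3 * ((b' - (b - F)) / 3)) * n%:R))%:E * muh (past_ball n xh e))%E.
  by near: n.
move=> /(_ (ek k)); rewrite ge_min lexx => /(_ isT) /andP[le1 _].
apply: le_trans le1.
have pe : ((expR (- b * n%:R))%:E <= muh (past_ball n xh (ek k)))%E by near: n; exact: ent.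
apply: (le_trans _ (lee_wpmul2l _ pe)); last by rewrite lee_fin expR_ge0.
by rewrite -EFinM -expRD lee_fin ler_expR -mulrDl ler_wpM2r//; lra.
Unshelve. all: by end_near. Qed.

(** The one-cell partition has entropy 0. This rules out [h = -oo], so that [h - F] satisfies the
    hypothesis of [cvge_from_below]. *)
Let h_ge0 : (0 <= h)%E.
Proof.
apply: ereal_sup_ubound; exists 1%N, (fun=> setT); split.
  split => //; first by move=> i j _ _ _; rewrite !ord1.
  by apply/seteqP; split => // x _; exists ord0.
rewrite /partition_entropy (_ : (fun n => _) = fun=> 0%E) ?lim_cst//.
apply/funext => n; rewrite /join_entropy big1 ?mule0// => w _.
rewrite /xlogx_opp (_ : itinerary_cell _ _ _ = setT); last by apply/seteqP; split.
by rewrite probability_setT lne1 mule0 oppe0.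
Qed.

(** Rational rates, countable in number, bound the lower limits from below and the upper limits from
    above; both local entropies are squeezed onto [h - F]. *)
Lemma local_inverse_entropyE : {ae muh, forall xh : Omega,
  local_inverse_entropy_inf f mu xh = (h - F%:E)%E /\
  local_inverse_entropy_sup f mu xh = (h - F%:E)%E}.
Proof.
have ge (q : rat) : {ae muh, forall xh : Omega, ((ratr q)%:E < h - F%:E)%E ->
    exists2 e0, 0 < e0 & forall e, e <= e0 ->
      ((ratr q)%:E <= limn_einf (inverse_ball_rate f mu xh e))%E}.
  have [qh|nqh] := pselect ((ratr q)%:E < h - F%:E)%E; last first.
    by apply: aeW => xh /nqh.
  have : ((ratr q + F)%:E < h)%E by rewrite EFinD -lteBrDr.
  move=> /rat_between[a qa ah].
  have [|e0 e00 he] := inverse_ball_rate_ge (a' := ratr q) ah; first by lra.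
  by apply: ae_imply he => xh he _; exists e0.
have le (q : rat) : {ae muh, forall xh : Omega, (h - F%:E < (ratr q)%:E)%E ->
    forall e, 0 < e -> (limn_esup (inverse_ball_rate f mu xh e) <= (ratr q)%:E)%E}.
  have [hq|nhq] := pselect (h - F%:E < (ratr q)%:E)%E; last first.
    by apply: aeW => xh /nhq.
  have [b hb bq] : exists2 b, (h < b%:E)%E & b - F < ratr q.
    case: h h_ge0 hq => [t| |]// _; rewrite -EFinB lte_fin => tq.
    exists ((t + (ratr q + F)) / 2); last by lra.
    by rewrite lte_fin; lra.
  by apply: ae_imply (inverse_ball_rate_le hb bq) => xh he _.
have H0 : (h - F%:E)%E != -oo%E.
  by case: h h_ge0.
apply: ae_imply2 (ae_forall_rat ge) (ae_forall_rat le) => xh {}ge {}le.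
have sup_le e : 0 < e -> (limn_esup (inverse_ball_rate f mu xh e) <= h - F%:E)%E.
  by move=> e0; apply: le_from_rat => // q /le; exact.
have inf_sup e := limn_einf_sup (inverse_ball_rate f mu xh e).
have inf_ge (a : R) : (a%:E < h - F%:E)%E -> \forall e \near 0^'+,
    (a%:E <= limn_einf (inverse_ball_rate f mu xh e))%E.
  move=> /rat_between[q /ltW aq /ge[e0 e00 hq]]; near=> e.
  by apply: (@le_trans _ _ (ratr q)%:E); rewrite ?lee_fin//; apply: hq; near: e;
    exact: nbhs_right_le.
split; apply: cvg_lim => //; apply: cvge_from_below => //.
- near=> e; apply: (le_trans (inf_sup e)); apply: sup_le; near: e.
  exact: nbhs_right_gt.
- near=> e; apply: sup_le; near: e; exact: nbhs_right_gt.
- move=> a /inf_ge; apply: filterS => e ae; exact: le_trans (inf_sup e).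
Unshelve. all: by end_near. Qed.

Lemma inverse_entropyE :
  inverse_entropy_inf f mu muh = (h - \int[mu]_x (ln (J x))%:E)%E /\
  inverse_entropy_sup f mu muh = (h - \int[mu]_x (ln (J x))%:E)%E.
Proof.
rewrite intF.
have aeL := ae_inverse_limit cf lift.
rewrite /inverse_entropy_inf /inverse_entropy_sup; split.
  rewrite integral_mkcond -[RHS](integral_cst_probability muh).
  apply: integral_eq_ae; apply: ae_imply2 aeL local_inverse_entropyE => xh xL [].
  by rewrite patchE mem_set.
rewrite integral_mkcond -[RHS](integral_cst_probability muh).
apply: integral_eq_ae; apply: ae_imply2 aeL local_inverse_entropyE => xh xL [].
by rewrite patchE mem_set.
Qed.

End inverse_entropy_formula.

Theorem theorem1p1 (R : realType) (X : pmetricType R) (f : X -> X)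
    (mu : probability (borel X) R)
    (muh : probability (borel {ptws nat -> X}) R)
    (J : X -> R) :
  compact [set: X] ->
  continuous f ->
  locally_injective f ->
  invariant_measure (f : borel X -> borel X) mu ->
  ergodic (f : borel X -> borel X) mu ->
  positively_nonsingular (f : borel X -> borel X) mu ->
  is_inverse_limit_lift f mu muh ->
  is_jacobian (f : borel X -> borel X) mu (J : borel X -> R) ->
  closed (discontinuities J) ->
  mu (discontinuities J) = 0%E ->
  [bounded J x | x in [set: X]] ->
  inverse_entropy_exists f mu muh /\
  inverse_entropy f mu muh =
    (metric_entropy (f : borel X -> borel X) mu
     - folding_entropy (f : borel X -> borel X) mu)%E.
Proof.
move=> cX cf lif invmu ergmu nonsing lift jac clD D0 bJ.
have mJ1 x : 1 <= J x by case: jac.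
have [L hL] : exists L, forall x, ln (J x) <= L.
  (* Boundedness gives a bound at every number above [M]; [|M| + 1] is one, and at least 1. *)
  have [M [_ hM]] := bJ; exists (ln (`|M| + 1)) => x.
  rewrite ler_ln ?posrE ?(lt_le_trans ltr01)//; last by rewrite lerDr.
  apply: le_trans (ler_norm _) _; apply: hM => //.
  by rewrite (le_lt_trans (ler_norm _))// ltrDl.
have [infE supE] := inverse_entropyE cX cf lif lift jac clD D0 hL.
split; first by rewrite /inverse_entropy_exists infE supE.
by rewrite /inverse_entropy infE (folding_entropyE cX cf lif invmu jac).
Qed.
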